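(* Let $(X,\tau,d,\mathfrak m)$ be a forward extended Polish metric measure space satisfying (A1) and (A3), let $p,q\in(1,\infty)$ with $\frac1p+\frac1q=1$, and let $\mathfrak T$ be a stretchable collection of $p$-test plans such that for any $\eta\in\mathfrak T$ and $M\ge0$ there is $C=C(\eta,M)\ge0$ with $$\int_0^1\bigl((e_t)_\sharp\eta\bigr)\bigl[\{x\in B:V(x)\le M\}\bigr]\,dt\le C\,\mathfrak m[B]\quad\text{for all Borel }B\subset X.$$ If $f\in\mathfrak D(\mathsf{Ch}^+_q)$ (i.e. $\mathsf{Ch}^+_q(f)<\infty$), then $f$ is Sobolev along $\mathfrak T$-almost every curve and $|D^+f|_{w,\mathfrak T}\le|D^+f|_{*,q}$ holds $\mathfrak m$-a.e. in $X$.
   Context: An asymmetric extended metric space $(X,d)$ is a set with $d:X\times X\to[0,\infty]$ such that $d(x,y)=0$ iff $x=y$, and $d(x,z)\le d(x,y)+d(y,z)$ (no symmetry). $B^+_x(r)=\{y:d(x,y)<r\}$. For $A\subset X$, $\lambda_d(A)=\inf\{\lambda\ge1: d(x,y)\le\lambda d(y,x)\ \forall x,y\in A\}$ ($\inf\emptyset=\infty$); $\lambda_d(X)$ is the reversibility. $X_{[x]}=\{y:d(x,y)<\infty\}$. $(X,d)$ is a forward extended metric space if $X$ is a disjoint union of sets $X_{[x_\alpha]}$ and there are non-decreasing functions $\Theta_\alpha:(0,\infty)\to[1,\infty)$ with $\lambda_d(B^+_{x_\alpha}(r))\le\Theta_\alpha(r)$ for all $r>0$; it carries the topology generated by forward balls,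 which coincides with that of the symmetrized metric $\hat d(x,y)=\frac12(d(x,y)+d(y,x))$ (the $d$-topology). It is forward complete if every sequence such that for all $\varepsilon>0$ there is $N$ with $d(x_i,x_j)<\varepsilon$ for $j\ge i\ge N$ converges in the $d$-topology. A forward extended Polish space $(X,\tau,d)$: (1) $(X,d)$ is a forward complete forward extended metric space; (2) $\tau$ is a Polish topology on $X$; (3) $d(x_i,x)\to0$ implies $x_i\to x$ in $\tau$; (4) $d$ is lower semi-continuous on $X\times X$ for $\tau\times\tau$. Unless $d$ is mentioned, topological notions refer to $\tau$. A forward extended Polish metric measure space $(X,\tau,d,\mathfrak m)$ is such a space with a nonnegative Borel $\sigma$-finite measure $\mathfrak m$. $f:X\to\mathbb R$ is forward Lipschitz if $f(y)-f(x)\le Cd(x,y)$ for all $x,y$ and some $C>0$. $(X,d)$ is a geodesic space if any $x,y$ with $d(x,y)<\infty$ are joined by a curve $\gamma$ from $x$ to $y$ of length $L_d(\gamma)=\sup\sum_id(\gamma(t_{i-1}),\gamma(t_i))=d(x,y)$. (A1) There is a Borel forward Lipschitz $V:X\to[0,\infty)$, bounded on every $\tau$-compact set, with $\int_Xe^{-V^2}\,d\mathfrak m\le1$; such $V$ is fixed. (A3) Either $\lambda_d(X)<\infty$, or $(X,d)$ is a geodesic space in which every $\tau$-compact set $K$ has finite diameter $\sup_{x,y\in K}d(x,y)<\infty$. Curves: $\gamma:I\to X$ is forward (resp. backward) $p$-absolutely continuous if there is $0\le g\in L^p(I)$ with $d(\gamma(s),\gamma(t))\le\int_s^t g$ (resp.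 $d(\gamma(t),\gamma(s))\le\int_s^tg$) for all $s\le t$ in $I$; $\mathsf{AC}^p(I;X)$ is the set of curves that are both. $|\gamma'_+|(t)=\lim_{h\to0^+}d(\gamma(t),\gamma(t+h))/h$ (exists a.e.). $C_\tau([0,1];X)$: $\tau$-continuous curves with the compact-open topology; $e_t(\gamma)=\gamma(t)$. A $p$-test plan is a Borel probability measure $\eta$ on $C_\tau([0,1];X)$ concentrated on $\mathsf{AC}^p([0,1];X)$ with $(e_t)_\sharp\eta\ll\mathfrak m$ for all $t\in[0,1]$. A collection $\mathfrak T$ of $p$-test plans is stretchable if for every $\eta\in\mathfrak T$ and $0\le t_1\le t_2\le1$ the push-forward of $\eta$ under $\gamma\mapsto\gamma((1-\cdot)t_1+\cdot\,t_2)$ is in $\mathfrak T$. A property holds for $\mathfrak T$-almost every curve if it holds $\eta$-a.e. for every $\eta\in\mathfrak T$. An $\mathfrak m$-measurable $G:X\to[0,\infty]$ is a $\mathfrak T$-weak forward upper gradient of $f$ if $f(\gamma(1))-f(\gamma(0))\le\int_0^1G(\gamma(s))|\gamma'_+|(s)\,ds<\infty$ for $\mathfrak T$-almost every $\gamma$; if one exists, there is an $\mathfrak m$-a.e. unique minimal one ($\le$ every other $\mathfrak m$-a.e.), denoted $|D^+f|_{w,\mathfrak T}$ (its existence is part of the conclusion). $f$ is Sobolev along $\mathfrak T$-almost every curve if for $\mathfrak T$-almost every $\gamma$, $f\circ\gamma$ coincides with an absolutely continuous function on $[0,1]$ at $\{0,1\}$ and a.e. in $(0,1)$. Relaxed gradients: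 $|D^+f|(x)=\limsup_{y\to x}\frac{[f(y)-f(x)]^+}{d(x,y)}$ ($d$-topology; $0$ at isolated points). For $f\in L^q(X,\mathfrak m)$, a nonnegative $G\in L^q$ is a relaxed ascending $q$-gradient of $f$ if there are $\tau$-Borel forward Lipschitz $f_i\in L^q$ with $f_i\to f$ in $L^q$, $|D^+f_i|\to\widetilde G$ weakly in $L^q$ and $\widetilde G\le G$ $\mathfrak m$-a.e. If one exists, the one with least $L^q$-norm is unique and denoted $|D^+f|_{*,q}$. For $\mathfrak m$-measurable $f:X\to\mathbb R$ put $f_N=\min\{\max\{f,-N\},N\}$. If every $f_N$, $N\in\mathbb N$, lies in $L^q$ and has a relaxed ascending $q$-gradient, set $|D^+f|_{*,q}:=|D^+f_N|_{*,q}$ on $\{|f|<N\}$ (consistent under (A3), and agreeing with the previous definition for $f\in L^q$) and $\mathsf{Ch}^+_q(f):=\frac1q\int_X|D^+f|_{*,q}^q\,d\mathfrak m$; otherwise $\mathsf{Ch}^+_q(f):=\infty$. *)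

(* Defs.v *)
From HB Require Import structures.
From mathcomp Require Import all_boot all_order all_algebra.
From mathcomp Require Import all_classical all_reals all_analysis.
From mathcomp Require Import measurable_realfun.

Set Implicit Arguments.
Unset Strict Implicit.
Unset Printing Implicit Defensive.

Import Order.TTheory GRing.Theory Num.Theory.
Import numFieldNormedType.Exports.

Local Open Scope classical_set_scope.
Local Open Scope ring_scope.

Notation borel X := (g_sigma_algebraType (@open X)).

Section AsymmetricMetric.
Context {R : realType} {X : choiceType}.
Implicit Types (d : X -> X -> \bar R) (A : set X) (x y : X).
Local Open Scope ereal_scope.

Definition asymmetric_extended_metric d :=
  [/\ forall x y, 0 <= d x y,
      forall x y, d x y = 0 <-> x = y &
      forall x y z, d x z <= d x y + d y z].

Definition fball d x (r : R) : set X := [set y | d x y < r%:E].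

Definition reversibility d A : \bar R :=
  ereal_inf [set l%:E | l in [set l : R | (1 <= l)%R /\
    forall x y, A x -> A y -> d x y <= l%:E * d y x]].

Definition finite_component d x : set X := [set y | d x y < +oo].

Definition forward_extended_metric d :=
  asymmetric_extended_metric d /\
  exists (I : Type) (c : I -> X) (Theta : I -> R -> R),
    [/\ trivIset [set: I] (fun i => finite_component d (c i)),
        \bigcup_i finite_component d (c i) = [set: X],
        forall i r, (0 < r)%R -> (1 <= Theta i r)%R,
        forall i r s, (0 < r)%R -> (r <= s)%R -> (Theta i r <= Theta i s)%R &
        forall i r, (0 < r)%R ->
          reversibility d (fball d (c i) r) <= (Theta i r)%:E].

(* Neighbourhoods of [x] in the topology generated by the forward balls: by the
   triangle inequality, [fball d y (r - d x y)] is included in [fball d x r]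
   for [y] in the latter, so the forward balls form a base and those centred at
   [x] form a neighbourhood base of [x]. *)
Definition fwd_nbhs d x : set_system X :=
  filter_from [set r : R | (0 < r)%R] (fball d x).

Definition forward_complete d := forall u : X^nat,
  (forall e : R, (0 < e)%R -> exists N, forall i j,
    (N <= i)%N -> (i <= j)%N -> d (u i) (u j) < e%:E) ->
  exists x : X, u n @[n --> \oo] --> fwd_nbhs d x.

Definition forward_Lipschitz d (f : X -> R) :=
  exists2 C : R, (0 < C)%R & forall x y, (f y - f x)%:E <= C%:E * d x y.

Definition curve_length d (g : R -> X) (a b : R) : \bar R :=
  ereal_sup [set \sum_(0 <= i < size s)
      d (g (nth b (a :: s) i)) (g (nth b s i)) | s in itv_partition a b].

(* Without the continuity of [g] every space would be geodesic, because of
   two-valued curves. *)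
Definition geodesic_space d := forall x y, d x y < +oo ->
  exists g : R -> X,
    [/\ g 0%R = x, g 1%R = y,
        forall t : R, t \in `[0%R, 1%R] ->
          g s @[s --> within `[0%R, 1%R]%classic (nbhs t)] --> fwd_nbhs d (g t) &
        curve_length d g 0 1 = d x y].

(* The ascending slope.  Near [x] the distance [d x y] is finite, and positive
   for [y != x]; the maximum with [0] only matters at isolated points, where
   [limf_esup] is [-oo]. *)
Definition ascending_slope d (f : X -> R) x : \bar R :=
  maxe 0 (ereal_inf [set ereal_sup
      [set (Num.max 0 (f y - f x) / fine (d x y))%:E | y in A `\ x] |
    A in fwd_nbhs d x]).

End AsymmetricMetric.

Section Polish.
Context {R : realType} {X : topologicalType}.
Local Open Scope ereal_scope.

Definition separable := exists2 S : set X, countable S & dense S.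

Definition completely_metrizable := exists rho : X -> X -> R,
  [/\ forall x y, rho x y = 0%R <-> x = y,
      forall x y, rho x y = rho y x,
      forall x y z, (rho x z <= rho x y + rho y z)%R,
      forall x, nbhs x =
        filter_from [set r : R | (0 < r)%R] (fun r => [set y | (rho x y < r)%R]) &
      forall u : X^nat,
        (forall e : R, (0 < e)%R -> exists N, forall i j,
          (N <= i)%N -> (N <= j)%N -> (rho (u i) (u j) < e)%R) ->
        exists x : X, u n @[n --> \oo] --> x].

Definition polish_topology := separable /\ completely_metrizable.

Definition forward_extended_Polish (d : X -> X -> \bar R) :=
  [/\ forward_extended_metric d /\ forward_complete d,
      polish_topology,
      forall (u : X^nat) (x : X), d (u n) x @[n --> \oo] --> 0 ->
        u n @[n --> \oo] --> x &
      lower_semicontinuous (fun z : X * X => d z.1 z.2)].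

Definition A3 (d : X -> X -> \bar R) :=
  reversibility d [set: X] < +oo \/
  (geodesic_space d /\
   forall K : set X, compact K ->
     ereal_sup [set d z.1 z.2 | z in K `*` K] < +oo).

End Polish.
Arguments separable : clear implicits.
Arguments completely_metrizable : clear implicits.
Arguments polish_topology : clear implicits.

Definition A1 {R : realType} {X : ptopologicalType} (d : X -> X -> \bar R)
    (m : {measure set (borel X) -> \bar R}) (V : X -> R) :=
  [/\ measurable_fun [set: borel X] V,
      forward_Lipschitz d V,
      forall x, 0 <= V x,
      forall K : set X, compact K -> exists M : R, forall x, K x -> V x <= M &
      (\int[m]_x (expR (- (V x ^+ 2)))%:E <= 1)%E].

Section CompletedMeasurability.
Context {R : realType} d (T : measurableType d).
Variable m : {measure set T -> \bar R}.
Local Open Scope ereal_scope.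

Definition completed_measurable_fun d' (U : measurableType d') (f : T -> U) :=
  forall B, measurable B -> completed_algebra_gen m (f @^-1` B).

(* On nonnegative functions [\int] is the supremum of the integrals of the
   measurable simple functions below: it is the Lebesgue integral also for
   functions measurable for the completed sigma-algebra only. *)
Definition Lq (q : R) (f : T -> R) :=
  completed_measurable_fun f /\ 'N[m]_q%:E[EFin \o f] < +oo.

End CompletedMeasurability.

Section Relaxed.
Context {R : realType} {X : ptopologicalType}.
Variables (d : X -> X -> \bar R) (m : {measure set (borel X) -> \bar R}) (q : R).
Implicit Types f G : X -> R.
Local Open Scope ereal_scope.

(* weak convergence in L^q, the dual of which is L^p with p = q / (q - 1) *)
Definition weak_Lq_cvg (g : nat -> X -> R) (G : X -> R) :=
  [/\ forall i, Lq m q (g i), Lq m q G &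
      forall h, Lq m (q / (q - 1)) h ->
        \int[m]_x (g i x * h x)%:E @[i --> \oo] --> \int[m]_x (G x * h x)%:E].

Definition relaxed_ascending_gradient f G :=
  [/\ Lq m q f, Lq m q G, forall x, (0 <= G x)%R &
    exists (f_ : nat -> X -> R) (Gt : X -> R),
    [/\ forall i, [/\ measurable_fun [set: borel X] (f_ i),
                      forward_Lipschitz d (f_ i) & Lq m q (f_ i)],
        'N[m]_q%:E[(fun x => (f_ i x - f x)%:E)] @[i --> \oo] --> 0,
        weak_Lq_cvg (fun i x => fine (ascending_slope d (f_ i) x)) Gt &
        {ae m, forall x, (Gt x <= G x)%R}]].

Definition least_relaxed_gradient f G :=
  relaxed_ascending_gradient f G /\
  forall G', relaxed_ascending_gradient f G' ->
    'N[m]_q%:E[EFin \o G] <= 'N[m]_q%:E[EFin \o G'].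

(* A representative of the relaxed ascending gradient of least norm of [f], or
   [+oo] if there is none. *)
Definition Lq_relaxed_gradient f : X -> \bar R :=
  xget (cst +oo) [set (EFin \o G : X -> \bar R) | G in least_relaxed_gradient f].

Definition truncation (N : nat) f : X -> R :=
  fun x => Num.min (Num.max (f x) (- N%:R)%R) N%:R%R.

Definition truncations_have_relaxed_gradients f :=
  forall N, Lq m q (truncation N f) /\
    exists G, relaxed_ascending_gradient (truncation N f) G.

(* On each [{|f| < N}] this should be the gradient of [truncation N f].  For
   different [N] these gradients agree almost everywhere on the common part
   when [A3 d] holds; the definition takes, at [x], the least natural [N] with
   [`|f x| < N], which is [Num.bound (f x)]. *)
Definition relaxed_gradient f : X -> \bar R :=
  fun x => Lq_relaxed_gradient (truncation (Num.bound (f x)) f) x.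

Definition Cheeger f : \bar R :=
  if `[< truncations_have_relaxed_gradients f >]
  then (q^-1)%:E * \int[m]_x (relaxed_gradient f x `^ q)
  else +oo.

End Relaxed.

Section UnitInterval.
Context {R : realType}.

Definition unit_itv : set R := `[0, 1].

Lemma clamp_subproof (t : R) : Num.min 1 (Num.max 0 t) \in unit_itv.
Proof.
apply/mem_set; rewrite /unit_itv /= in_itv /=.
by rewrite le_min ler01 le_max lexx /= ge_min lexx.
Qed.

Definition clamp (t : R) : unit_itv := @exist R (fun x => x \in unit_itv) _ (clamp_subproof t).

Lemma clamp_continuous : continuous clamp.
Proof.
apply: continuous_comp_initial => t /=.
apply: continuous_min; first exact: cvg_cst.
by apply: continuous_max; [exact: cvg_cst|exact: cvg_id].
Qed.

(* t |-> (1 - t) t1 + t t2, as a self-map of [0, 1] when 0 <= t1, t2 <= 1 *)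
Definition affine_itv (t1 t2 : R) (t : unit_itv) : unit_itv :=
  clamp ((1 - set_val t) * t1 + set_val t * t2).

Lemma affine_itv_continuous t1 t2 : continuous (affine_itv t1 t2).
Proof.
have cphi : continuous (fun t : R => (1 - t) * t1 + t * t2).
  move=> t; apply: cvgD; last by apply: cvgM; [exact: cvg_id|exact: cvg_cst].
  by apply: cvgM; [apply: cvgB; [exact: cvg_cst|exact: cvg_id]|exact: cvg_cst].
move=> t; apply: (@continuous_comp _ _ _ set_val
  (fun t : R => clamp ((1 - t) * t1 + t * t2))).
  exact: initial_continuous.
by apply: continuous_comp; [exact: cphi|exact: clamp_continuous].
Qed.

End UnitInterval.
Arguments unit_itv : clear implicits.

Definition curve (R : realType) (X : ptopologicalType) : Type :=
  continuousType (unit_itv R) X.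

HB.instance Definition _ R X := Choice.on (curve R X).
HB.instance Definition _ R X := isPointed.Build (curve R X) (cst point).
HB.instance Definition _ R (X : ptopologicalType) :=
  Topological.copy (curve R X)
    (initial_topology
      ((fun g => g) : curve R X -> {compact-open, unit_itv R -> X})).

Section Curves.
Context {R : realType} {X : ptopologicalType}.
Local Open Scope ereal_scope.
Local Notation leb := (@lebesgue_measure R).

(* The evaluation [e_t]; for [t] outside of [0, 1] it is that at the nearest
   endpoint. *)
Definition ev (t : R) (g : curve R X) : X :=
  (g : continuousType (unit_itv R) X) (clamp t).

Definition stretch (t1 t2 : R) (g : curve R X) : curve R X :=
  (g : continuousType (unit_itv R) X) \o mkcts (@affine_itv_continuous R t1 t2).

Variable d : X -> X -> \bar R.

Definition forward_AC (p : R) (g : curve R X) :=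
  exists G : R -> R,
    [/\ measurable_fun (unit_itv R) G, forall x, (0 <= G x)%R,
        \int[leb]_(x in unit_itv R) (G x `^ p)%:E < +oo &
        forall s t : R, (0 <= s)%R -> (s <= t)%R -> (t <= 1)%R ->
          d (ev s g) (ev t g) <= \int[leb]_(x in `[s, t]) (G x)%:E].

Definition backward_AC (p : R) (g : curve R X) :=
  exists G : R -> R,
    [/\ measurable_fun (unit_itv R) G, forall x, (0 <= G x)%R,
        \int[leb]_(x in unit_itv R) (G x `^ p)%:E < +oo &
        forall s t : R, (0 <= s)%R -> (s <= t)%R -> (t <= 1)%R ->
          d (ev t g) (ev s g) <= \int[leb]_(x in `[s, t]) (G x)%:E].

Definition AC (p : R) : set (curve R X) :=
  [set g | forward_AC p g /\ backward_AC p g].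

Definition forward_speed (g : curve R X) (t : R) : \bar R :=
  lim (d (ev t g) (ev (t + h) g) * (h^-1)%:E @[h --> 0%R^'+]).

Variables (m : {measure set (borel X) -> \bar R}) (p : R).

Definition test_plan (eta : probability (borel (curve R X)) R) :=
  {ae eta, forall g : curve R X, AC p g} /\
  forall t : R, t \in `[0%R, 1%R] ->
    pushforward eta (ev t : borel (curve R X) -> borel X) `<< m.

Variable T : set (probability (borel (curve R X)) R).

Definition stretchable :=
  forall eta, T eta -> forall t1 t2 : R,
    (0 <= t1)%R -> (t1 <= t2)%R -> (t2 <= 1)%R ->
  exists2 eta', T eta' & forall A, measurable A ->
    eta' A =
      pushforward eta (stretch t1 t2 : borel (curve R X) -> borel (curve R X)) A.

Definition almost_every_curve (P : curve R X -> Prop) :=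
  forall eta, T eta -> {ae eta, forall g, P g}.

Definition weak_forward_upper_gradient (f : X -> R) (G : X -> \bar R) :=
  [/\ completed_measurable_fun m (G : borel X -> \bar R), forall x, 0 <= G x &
    almost_every_curve (fun g =>
      let I := \int[leb]_(s in unit_itv R) (G (ev s g) * forward_speed g s) in
      (f (ev 1 g) - f (ev 0 g))%:E <= I /\ I < +oo)].

Definition minimal_weak_forward_upper_gradient f G :=
  weak_forward_upper_gradient f G /\
  forall G', weak_forward_upper_gradient f G' -> {ae m, forall x, G x <= G' x}.

Definition absolutely_continuous01 (u : R -> R) :=
  forall e : R, (0 < e)%R -> exists2 del : R, (0 < del)%R &
    forall n (a b : 'I_n -> R),
      (forall i, [/\ 0 <= a i, a i <= b i & b i <= 1])%R ->
      trivIset [set: 'I_n] (fun i => `]a i, b i[%classic) ->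
      (\sum_(i < n) (b i - a i) < del)%R ->
      (\sum_(i < n) `|u (b i) - u (a i)| < e)%R.

Definition Sobolev_along (f : X -> R) :=
  almost_every_curve (fun g => exists u : R -> R,
    [/\ absolutely_continuous01 u, u 0%R = f (ev 0 g), u 1%R = f (ev 1 g) &
        {ae leb, forall t, t \in `]0%R, 1%R[ -> f (ev t g) = u t}]).

End Curves.

(* Main.v *)
(* Fix a test plan and a good set of curves, on which the energy of the speed
   and the values of V are bounded.  Weighting time by the speed, the occupation
   measure of these curves has, by the compression bound, a density h in L^p with
   respect to m.  Hence weak L^q convergence of slopes can be tested against h:
   integrating v(g_t) - v(g_s) <= int_s^t slope * speed for the approximating
   Lipschitz functions and letting Fatou handle the left-hand side gives the
   gradient inequality for the relaxed gradient, between two fixed times, along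
   almost every curve; neither strong convergence (Mazur) nor locality of relaxed
   gradients is needed.  The same holds for motion to the left with the backward
   speed.  By Fubini the inequalities hold, along almost every curve g, between
   almost all times, so the truncations of f o g have McShane extensions
   increasing at most like the integrals of the gradients; cutting the range of f
   into slices glues the truncations and yields an absolutely continuous
   representative of f o g and the weak upper gradient H.  The minimal gradient
   minimizes the L^q norm; it exists because stretchability turns every weak upper
   gradient into a pointwise bound for the derivative of that representative, so
   that countable infima of weak upper gradients are weak upper gradients. *)

(* A slope is only known to be measurable for the completion of [m], and relaxed gradients are weak
   limits; this shapes the proof. Integrals of nonnegative functions are compared without
   measurability, and the estimates are integrated over an arbitrary measurable family of good
   curves before they are localized to almost every curve. The compression bound holds after
   integration in time; at a fixed time the law of the position is merely absolutely continuous with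
   respect to [m]. So the end values of the approximations converge along almost every curve only
   for a subsequence, and this is why Fatou is needed on the left-hand side. The L^p bound on h is a
   duality: the unweighted occupation measure has density at most C, and by Hoelder weighting it
   with the speed costs C^(1/q) times the L^p norm of the speed. The slices match the definition of
   the relaxed gradient: where N <= |f| < N + 1 it takes the truncation at N + 1, and the difference
   of the truncations at N + 1 and N varies only there. The end values of f along a curve are
   attained because rational times, 0 and 1 among them, are countably many fixed times. *)
From HB Require Import structures.
Require Import Defs.
From mathcomp Require Import all_boot all_order all_algebra.
From mathcomp Require Import all_classical all_reals all_analysis.
From mathcomp Require Import measurable_realfun.
From mathcomp Require Import lra ring.

Set Implicit Arguments.
Unset Strict Implicit.
Unset Printing Implicit Defensive.

Import Order.TTheory GRing.Theory Num.Theory.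
Import numFieldNormedType.Exports.
Local Open Scope classical_set_scope.
Local Open Scope ring_scope.

(* [filterS] with the measure inferred from the hypotheses: for the Lebesgue
   measure the canonical filter instance is not found. *)
Lemma ae_imp d (T : ringOfSetsType d) (R : realFieldType)
    (mu : {measure set T -> \bar R}) (P Q : T -> Prop) :
  (\forall x \ae mu, P x) -> (forall x, P x -> Q x) -> \forall x \ae mu, Q x.
Proof. by move=> aeP PQ; apply: filterS aeP. Qed.

Lemma ae_imp2 d (T : ringOfSetsType d) (R : realFieldType)
    (mu : {measure set T -> \bar R}) (P1 P2 Q : T -> Prop) :
  (\forall x \ae mu, P1 x) -> (\forall x \ae mu, P2 x) ->
  (forall x, P1 x -> P2 x -> Q x) -> \forall x \ae mu, Q x.
Proof. by move=> ae1 ae2 PQ; apply: filterS2 ae1 ae2. Qed.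

(** * Integrals without measurability, completed measurability *)

Section MeasureGeneralities.
Context d (T : measurableType d) (R : realType).
Implicit Types (mu : {measure set T -> \bar R}) (f g : T -> \bar R).
Import HBNNSimple.
Local Open Scope ereal_scope.

(* [\int] of a nonnegative function is a supremum over simple functions, whence
   no measurability of [f] and [g]. *)
Lemma ae_le_integral_raw mu (D : set T) f g : measurable D ->
  (forall x, D x -> 0 <= f x) -> (forall x, D x -> 0 <= g x) ->
  {ae mu, forall x, D x -> f x <= g x} ->
  \int[mu]_(x in D) f x <= \int[mu]_(x in D) g x.
Proof.
move=> mD f0 g0 [N [mN N0 fgN]].
rewrite integral_mkcond [leRHS]integral_mkcond.
have f0' x : 0 <= (f \_ D) x by rewrite patchE; case: ifPn => // /set_mem /f0.
have g0' x : 0 <= (g \_ D) x by rewrite patchE; case: ifPn => // /set_mem /g0.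
rewrite ge0_integralTE// ge0_integralTE//.
apply: ge_ereal_sup => _ [h /= hf <-].
(* Cut off on [N], the simple function [h] lies below [g] everywhere, and its integral is
   unchanged. *)
have mNC : measurable (~` N) by exact: measurableC.
apply: ereal_sup_ubound; exists (proj_nnsfun h mNC) => /=.
  move=> x; rewrite /= mindicE; have [xN|xN] := boolP (x \in ~` N); last first.
    by rewrite mulr0.
  rewrite mulr1; apply: (le_trans (hf x)); rewrite !patchE; case: ifPn => // xD.
  apply: contrapT => nle; move/set_mem: xN; apply; apply: fgN => /= H.
  by apply: nle; apply: H; exact: set_mem.
rewrite -!integralT_nnsfun; apply: ge0_ae_eq_integral => //.
- exact/measurable_EFinP.
- exact/measurable_EFinP.
- by move=> x _; rewrite lee_fin.
- by move=> x _; rewrite lee_fin.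
- exists N; split => // x /= xN; apply: contrapT => nNx; apply: xN => _ /=.
  by rewrite mindicE mem_set //= mulr1.
Qed.

Lemma ae_eq_integral_raw mu (D : set T) f g : measurable D ->
  (forall x, D x -> 0 <= f x) -> (forall x, D x -> 0 <= g x) ->
  {ae mu, forall x, D x -> f x = g x} ->
  \int[mu]_(x in D) f x = \int[mu]_(x in D) g x.
Proof.
move=> mD f0 g0 fg; apply/eqP; rewrite eq_le; apply/andP; split;
  by apply: ae_le_integral_raw => //; apply: filterS fg => x /[apply] ->.
Qed.

Lemma ae_lty_integral mu (D : set T) f : measurable D -> measurable_fun D f ->
  (forall x, D x -> 0 <= f x) -> \int[mu]_(x in D) f x < +oo ->
  {ae mu, forall x, D x -> f x < +oo}.
Proof.
move=> mD mf f0 fi.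
have : mu.-integrable D f.
  apply/integrableP; split => //; rewrite (le_lt_trans _ fi)//.
  by apply: ge0_le_integral => //; [exact: measurableT_comp|move=> x Dx; rewrite gee0_abs// f0].
move=> /integrable_ae -/(_ mD); apply: filterS => x /= fx Dx.
by rewrite -ge0_fin_numE ?fx ?f0.
Qed.

End MeasureGeneralities.

Section Comparison.
Context d1 d2 d3 (T1 : measurableType d1) (T2 : measurableType d2)
  (X : measurableType d3) (R : realType).
Import HBNNSimple.
Local Open Scope ereal_scope.

(* by approximation with simple functions *)
Lemma le_integral_comp (mu1 : {measure set T1 -> \bar R})
  (mu2 : {measure set T2 -> \bar R}) (D1 : set T1) (D2 : set T2)
  (W1 : T1 -> \bar R) (W2 : T2 -> \bar R) (phi1 : T1 -> X) (phi2 : T2 -> X) :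
  measurable D1 -> measurable D2 ->
  measurable_fun D1 W1 -> (forall x, 0 <= W1 x) ->
  measurable_fun D2 W2 -> (forall x, 0 <= W2 x) ->
  measurable_fun D1 phi1 -> measurable_fun D2 phi2 ->
  (forall B, measurable B -> \int[mu1]_(x in D1) ((\1_B (phi1 x))%:E * W1 x) <=
                             \int[mu2]_(x in D2) ((\1_B (phi2 x))%:E * W2 x)) ->
  forall g : X -> \bar R, measurable_fun setT g -> (forall x, 0 <= g x) ->
    \int[mu1]_(x in D1) (g (phi1 x) * W1 x) <=
    \int[mu2]_(x in D2) (g (phi2 x) * W2 x).
Proof.
move=> mD1 mD2 mW1 W10 mW2 W20 mp1 mp2 H g mg g0.
pose gn := nnsfun_approx measurableT mg.
have cvgg x : (gn n x)%:E @[n --> \oo] --> g x.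
  by apply: (cvg_nnsfun_approx measurableT mg) => // y _; exact: g0.
have ndg x m n : (m <= n)%N -> (gn m x <= gn n x)%R.
  by move=> mn; have /lefP/(_ x) := nd_nnsfun_approx measurableT mg mn.
have Hs (h : {nnsfun X >-> R}) :
    \int[mu1]_(x in D1) ((h (phi1 x))%:E * W1 x) <=
    \int[mu2]_(x in D2) ((h (phi2 x))%:E * W2 x).
  have E d' (T' : measurableType d') (mu : {measure set T' -> \bar R}) (D : set T')
      (W : T' -> \bar R) (p : T' -> X) : measurable D -> measurable_fun D W ->
      (forall x, 0 <= W x) -> measurable_fun D p ->
      \int[mu]_(x in D) ((h (p x))%:E * W x) = \sum_(y \in range h)
        y%:E * \int[mu]_(x in D) ((\1_(h @^-1` [set y]) (p x))%:E * W x).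
    move=> mD mW W0 mp.
    have mi y : measurable_fun D (fun x => (\1_(h @^-1` [set y]) (p x))%:E * W x).
      apply: emeasurable_funM => //; apply/measurable_EFinP.
      by apply: (measurableT_comp _ mp); exact: measurable_indic.
    under eq_integral => x xD.
      rewrite fimfunE -fsumEFin// ge0_mule_fsuml; last first.
        by move=> y; exact: nnfun_muleindic_ge0.
      under eq_fsbigr do rewrite EFinM -muleA.
      over.
    rewrite ge0_integral_fsum//.
    - apply: eq_fsbigr => y yr; rewrite ge0_integralZl//.
      + by move=> x _; rewrite mule_ge0// lee_fin.
      + by move: yr; rewrite inE /= => -[z _ <-]; rewrite lee_fin.
    - by move=> y; exact: measurable_funeM.
    - move=> y x Dx; rewrite muleA mule_ge0//.
      exact: nnfun_muleindic_ge0.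
  rewrite !E//; apply: lee_fsum => // y [z _ <-].
  by apply: lee_wpmul2l; [rewrite lee_fin|exact: H].
have mono d' (T' : measurableType d') (mu : {measure set T' -> \bar R}) (D : set T')
    (W : T' -> \bar R) (p : T' -> X) : measurable D -> measurable_fun D W ->
    (forall x, 0 <= W x) -> measurable_fun D p ->
    \int[mu]_(x in D) ((gn n (p x))%:E * W x) @[n --> \oo] -->
    \int[mu]_(x in D) (g (p x) * W x).
  move=> mD mW W0 mp.
  have -> : \int[mu]_(x in D) (g (p x) * W x) =
      \int[mu]_(x in D) limn (fun n => (gn n (p x))%:E * W x).
    apply: eq_integral => x _; apply/esym/cvg_lim => //.
    have nd : {homo (fun n => (gn n (p x))%:E * W x) : m n / (m <= n)%N >-> m <= n}.
      by move=> m n mn; apply: lee_wpmul2r => //; rewrite lee_fin ndg.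
    move: (W0 x); rewrite le_eqVlt => /predU1P[<-|Wx0].
      by rewrite mule0; under eq_fun do rewrite mule0; exact: cvg_cst.
    have := cvgg (p x).
    have [Wf|] := boolP (W x \is a fin_num).
      by move=> ?; exact: cvgeZr.
    (* Multiplication is not continuous at [W x = +oo]: the products are [+oo] as soon as [gn n] is
       positive, or all [0] if [g] vanishes at the point. *)
    rewrite ge0_fin_numE// -leNgt leye_eq => /eqP -> c.
    have nd' : {homo (fun n => (gn n (p x))%:E) : m n / (m <= n)%N >-> m <= n}.
      by move=> m k mk; rewrite lee_fin ndg.
    have gE : g (p x) = ereal_sup (range (fun n => (gn n (p x))%:E)).
      by rewrite (cvg_unique _ c (ereal_nondecreasing_cvgn nd')).
    have [g00|gpos] := eqVneq (g (p x)) 0.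
      have gn0 n : gn n (p x) = 0%R.
        apply/eqP; rewrite eq_le fun_ge0 andbT -lee_fin -[leRHS]g00 gE.
        by apply: ereal_sup_ubound; exists n.
      by rewrite g00 mul0e; under eq_fun do rewrite gn0 mul0e; exact: cvg_cst.
    have gp : 0 < g (p x) by rewrite lt_neqAle eq_sym gpos g0.
    rewrite gt0_muley//.
    have : \forall n \near \oo, 0 < (gn n (p x))%:E.
      move: gp; rewrite gE => /ereal_sup_gt[_ [N _ <-] Npos].
      by exists N => // n /= Nn; apply: (lt_le_trans Npos); exact: nd'.
    move=> pos; apply: (@cvg_trans _ (cst +oo @ \oo)); last exact: cvg_cst.
    apply: near_eq_cvg; apply: filterS pos => n np /=.
    by rewrite gt0_muley.
  apply: cvg_monotone_convergence => //.
  - move=> n; apply: emeasurable_funM => //; apply/measurable_EFinP.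
    exact: (measurableT_comp _ mp).
  - by move=> n x _; rewrite mule_ge0// lee_fin.
  - by move=> x _ m n mn; apply: lee_wpmul2r => //; rewrite lee_fin ndg.
apply: (lee_cvg_to (mono _ _ mu1 D1 W1 phi1 mD1 mW1 W10 mp1) (mono _ _ mu2 D2 W2 phi2 mD2 mW2 W20 mp2)).
by apply: nearW => n; exact: Hs.
Qed.

End Comparison.

Lemma ae_forall_countable d (T : sigmaRingType d) (R : realType) (I : countType)
    (mu : {measure set T -> \bar R}) (P : I -> T -> Prop) :
  (forall i, \forall x \ae mu, P i x) -> \forall x \ae mu, forall i, P i x.
Proof.
move=> aeP.
have /ae_foralln : forall n, \forall x \ae mu,
    forall i, unpickle n = Some i -> P i x.
  move=> n; case E : (unpickle n) => [i|]; last by apply: aeW.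
  by apply: filterS (aeP i) => x Pix j [<-].
by apply: filterS => x H i; apply: (H (pickle i)); rewrite pickleK.
Qed.

Section CompletedMeasurability.
Context d (T : measurableType d) (R : realType).
Variable mu : {measure set T -> \bar R}.
Local Open Scope ereal_scope.

Lemma ae_completed_measurable_fun d' (U : measurableType d') (f g : T -> U) :
  measurable_fun setT g -> {ae mu, forall x, f x = g x} ->
  completed_measurable_fun mu f.
Proof.
move=> mg [Z [mZ Z0 fgZ]] B mB.
exists ((g @^-1` B) `\` Z).
  by apply: measurableD => //; rewrite -[_ @^-1` _]setTI; exact: mg.
exists ((f @^-1` B) `&` Z).
  by exists Z; split => //; exact: subIsetr.
have fg x : ~ Z x -> f x = g x.
  by move=> nZ; apply: contrapT => nfg; apply: nZ; apply: fgZ.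
apply/seteqP; split=> x /=.
  by move=> [[Bx /fg ->]//|[]].
move=> Bx; have [Zx|Zx] := pselect (Z x); first by right.
by left; split => //; rewrite -fg.
Qed.

(** Only the countably many sets where [f] exceeds a rational have to be corrected. Off the union
    [Z] of their null sets they are measurable, and the value [0] on [Z] keeps nonnegativity and
    finiteness. *)
Lemma completed_measurable_fun_ae (f : T -> \bar R) :
  completed_measurable_fun mu f ->
  exists g, [/\ measurable_fun setT g, {ae mu, forall x, f x = g x},
    (forall x, 0 <= f x) -> forall x, 0 <= g x &
    (forall x, f x \is a fin_num) -> forall x, g x \is a fin_num].
Proof.
move=> mf.
have mI (r : R) : measurable (`]r%:E, +oo[%classic : set (\bar R)).
  exact: emeasurable_itv.
have /choice[A HA] : forall q : rat, exists AZ : set T * set T,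
    [/\ measurable AZ.1, measurable AZ.2, mu AZ.2 = 0 &
      forall x, ~ AZ.2 x -> (ratr q)%:E < f x <-> AZ.1 x].
  move=> q; have [A mA [N [Z [mZ Z0 NZ]] ANE]] := mf _ (mI (ratr q)).
  exists (A, Z); split => //= x nZx.
  have : (f @^-1` `](ratr q)%:E, +oo[%classic) x <-> A x.
    by rewrite -ANE; split; [move=> [//|/NZ]|left].
  by rewrite /= in_itv/= andbT.
pose Z := \bigcup_q (A q).2.
have mZ : measurable Z by apply: bigcupT_measurable_rat => q; case: (HA q).
have Z0 : mu Z = 0.
  apply/negligibleP => //.
  have : \forall x \ae mu, forall q, ~ (A q).2 x.
    apply: ae_forall_countable => q; exists (A q).2; case: (HA q) => _ m2 m0 _.
    by split => // x /= /contrapT.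
  apply: negligibleS => x [q _ Aqx] /= /(_ q); exact.
pose g x : \bar R := if x \in Z then 0 else f x.
have gZ x : ~ Z x -> g x = f x by move=> nZ; rewrite /g memNset.
exists g; split.
- apply: (measurability (@ErealGenOInfty.G R)).
    exact: ErealGenOInfty.measurableE.
  move=> _ [_ [r ->] <-].
  have mg (q : rat) : measurable [set x | (ratr q)%:E < g x].
    have [m1 m2 _ E] := HA q.
    (* Since [g] is [0] on [Z], all of [Z] belongs to the superlevel set if [q < 0] and none of it
       otherwise. *)
    have -> : [set x | (ratr q)%:E < g x] =
        ((A q).1 `\` Z) `|` (if (ratr q)%:E < 0 :> \bar R then Z else set0).
      apply/seteqP; split => x /=.
        have [Zx|Zx] := pselect (Z x).
          by rewrite /g mem_set// => ->; right.
        rewrite gZ// => fx; left; split => //; apply/E => //.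
        by move=> Z2; apply: Zx; exists q.
      move=> [[A1x Zx]|].
        by rewrite gZ//; apply/E => // Z2; apply: Zx; exists q.
      by case: ifPn => // q0 Zx; rewrite /g mem_set.
    apply: measurableU; first exact: measurableD.
    by case: ifP.
  rewrite setTI.
  have -> : g @^-1` `]r%:E, +oo[%classic = \bigcup_q
      (if (r < ratr q)%R then [set x | (ratr q)%:E < g x] else set0).
    apply/seteqP; split => x /=.
      rewrite in_itv/= andbT => rg.
      have [c rc cg] : exists2 c, (r < c)%R & c%:E <= g x.
        case: (g x) rg => [y ry| _|//]; first by exists y; rewrite ?lexx// -lte_fin.
        by exists (r + 1)%R; rewrite ?leey// ltrDl.
      have [q] := rat_in_itvoo rc; rewrite in_itv/= => /andP[rq qc].
      by exists q => //; rewrite rq /=; apply: lt_le_trans cg; rewrite lte_fin.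
    move=> [q _]; case: ifPn => //= rq qg.
    by rewrite in_itv/= andbT; apply: lt_trans qg; rewrite lte_fin.
  by apply: bigcupT_measurable_rat => q; case: ifP.
- exists Z; split => // x /= nfg; apply: contrapT => nZ; apply: nfg.
  by rewrite gZ.
- by move=> f0 x; rewrite /g; case: ifP.
- by move=> f0 x; rewrite /g; case: ifP.
Qed.

Lemma completed_measurable_fun_ae_real (f : T -> R) :
  completed_measurable_fun mu f ->
  exists g : T -> R, [/\ measurable_fun setT g, {ae mu, forall x, f x = g x} &
    (forall x, 0 <= f x)%R -> forall x, (0 <= g x)%R].
Proof.
move=> mf; have [|g [mg fg g0 gf]] := @completed_measurable_fun_ae (EFin \o f).
  move=> B mB; rewrite comp_preimage; apply: mf.
  have /(_ measurableT _ mB) : measurable_fun setT (EFin \o @idfun R).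
    exact/measurable_EFinP/measurable_id.
  by rewrite setTI.
exists (fine \o g); split.
- exact: measurableT_comp.
- by apply: filterS fg => x /= <-.
- by move=> f0 x; rewrite fine_ge0// g0// => y; rewrite /= lee_fin.
Qed.

End CompletedMeasurability.

(** * Densities of functions of one variable *)

Section IntervalIntegral.
Context {R : realType}.
Local Notation mu := (@lebesgue_measure R).
Implicit Types (a b c w phi psi : R -> R) (s t r : R).

Definition integrable_fun a := mu.-integrable setT (EFin \o a).

(** The interval is half-open so that adjacent intervals are disjoint and match those on which
    Stieltjes measures are determined. *)
Definition itv_int a s t : R := \int[mu]_(x in `]s, t]) a x.

Lemma integrable_funS a (A : set R) : measurable A -> integrable_fun a ->
  mu.-integrable A (EFin \o a).
Proof. by move=> mA; apply: integrableS. Qed.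

Lemma itv_intE a s t : integrable_fun a ->
  (itv_int a s t)%:E = (\int[mu]_(x in `]s, t]) (a x)%:E)%E.
Proof.
move=> ia; rewrite /itv_int /Rintegral fineK//; apply: integrable_fin_num => //.
exact: integrable_funS.
Qed.

Lemma itv_int_ge0 a s t : (forall x, 0 <= a x) -> 0 <= itv_int a s t.
Proof. by move=> a0; apply: Rintegral_ge0 => x _; exact: a0. Qed.

Lemma itv_intxx a s : itv_int a s s = 0.
Proof. by rewrite /itv_int set_itvoc0 Rintegral_set0. Qed.

Lemma itv_intD a s r t : integrable_fun a -> s <= r -> r <= t ->
  itv_int a s t = itv_int a s r + itv_int a r t.
Proof.
move=> ia sr rt; rewrite /itv_int (@itv_bndbnd_setU _ _ _ (BRight r))//.
rewrite Rintegral_setU//=.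
- exact: integrable_funS (measurableU _ _ _ _) ia.
- apply/disj_set2P; rewrite -subset0 => z/=; rewrite !in_itv/= => -[/andP[_ zr]].
  by rewrite ltNge zr.
Qed.

Lemma itv_int_sub a s t s' t' : integrable_fun a -> (forall x, 0 <= a x) ->
  s' <= s -> s <= t -> t <= t' -> itv_int a s t <= itv_int a s' t'.
Proof.
move=> ia a0 ss st tt.
rewrite (@itv_intD a s' s t')// ?(le_trans st)// (@itv_intD a s t t')//.
by rewrite addrCA lerDl addr_ge0// itv_int_ge0.
Qed.

Lemma le_itv_int a b s t : integrable_fun a -> integrable_fun b ->
  {ae mu, forall x, s < x <= t -> a x <= b x} -> itv_int a s t <= itv_int b s t.
Proof.
move=> ia ib ab; rewrite -subr_ge0 -lee_fin EFinB !itv_intE//.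
rewrite -integralB//; [|exact: integrable_funS..].
have mab : measurable_fun setT (fun x => ((a x)%:E - (b x)%:E)%E).
  by apply: emeasurable_funB; exact: (measurable_int mu).
rewrite (_ : (\int[mu]_(_ in _) _)%E =
  \int[mu]_(x in `]s, t]) ((Num.max 0 (b x - a x))%:E))%E; last first.
  apply: ae_eq_integral => //.
  - apply: measurable_funTS; apply: emeasurable_funB; exact: (measurable_int mu).
  - apply: measurable_funTS; apply/measurable_EFinP; apply: measurable_maxr => //.
    by apply: measurable_funB; apply/measurable_EFinP; exact: (measurable_int mu).
  - apply: (ae_imp ab) => x {}ab /=; rewrite in_itv/= => /ab abx.
    by rewrite (max_r _) ?subr_ge0// EFinB.
by apply: integral_ge0 => x _; rewrite lee_fin le_max lexx.
Qed.

Lemma itv_int_small a (e : R) : integrable_fun a -> 0 < e ->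
  exists2 del, 0 < del & forall s t, s <= t -> t - s < del -> `|itv_int a s t| < e.
Proof.
move=> ia e0; have [del [del0 H]] := integral_normr_continuous ia e0.
exists del => // s t st tsdel.
apply: (@le_lt_trans _ _ (\int[mu]_(x in `]s, t]) `|a x|)).
  apply: le_normr_Rintegral => //; exact: integrable_funS.
apply: H => //; rewrite [X in (X < _)%E](lebesgue_measure_itv `]s, t])/= lte_fin.
by case: ifPn => _; rewrite ?lte_fin// -EFinB lte_fin.
Qed.

Lemma integrable_funD a b : integrable_fun a -> integrable_fun b ->
  integrable_fun (fun x => a x + b x).
Proof.
move=> ia ib; rewrite /integrable_fun (_ : _ \o _ = (EFin \o a) \+ (EFin \o b))%E//.
exact: integrableD.
Qed.

Lemma itv_intDfun a b s t : integrable_fun a -> integrable_fun b ->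
  itv_int (fun x => a x + b x) s t = itv_int a s t + itv_int b s t.
Proof. by move=> ia ib; apply: RintegralD => //; exact: integrable_funS. Qed.

Lemma integrable_funN a : integrable_fun a -> integrable_fun (fun x => - a x).
Proof.
move=> ia; rewrite /integrable_fun (_ : _ \o _ = \- (EFin \o a))%E//.
exact: integrableN.
Qed.

Lemma itv_intN a s t : integrable_fun a ->
  itv_int (fun x => - a x) s t = - itv_int a s t.
Proof.
move=> ia; apply: EFin_inj; rewrite EFinN !itv_intE//; last exact: integrable_funN.
by under eq_integral do rewrite EFinN; rewrite integralN// integrable_add_def//; exact: integrable_funS.
Qed.

Definition primitive a t : R := \int[mu]_(x in `]-oo, t]) a x.

Lemma primitiveB a s t : integrable_fun a -> s <= t ->
  primitive a t - primitive a s = itv_int a s t.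
Proof.
move=> ia st; rewrite /primitive (@itv_bndbnd_setU _ _ _ (BRight s))//.
rewrite Rintegral_setU//=; first by rewrite addrAC subrr add0r.
- exact: integrable_funS (measurableU _ _ _ _) ia.
- apply/disj_set2P; rewrite -subset0 => z/=; rewrite !in_itv/= => -[zr].
  by rewrite ltNge zr.
Qed.

End IntervalIntegral.

Section NonnegDensityMeasure.
Context d (T : measurableType d) (R : realType).
Variables (mu : {measure set T -> \bar R}) (f : T -> \bar R).
Hypotheses (mf : measurable_fun setT f) (f0 : forall x, (0 <= f x)%E).

Definition density_measure of measurable_fun setT f & (forall x, (0 <= f x)%E) :=
  fun A : set T => (\int[mu]_(x in A) f x)%E.

Local Notation nu := (density_measure mf f0).

Let nu0 : nu set0 = 0%E. Proof. exact: integral_set0. Qed.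
Let nu_ge0 A : (0 <= nu A)%E. Proof. by apply: integral_ge0 => x _; exact: f0. Qed.
Let nu_sigma : semi_sigma_additive nu.
Proof. exact: semi_sigma_additive_nng_induced. Qed.

HB.instance Definition _ := isMeasure.Build _ _ _ nu nu0 nu_ge0 nu_sigma.

End NonnegDensityMeasure.

Section FundamentalTheorem.
Context {R : realType}.
Local Notation mu := (@lebesgue_measure R).
Implicit Types (a b c w phi psi : R -> R) (s t r : R).

Lemma right_continuous_of_itv_int c psi : integrable_fun c ->
  (forall s t, s <= t -> `|psi t - psi s| <= itv_int c s t) ->
  right_continuous psi.
Proof.
move=> ic H x; apply/cvgrPdist_lt => e e0.
have [del del0 small] := itv_int_small ic e0.
near=> y; have xy : x <= y by near: y; exact: nbhs_right_ge.
rewrite distrC; apply: (le_lt_trans (H _ _ xy)).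
apply: (le_lt_trans (ler_norm _)); apply: small => //.
rewrite ltrBlDl; near: y; apply: nbhs_right_lt; by rewrite ltrDl.
Unshelve. all: by end_near. Qed.

(** The Stieltjes measure of [psi] is at most [c] times Lebesgue measure, so Radon-Nikodym gives its
    density. Domination on all Borel sets, not only on intervals, comes from the complement: with
    [C] a primitive of [c], the function [C - psi] is nondecreasing too, and the Stieltjes measures
    of [psi] and [C - psi] add up to that of [C]. *)
Lemma nondecreasing_density c psi : integrable_fun c ->
  (forall x, 0 <= c x) ->
  (forall s t, s <= t -> 0 <= psi t - psi s <= itv_int c s t) ->
  exists w, [/\ forall x, 0 <= w x, integrable_fun w &
    forall s t, s <= t -> psi t - psi s = itv_int w s t].
Proof.
move=> ic c0 H.
pose C := primitive c.
have CE s t : s <= t -> C t - C s = itv_int c s t by exact: primitiveB.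
have rc1 : right_continuous psi.
  apply: (right_continuous_of_itv_int ic) => s t st.
  by have /andP[? ?] := H _ _ st; rewrite ger0_norm.
have nd1 : nondecreasing psi.
  by move=> s t st; rewrite -subr_ge0; have /andP[] := H _ _ st.
have rc2 : right_continuous (fun x => C x - psi x).
  apply: (right_continuous_of_itv_int ic) => s t st.
  have /andP[? ?] := H _ _ st; have := CE _ _ st => ?.
  by rewrite ger0_norm; lra.
have nd2 : nondecreasing (fun x => C x - psi x).
  move=> s t st; have /andP[? ?] := H _ _ st; have := CE _ _ st => ?.
  by rewrite -subr_ge0; lra.
have rc3 : right_continuous C.
  apply: (right_continuous_of_itv_int ic) => s t st.
  by rewrite CE// ger0_norm// itv_int_ge0.
have nd3 : nondecreasing C.
  by move=> s t st; rewrite -subr_ge0 CE// itv_int_ge0.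
pose F1 : cumulative R R := HB.pack psi (isCumulative.Build R _ R psi nd1 rc1).
pose F2 : cumulative R R := HB.pack (fun x => C x - psi x)
  (isCumulative.Build R _ R (fun x => C x - psi x) nd2 rc2).
pose F3 : cumulative R R := HB.pack C (isCumulative.Build R _ R C nd3 rc3).
have LSE (F : cumulative R R) s t : s <= t ->
    lebesgue_stieltjes_measure F `]s, t]%classic = (F t - F s)%:E.
  move=> st; rewrite /lebesgue_stieltjes_measure/= /measure_extension/=.
  by rewrite measurable_mu_extE/=; [rewrite wlength_itv_bnd|exact: is_ocitv].
have mc : measurable_fun setT (EFin \o c) by exact: (measurable_int mu).
have c0' x : (0 <= (EFin \o c) x)%E by rewrite /= lee_fin.
pose kappa := density_measure mu mc c0'.
have ocitvE A : ocitv A -> exists s t, s <= t /\ A = `]s, t]%classic.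
  move=> [[s t] _ <-] /=; have [st|ts] := leP s t; first by exists s, t.
  by exists s, s; rewrite !set_itv_ge// -leNgt bnd_simp// ltW.
have E3 A : measurable A -> lebesgue_stieltjes_measure F3 A = kappa A.
  move=> mA; apply: (@lebesgue_stieltjes_measure_unique _ F3 kappa) => // B.
  move=> /ocitvE[s [t [st ->]]]; rewrite LSE// CE// itv_intE//.
have E12 A : measurable A -> lebesgue_stieltjes_measure F3 A =
    measure_add (lebesgue_stieltjes_measure F1) (lebesgue_stieltjes_measure F2) A.
  move=> mA; apply: (@lebesgue_stieltjes_measure_unique _ F3 _) => // B.
  move=> /ocitvE[s [t [st ->]]].
  transitivity ((F1 t - F1 s)%:E + (F2 t - F2 s)%:E)%E.
    by rewrite LSE// -EFinD; congr EFin; rewrite /=; ring.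
  by rewrite -[RHS]/(measure_add (lebesgue_stieltjes_measure F1)
    (lebesgue_stieltjes_measure F2) _) measure_addE -!LSE.
have le1 A : measurable A -> (lebesgue_stieltjes_measure F1 A <= kappa A)%E.
  by move=> mA; rewrite -E3// E12// measure_addE leeDl.
have kfin : (kappa setT < +oo)%E.
  move/integrableP : ic => [_]; apply: le_lt_trans.
  rewrite le_eqVlt; apply/orP; left; apply/eqP.
  by apply: eq_integral => x _ /=; rewrite ger0_norm.
have fin1 : fin_num_fun (lebesgue_stieltjes_measure F1).
  apply: lty_fin_num_fun; exact: le_lt_trans (le1 _ measurableT) kfin.
pose nu : {finite_measure set (measurableTypeR R) -> \bar R} :=
  HB.pack (lebesgue_stieltjes_measure F1)
    (Measure_isFinite.Build _ _ _ (lebesgue_stieltjes_measure F1) fin1).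
have ac : nu `<< mu.
  apply/null_content_dominatesP => A mA A0.
  apply/eqP; rewrite eq_le measure_ge0 andbT.
  apply: (le_trans (le1 A mA)); rewrite /kappa/= /density_measure.
  rewrite (_ : (\int[mu]_(x in A) _)%E = 0%E)//.
  by apply: null_set_integral => //; exact: measurable_funTS.
have [w [w0 wfin iw wE]] := radon_nikodym_sigma_finite ac.
have wEF : w = EFin \o (fine \o w) by apply/funext => x /=; rewrite fineK.
exists (fine \o w); split.
- by move=> x; rewrite fine_ge0.
- by rewrite /integrable_fun -wEF.
- move=> s t st; apply: EFin_inj; rewrite itv_intE; last first.
    by rewrite /integrable_fun -wEF.
  transitivity (nu `]s, t]%classic); first by rewrite /nu/= LSE.
  by rewrite wE//; apply: eq_integral => x _ /=; rewrite fineK.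
Qed.

(** The two-sided derivative without division, so that it combines linearly with increments of
    either sign. *)
Definition has_deriv phi x l := forall e, 0 < e ->
  exists2 del, 0 < del & forall h, `|h| < del ->
    `|phi (x + h) - phi x - l * h| <= e * `|h|.

Lemma itv_int_deriv w phi : integrable_fun w ->
  (forall s t, s <= t -> phi t - phi s = itv_int w s t) ->
  {ae mu, forall x, has_deriv phi x (w x)}.
Proof.
move=> iw phiE.
have loc : locally_integrable [set: R] w.
  rewrite (_ : w = w \_ setT); last by rewrite patch_setT.
  exact: integrable_locally.
have := FTC1Ny (fun y => integrable_funS (measurable_itv _) iw) loc.
move=> /= aeF; apply: (ae_imp aeF) => x [dx dxE] e e0.
have : (fun h => h^-1 *: ((primitive w \o shift x) (h *: (1 : R)) - primitive w x))
    @ 0^' --> w x by rewrite -dxE derive1E; exact: dx.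
move=> /cvgrPdist_le/(_ _ e0)[del /= del0 Hd]; exists del => // h hdel.
have phiP y z : phi y - phi z = primitive w y - primitive w z.
  have [yz|zy] := leP y z; last by rewrite phiE ?primitiveB// ltW.
  by apply: oppr_inj; rewrite !opprB phiE// primitiveB.
have [->|h0] := eqVneq h 0.
  by rewrite addr0 subrr mulr0 subr0 normr0 mulr0.
have := Hd h; rewrite /ball_ /= sub0r normrN => /(_ hdel h0).
rewrite scaler1 addrC -phiP => Hh.
have -> : phi (x + h) - phi x - w x * h =
    - (h * (w x - h^-1 *: (phi (x + h) - phi x))).
  by rewrite mulrBr /GRing.scale/= mulVKf// opprB mulrC.
rewrite normrN normrM mulrC ler_wpM2r//.
by rewrite addrC [x + h]addrC.
Qed.

(** Adding the primitive [B] of [b] makes [phi] nondecreasing, with increments at most the integrals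
    of [a + b]. The density of [phi] is that of the sum minus [b]. *)
Lemma has_deriv_of_itv_int a b phi : integrable_fun a -> integrable_fun b ->
  (forall x, 0 <= a x) -> (forall x, 0 <= b x) ->
  (forall s t, s <= t -> phi t - phi s <= itv_int a s t) ->
  (forall s t, s <= t -> phi s - phi t <= itv_int b s t) ->
  exists w, [/\ integrable_fun w,
    forall s t, s <= t -> phi t - phi s = itv_int w s t &
    {ae mu, forall x, has_deriv phi x (w x)}].
Proof.
move=> ia ib a0 b0 Ha Hb; pose B := primitive b.
have BE s t : s <= t -> B t - B s = itv_int b s t by exact: primitiveB.
have [|||v [v0 iv vE]] := @nondecreasing_density (fun x => a x + b x) (fun t => phi t + B t).
- exact: integrable_funD.
- by move=> x; rewrite addr_ge0.
- move=> s t st; rewrite itv_intDfun//; have := BE _ _ st.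
  have := Ha _ _ st; have := Hb _ _ st => ? ? ?; apply/andP; split; lra.
have iw := integrable_funD iv (integrable_funN ib).
have wE s t : s <= t -> phi t - phi s = itv_int (fun x => v x + - b x) s t.
  move=> st; rewrite itv_intDfun//; last exact: integrable_funN.
  rewrite itv_intN//; have := vE _ _ st; have := BE _ _ st => ? ?; lra.
by exists (fun x => v x + - b x); split => //; exact: itv_int_deriv.
Qed.

End FundamentalTheorem.

Lemma ae_imp3 d (T : ringOfSetsType d) (R : realFieldType)
    (mu : {measure set T -> \bar R}) (P1 P2 P3 Q : T -> Prop) :
  (\forall x \ae mu, P1 x) -> (\forall x \ae mu, P2 x) ->
  (\forall x \ae mu, P3 x) ->
  (forall x, P1 x -> P2 x -> P3 x -> Q x) -> \forall x \ae mu, Q x.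
Proof. by move=> ae1 ae2 ae3 PQ; apply: filterS3 ae1 ae2 ae3. Qed.

(** * Metric derivatives for asymmetric distances on the line *)

Section MetricDerivative.
Context {R : realType}.
Local Notation mu := (@lebesgue_measure R).
Implicit Types (a b c w phi psi : R -> R) (s t r : R).

Lemma le_has_deriv phi psi x l k del : has_deriv phi x l -> has_deriv psi x k ->
  0 < del ->
  (forall h, 0 < h < del -> phi (x + h) - phi x <= psi (x + h) - psi x) -> l <= k.
Proof.
move=> dphi dpsi del0 H; rewrite leNgt; apply/negP => kl.
have e0 : 0 < (l - k) / 4 by rewrite divr_gt0// subr_gt0.
have [d1 d10 H1] := dphi _ e0; have [d2 d20 H2] := dpsi _ e0.
pose e := Num.min del (Num.min d1 d2); pose h := e / 2.
have e_gt0 : 0 < e by rewrite !lt_min del0 d10.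
have h0 : 0 < h by rewrite divr_gt0.
have hlt : h < e by rewrite ltr_pdivrMr// ltr_pMr// ltr1n.
have := hlt; rewrite !lt_min => /and3P[hdel hd1 hd2].
have := H1 h; have := H2 h; rewrite gtr0_norm// => /(_ hd2) + /(_ hd1).
rewrite !ler_norml => /andP[_ A2] /andP[A1 _].
have A3 : phi (x + h) - phi x <= psi (x + h) - psi x by apply: H; rewrite h0.
have lkh : 0 < (l - k) * h by rewrite mulr_gt0// subr_gt0.
have aux (P Q L K z : R) : P - Q <= L - K -> - ((z / 4) * h) <= P - Q - l * h ->
    L - K - k * h <= (z / 4) * h -> z = l - k -> False.
  by move=> h1 h2 h3 zE; move: h2 h3 lkh; rewrite zE; clear -h1; lra.
by apply: (aux _ _ _ _ _ A3 A1 A2).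
Qed.

Lemma ae_le_of_itv_int w a phi : integrable_fun a ->
  (forall s t, s <= t -> phi t - phi s <= itv_int a s t) ->
  {ae mu, forall x, has_deriv phi x (w x)} ->
  {ae mu, forall x, w x <= a x}.
Proof.
move=> ia Ha aew.
have aea := itv_int_deriv ia (fun s t => @primitiveB _ a s t ia).
apply: (ae_imp2 aew aea) => x dw da.
apply: (le_has_deriv dw da ltr01) => h /andP[h0 _].
by rewrite primitiveB// ?Ha// lerDl ltW.
Qed.

(* [m] is the supremum of the derivatives of [D (ratr q)], [q : rat]. *)
Lemma metric_derivative (D : R -> R -> R) a b :
  integrable_fun a -> integrable_fun b ->
  (forall x, 0 <= a x) -> (forall x, 0 <= b x) ->
  (forall s t, 0 <= D s t) -> (forall s t r, D s r <= D s t + D t r) ->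
  (forall s t, s <= t -> D s t <= itv_int a s t) ->
  (forall s t, s <= t -> D t s <= itv_int b s t) ->
  exists m, [/\ forall x, 0 <= m x <= a x, integrable_fun m,
    forall s t, s <= t -> D s t <= itv_int m s t &
    {ae mu, forall x, forall e, 0 < e -> exists2 del, 0 < del &
      forall h, 0 < h < del -> `|D x (x + h) - m x * h| <= e * h}].
Proof.
move=> ia ib a0 b0 D0 Dtri Da Db.
have /choice[w Hw] : forall q : rat, exists w, [/\ integrable_fun w,
    forall s t, s <= t -> D (ratr q) t - D (ratr q) s = itv_int w s t &
    {ae mu, forall x, has_deriv (D (ratr q)) x (w x)}].
  move=> q; apply: (@has_deriv_of_itv_int _ a b) => // s t st.
    by rewrite lerBlDl; apply: (le_trans (Dtri _ s _)); rewrite lerD2l Da.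
  by rewrite lerBlDl; apply: (le_trans (Dtri _ t _)); rewrite lerD2l Db.
(* The zero function, at index [0] and at the codes of no rational, makes the supremum [M]
   nonnegative. *)
pose v n : R -> R := if n is k.+1 then
  if unpickle k is Some q then w q else cst 0 else cst 0.
have vq q : v (pickle q).+1 = w q by rewrite /v pickleK.
have iv n : integrable_fun (v n).
  have i0 : integrable_fun (cst 0 : R -> R) by exact: integrable0.
  by case: n => //= n; case: (unpickle n) => // q; case: (Hw q).
pose M x := ereal_sup (range (fun n => (v n x)%:E)).
have mM : measurable_fun setT M.
  have -> : M = fun x => esups (fun n => (v n x)%:E) 0%N.
    apply/funext => x; rewrite /M /esups; congr ereal_sup.
    by apply/seteqP; split=> y [n _ <-]; exists n.
  apply: (@measurable_fun_esups _ _ _ _ (fun n x => (v n x)%:E)) => n.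
  exact: (measurable_int mu (iv n)).
have vM n x : ((v n x)%:E <= M x)%E by apply: ereal_sup_ubound; exists n.
have M0 x : (0%:E <= M x)%E by exact: (vM 0%N).
(* Capping by [a] changes [M] on a null set only, and makes it finite everywhere and integrable. *)
pose m x := Num.min (fine (M x)) (a x).
have m0 x : 0 <= m x by rewrite le_min fine_ge0//= a0.
have ma x : m x <= a x by rewrite ge_min lexx orbT.
have mm : measurable_fun setT m.
  apply: measurable_minr; first exact: measurableT_comp.
  by apply/measurable_EFinP; exact: (measurable_int mu).
have im : integrable_fun m.
  apply: le_integrable ia => //; first exact/measurable_EFinP.
  by move=> x _ /=; rewrite lee_fin !ger0_norm.
have aewa : {ae mu, forall x, forall q, w q x <= a x}.
  apply: ae_forall_countable => q; have [iw wE dw] := Hw q.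
  apply: (ae_le_of_itv_int ia _ dw) => s t st.
  by rewrite lerBlDl; apply: (le_trans (Dtri _ s _)); rewrite lerD2l Da.
have aeM : {ae mu, forall x, M x = (m x)%:E}.
  apply: (ae_imp aewa) => x wa.
  have Ma : (M x <= (a x)%:E)%E.
    apply: ge_ereal_sup => _ [n _ <-]; rewrite lee_fin.
    by case: n => [|n] //=; case: (unpickle n) => //= q; exact: wa.
  have Mfin : M x \is a fin_num.
    by rewrite ge0_fin_numE// (le_lt_trans Ma)// ltry.
  by rewrite /m min_l ?fineK// -lee_fin fineK.
have aewm q : {ae mu, forall x, w q x <= m x}.
  by apply: (ae_imp aeM) => x Mm; rewrite -lee_fin -Mm -vq.
(* Pass through a rational [q] just to the right of [s]: [D s t <= D s q + D q t], where [D q t] is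
   [D q s] plus an integral of [w q <= m], and both [D s q] and [D q s] are small. *)
have Dm s t : s <= t -> D s t <= itv_int m s t.
  move=> st; apply/ler_addgt0Pr => e e0.
  have e20 : 0 < e / 2 by rewrite divr_gt0.
  have [d1 d10 s1] := itv_int_small ia e20.
  have [d2 d20 s2] := itv_int_small ib e20.
  have [q] : exists q : rat, ratr q \in `]s, s + Num.min d1 d2[.
    by apply: rat_in_itvoo; rewrite ltrDl lt_min d10.
  rewrite in_itv/= -ltrBlDl lt_min => /and3P[sq qd1 qd2].
  have [iw wE _] := Hw q.
  have : itv_int (w q) s t <= itv_int m s t.
    by apply: le_itv_int => //; apply: (ae_imp (aewm q)) => x ?.
  rewrite -wE//.
  have := s1 _ _ (ltW sq) qd1; have := s2 _ _ (ltW sq) qd2.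
  rewrite !ltr_norml => /andP[_ ?] /andP[_ ?].
  have := Da _ _ (ltW sq); have := Db _ _ (ltW sq).
  have := Dtri s (ratr q) t => ? ? ? ?; lra.
exists m; split => //.
- by move=> x; rewrite m0 ma.
- have aed : {ae mu, forall x, forall q, has_deriv (D (ratr q)) x (w q x)}.
    by apply: ae_forall_countable => q; case: (Hw q).
  have aem := itv_int_deriv im (fun s t => @primitiveB _ m s t im).
  apply: (ae_imp3 aeM aed aem) => x Mm dw dm e e0.
  have e20 : 0 < e / 2 by rewrite divr_gt0.
  have [d1 d10 H1] := dm _ e0.
  (* One index has a value above [m x - e / 2] at [x]. If it is some [w q], the triangle inequality
     bounds [D x (x + h)] from below by the increment of [D (ratr q)]; if it is the zero function,
     [D >= 0] suffices. *)
  have [d2 d20 H2] : exists2 d2, 0 < d2 &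
      forall h, 0 < h < d2 -> (m x - e) * h <= D x (x + h).
    have [_ [n _ <-] vn] : exists2 y, range (fun n => (v n x)%:E) y &
        ((m x - e / 2)%:E < y)%E.
      by apply: ereal_sup_gt; rewrite -/(M x) Mm lte_fin; lra.
    move: vn; rewrite lte_fin => vn.
    have triv : m x - e / 2 < 0 -> exists2 d2, 0 < d2 &
        forall h, 0 < h < d2 -> (m x - e) * h <= D x (x + h).
      move=> me; exists 1 => // h /andP[h0 _]; apply: le_trans (D0 _ _).
      by rewrite pmulr_lle0//; lra.
    case: n vn => [|n] //=; case: (unpickle n) => [q|] // wq.
    have [d2 d20 H2] := dw q _ e20; exists d2 => // h /andP[h0 hd].
    have := H2 h; rewrite gtr0_norm// => /(_ hd); rewrite ler_norml => /andP[H _].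
    have Dt := Dtri (ratr q) x (x + h).
    have : (m x - e / 2) * h <= w q x * h by rewrite ler_pM2r// ltW.
    by lra.
  exists (Num.min d1 d2); first by rewrite lt_min d10.
  move=> h /andP[h0]; rewrite lt_min => /andP[hd1 hd2].
  have := H1 h; rewrite gtr0_norm// => /(_ hd1); rewrite ler_norml => /andP[_ A].
  have B := H2 h; rewrite h0 hd2 in B; have := B isT => {}B.
  have C := Dm x (x + h); rewrite lerDl (ltW h0) in C; have := C isT => {}C.
  rewrite -primitiveB// ?lerDl ?(ltW h0)// in C.
  by rewrite ler_norml; apply/andP; split; lra.
Qed.

End MetricDerivative.

(** * Extension and gluing on the line *)

Section Extension.
Context {R : realType}.
Local Notation mu := (@lebesgue_measure R).
Implicit Types (a b c w phi psi u : R -> R) (s t r : R).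

(* The asymmetric pseudo-distance on the line given by a density [a] for moving
   to the right and a density [b] for moving to the left. *)
Definition travel a b s t := if s <= t then itv_int a s t else itv_int b t s.

Lemma travelxx a b s : travel a b s s = 0.
Proof. by rewrite /travel lexx itv_intxx. Qed.

Lemma travel_triangle a b s r t : integrable_fun a -> integrable_fun b ->
  (forall x, 0 <= a x) -> (forall x, 0 <= b x) ->
  travel a b s t <= travel a b s r + travel a b r t.
Proof.
move=> ia ib a0 b0; rewrite /travel.
have Ja x y := itv_int_ge0 x y a0; have Jb x y := itv_int_ge0 x y b0.
have [st|ts] := leP s t; have [sr|rs] := leP s r; have [rt|tr] := leP r t.
- by rewrite -itv_intD.
- rewrite -[leLHS]addr0 lerD// ?Jb//; apply: itv_int_sub => //; exact: ltW.
- rewrite -[leLHS]add0r lerD// ?Jb//; apply: itv_int_sub => //; exact: ltW.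
- by move: (lt_trans tr rs); rewrite ltNge st.
- by move: (le_lt_trans (le_trans sr rt) ts); rewrite ltxx.
- rewrite -[leLHS]add0r lerD// ?Ja//; apply: itv_int_sub => //; exact: ltW.
- rewrite -[leLHS]addr0 lerD// ?Ja//; apply: itv_int_sub => //; exact: ltW.
- by rewrite addrC -itv_intD// ltW.
Qed.

Lemma le_travel a b a' b' s t : integrable_fun a -> integrable_fun b ->
  integrable_fun a' -> integrable_fun b' ->
  {ae mu, forall x, Num.min s t < x <= Num.max s t -> a x <= a' x /\ b x <= b' x} ->
  travel a b s t <= travel a' b' s t.
Proof.
move=> ia ib ia' ib' H; rewrite /travel; case: (leP s t) H => st H;
  by apply: le_itv_int => //; apply: (ae_imp H) => x {}H /H[].
Qed.

(** It turns a bound known only at the times of [E] into a function on the whole line with the same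
    densities, by McShane's infimum over [r] in [E] of [phi r + travel a b r t]. *)
Lemma McShane_extension a b (E : set R) phi : integrable_fun a -> integrable_fun b ->
  (forall x, 0 <= a x) -> (forall x, 0 <= b x) -> E !=set0 ->
  (forall s t, E s -> E t -> phi t - phi s <= travel a b s t) ->
  exists2 u, (forall t, E t -> u t = phi t) &
    forall s t, u t - u s <= travel a b s t.
Proof.
move=> ia ib a0 b0 [r0 Er0] H.
pose S t := [set phi r + travel a b r t | r in E].
have tri s r t : travel a b s t <= travel a b s r + travel a b r t.
  exact: travel_triangle.
have Slb t : has_inf (S t).
  split; first by exists (phi r0 + travel a b r0 t), r0.
  exists (phi r0 - travel a b t r0) => _ [r Er <-].
  by have := H _ _ Er Er0; have := tri r t r0 => ? ?; lra.
have le_u t r : E r -> inf (S t) <= phi r + travel a b r t.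
  by move=> Er; apply: ge_inf; [case: (Slb t)|exists r].
exists (fun t => inf (S t)).
- move=> t Et; apply/eqP; rewrite eq_le; apply/andP; split.
    by apply: (le_trans (le_u _ _ Et)); rewrite travelxx addr0.
  apply: lb_le_inf; first by case: (Slb t).
  by move=> _ [r Er <-]; have := H _ _ Er Et => ?; lra.
- move=> s t; rewrite lerBlDl -lerBlDr; apply: lb_le_inf; first by case: (Slb s).
  move=> _ [r Er <-]; have := le_u t _ Er; have := tri r s t => ? ?; lra.
Qed.

Lemma travel_ge0 a b s t : (forall x, 0 <= a x) -> (forall x, 0 <= b x) ->
  0 <= travel a b s t.
Proof. by move=> a0 b0; rewrite /travel; case: ifP => _; exact: itv_int_ge0. Qed.

Lemma travel_norm a b u : integrable_fun a -> integrable_fun b ->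
  (forall x, 0 <= a x) -> (forall x, 0 <= b x) ->
  (forall s t, u t - u s <= travel a b s t) ->
  forall s t, s <= t -> `|u t - u s| <= itv_int (fun x => a x + b x) s t.
Proof.
move=> ia ib a0 b0 H s t st; rewrite itv_intDfun//.
have := H s t; rewrite {1}/travel st => h1.
have h2 : u s - u t <= itv_int b s t.
  have [ts|st'] := leP t s; last by have := H t s; rewrite /travel (lt_geF st').
  have -> : s = t by apply/eqP; rewrite eq_le st ts.
  by rewrite subrr itv_int_ge0.
have := itv_int_ge0 s t a0; have := itv_int_ge0 s t b0 => ? ?.
by rewrite ler_norml; apply/andP; split; lra.
Qed.

Lemma continuous_of_itv_int c u : integrable_fun c ->
  (forall s t, s <= t -> `|u t - u s| <= itv_int c s t) -> continuous u.
Proof.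
move=> ic H x; apply/cvgrPdist_lt => e e0.
have [del del0 small] := itv_int_small ic e0.
near=> y.
have yx : `|x - y| < del by near: y; exact: cvgr_dist_lt.
have [xy|yx'] := leP x y.
  rewrite distrC; apply: (le_lt_trans (H _ _ xy)).
  apply: (le_lt_trans (ler_norm _)); apply: small => //.
  by apply: le_lt_trans yx; rewrite distrC ler_norm.
apply: (le_lt_trans (H _ _ (ltW yx'))).
apply: (le_lt_trans (ler_norm _)); apply: small => //; first exact: ltW.
by apply: le_lt_trans yx; rewrite ler_norm.
Unshelve. all: by end_near. Qed.

(** The sum of the increments is at most the integral of [|c|] over the union of the intervals,
    which is small by absolute continuity of the integral. *)
Lemma absolutely_continuous01_itv_int c u : integrable_fun c ->
  (forall s t, s <= t -> `|u t - u s| <= itv_int c s t) ->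
  absolutely_continuous01 u.
Proof.
move=> ic H e e0; have [del [del0 Hd]] := integral_normr_continuous ic e0.
exists del => // n x y xy triv small.
pose F i := `]x i, y i[%classic; pose A := \big[setU/set0]_(i < n) F i.
have mF i : measurable (F i) by exact: measurable_itv.
have mA : measurable A by exact: bigsetU_measurable.
have trivF : trivIset [set` index_enum 'I_n] F by apply: sub_trivIset triv => i.
have mc : measurable_fun setT c by apply/measurable_EFinP; exact: (measurable_int mu).
have muF i : mu (F i) = (y i - x i)%:E.
  rewrite /F lebesgue_measure_itv/= lte_fin; have [_ xyi _] := xy i.
  by move: xyi; rewrite le_eqVlt => /predU1P[->|->//]; rewrite ltxx subrr.
have muA : (mu A < del%:E)%E.
  have -> : mu A = (\int[mu]_(z in A) cst 1%E z)%E.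
    by rewrite integral_cst// mul1e.
  rewrite ge0_integral_bigsetU//; last exact: index_enum_uniq.
  rewrite (eq_bigr (fun i => (y i - x i)%:E)); last first.
    move=> i _; have := integral_cst mu (mF i) 1%E.
    by rewrite mul1e => ->; exact: muF.
  by rewrite sumEFin lte_fin.
have := Hd A mA muA; apply: le_lt_trans.
have intc (B : set R) : measurable B ->
    (\int[mu]_(z in B) `|c z|)%:E = (\int[mu]_(z in B) `|c z|%:E)%E.
  move=> mB; rewrite /Rintegral fineK//; apply: integrable_fin_num => //.
  by apply: integrableS (integrable_abse ic).
rewrite -lee_fin intc// ge0_integral_bigsetU//; last 2 first.
- exact: index_enum_uniq.
- by apply: measurable_funTS; apply/measurable_EFinP; exact: measurableT_comp.
rewrite -sumEFin; apply: lee_sum => i _; rewrite -intc// lee_fin.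
have [_ xyi _] := xy i; apply: (le_trans (H _ _ xyi)).
apply: (le_trans (ler_norm _)).
apply: (le_trans (le_normr_Rintegral _ _)) => //; first exact: integrable_funS.
rewrite -lee_fin !intc// le_eqVlt; apply/orP; left; apply/eqP.
rewrite -(@integral_itv_bndo_bndc _ (BRight (x i)))//.
by apply: measurable_funTS; apply/measurable_EFinP; exact: measurableT_comp.
Qed.

End Extension.

Section Restriction.
Context {R : realType}.
Local Notation mu := (@lebesgue_measure R).

Lemma integrable_fun_measurable (a : R -> R) : integrable_fun a -> measurable_fun setT a.
Proof. by move=> ia; apply/measurable_EFinP; exact: (measurable_int mu). Qed.

Lemma integrable_fun_le (a b : R -> R) : measurable_fun setT a ->
  (forall x, 0 <= a x <= b x) -> integrable_fun b -> integrable_fun a.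
Proof.
move=> ma ab; apply: le_integrable => //; first exact/measurable_EFinP.
by move=> x _ /=; have /andP[a0 ab'] := ab x; rewrite lee_fin !ger0_norm// (le_trans a0).
Qed.

Lemma integrable_fun_if (a : R -> R) (P : R -> bool) : measurable_fun setT P ->
  (forall x, 0 <= a x) -> integrable_fun a ->
  integrable_fun (fun x => if P x then a x else 0).
Proof.
move=> mP a0 ia; apply: (integrable_fun_le _ _ ia).
  by apply: measurable_fun_ifT => //; exact: integrable_fun_measurable.
by move=> x; case: ifP; rewrite ?lexx a0.
Qed.

End Restriction.

Section Slices.
Context {R : realType}.
Local Notation mu := (@lebesgue_measure R).
Implicit Types (a b c w phi psi u : R -> R) (s t r : R).

Lemma continuous_last_le u s t A : continuous u -> s <= t -> u s <= A ->
  exists r, [/\ s <= r <= t, u r <= A & forall x, r < x <= t -> A < u x].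
Proof.
move=> cu st usA.
pose S := [set x | s <= x <= t /\ u x <= A].
have Ss : S s by split; rewrite ?lexx.
have hS : has_sup S by split; [exists s|exists t => x [/andP[]]].
have rt : sup S <= t by apply: ge_sup; [exists s|move=> x [/andP[]]].
have sr : s <= sup S by apply: ub_le_sup => //; case: hS.
exists (sup S); split.
- by rewrite sr rt.
- have cS : closed S.
    have -> : S = `[s, t]%classic `&` (u @^-1` `]-oo, A]%classic).
      by apply/seteqP; split => x /=; rewrite !in_itv.
    apply: closedI; first exact: interval_closed.
    by apply: preimage_closed; [move=> x _; exact: cu|exact: interval_closed].
  by have [] : S (sup S) by move/closure_id: cS => {1}->; by apply: closure_sup; case: hS.
- move=> x /andP[rx xt]; rewrite ltNge; apply/negP => uxA.
  have : S x by split => //; rewrite xt (le_trans sr)// ltW.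
  by move=> Sx; have := ub_le_sup hS.2 Sx; rewrite leNgt rx.
Qed.

Lemma continuous_first_ge u s t B : continuous u -> s <= t -> B <= u t ->
  exists r, [/\ s <= r <= t, B <= u r & forall x, s <= x < r -> u x < B].
Proof.
move=> cu st utB.
have [|||r [/andP[sr rt] ur H]] := @continuous_last_le (fun x => - u (- x)) (- t) (- s) (- B).
- by move=> x; apply: cvgN; apply: (@continuous_comp _ _ _ -%R u);
    [exact: opp_continuous|exact: cu].
- by rewrite lerN2.
- by rewrite opprK lerN2.
exists (- r); split.
- by rewrite lerNr rt lerNl sr.
- by rewrite -lerN2.
- move=> x /andP[sx xr]; have := H (- x); rewrite opprK ltrN2; apply.
  by rewrite ltrNr xr lerN2.
Qed.

Definition clip (c y : R) := Num.min (Num.max y c) (c + 1).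

Lemma clip_homo (c x y : R) : x <= y -> clip c x <= clip c y.
Proof.
move=> xy; rewrite le_min; apply/andP; split; rewrite ge_min ?lexx ?orbT//.
by rewrite ge_max !le_max xy lexx orbT.
Qed.

(* [u] can only cross the values in [c, c + 1] while its own value is there. *)
Lemma clip_increment g u (c : R) s t : integrable_fun g -> (forall x, 0 <= g x) ->
  continuous u -> (forall x y, x <= y -> u y - u x <= itv_int g x y) ->
  s <= t ->
  clip c (u t) - clip c (u s) <=
    itv_int (fun x => if c < u x < c + 1 then g x else 0) s t.
Proof.
move=> ig g0 cu H st.
set k := (fun x => _).
have k0 x : 0 <= k x by rewrite /k; case: ifP.
have mu_ : measurable_fun setT u by exact: continuous_measurable_fun.
have ik : integrable_fun k.
  apply: integrable_fun_if => //.
  by apply: measurable_and; exact: measurable_fun_ltr.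
have [le|lt] := leP (clip c (u t)) (clip c (u s)).
  by apply: (@le_trans _ _ 0); rewrite ?subr_le0// itv_int_ge0.
have [uc uc1 ust] : [/\ c < u t, u s < c + 1 & u s < u t].
  split.
  - rewrite ltNge; apply: contraTN lt => utc; rewrite -leNgt.
    rewrite {1}/clip (max_r utc) min_l ?lerDl//.
    by rewrite /clip le_min le_max lexx orbT lerDl ler01.
  - rewrite ltNge; apply: contraTN lt => usc; rewrite -leNgt.
    rewrite [leRHS]/clip min_r ?le_max ?usc//.
    by rewrite ge_min lexx orbT.
  - by rewrite ltNge; apply: contraTN lt => uts; rewrite -leNgt clip_homo.
pose A := Num.max (u s) c; pose B := Num.min (u t) (c + 1).
have AE : clip c (u s) = A by rewrite /clip min_l// ge_max (ltW uc1)/= lerDl.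
have BE : clip c (u t) = B by rewrite /clip /B (max_l (ltW uc)).
(* Between the last time [s'] with [u <= A] and the first later time [t'] with [u >= B], the values
   of [u] are strictly between [A] and [B], hence between [c] and [c + 1]; yet [u] already increases
   by at least [B - A] from [s'] to [t']. *)
have [|s' [/andP[ss st'] us' H1]] := @continuous_last_le u s t A cu st.
  by rewrite le_max lexx.
have [|t' [/andP[s't' t't] ut' H2]] := @continuous_first_ge u s' t B cu st'.
  by rewrite ge_min lexx.
rewrite AE BE; apply: (@le_trans _ _ (itv_int g s' t')).
  by have := H _ _ s't' => ?; lra.
apply: (@le_trans _ _ (itv_int k s' t')); last exact: itv_int_sub.
apply: le_itv_int => //.
(* The half-open interval contains [t'], where [u < B] fails. *)
have : {ae mu, forall x, x <> t'}.
  exists [set t']; split; [exact: measurable_set1|exact: lebesgue_measure_set1|].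
  by move=> x /= /contrapT.
move=> /ae_imp; apply => x /eqP xt' /andP[s'x]; rewrite le_eqVlt (negbTE xt')/= => xlt.
have := H1 x; rewrite s'x (le_trans (ltW xlt) t't) => /(_ isT).
have := H2 x; rewrite xlt (ltW s'x) => /(_ isT).
by rewrite lt_min gt_max /k => /andP[_ ->] /andP[_ ->].
Qed.

End Slices.

Section Truncations.
Context {R : realType}.
Local Notation mu := (@lebesgue_measure R).
Implicit Types (phi u g : R -> R) (s t x y : R) (a b : nat -> R -> R).

Definition trunc (N : nat) y : R := Num.min (Num.max y (- N%:R)) N%:R.

Definition truncr (n y : R) : R := Num.min (Num.max y (- n)) n.

Lemma truncrN (n y : R) : 0 <= n -> truncr n (- y) = - truncr n y.
Proof.
move=> n0; rewrite /truncr.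
have nn : - n <= n by lra.
have [h1|h1] := leP (- y) (- n); have [h2|h2] := leP y (- n).
- by rewrite (min_l nn); lra.
- by rewrite (min_l nn) min_r ?opprK//; lra.
- by rewrite (min_l nn) min_r ?opprK//; lra.
- by rewrite !min_l//; lra.
Qed.

(** What is gained from [n] to [n + 1] comes from the slice above [n] or from the one below [-n].
    Between them the two clips are the constants [n] and [-n], which cancel. *)
Lemma truncrB (n y : R) : 0 <= n ->
  truncr (n + 1) y - truncr n y = clip n y + clip (- (n + 1)) y.
Proof.
move=> n0; rewrite /truncr /clip.
have -> : - (n + 1) + 1 = - n :> R by lra.
have [h1|h1] := leP y (- (n + 1)); have [h2|h2] := leP y (- n);
  have [h3|h3] := leP y n; try lra.
- rewrite (min_l (_ : - (n + 1) <= n + 1)) ?(min_l (_ : - n <= n)); try lra.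
  by rewrite (min_l (_ : n <= n + 1)) ?(min_l (_ : - (n + 1) <= - n)); lra.
- rewrite (min_l (_ : y <= n + 1)) ?(min_l (_ : - n <= n)); try lra.
  by rewrite (min_l (_ : n <= n + 1)) ?(min_l (_ : y <= - n)); lra.
- rewrite (min_l (_ : y <= n + 1)); last by lra.
  by rewrite (min_l (_ : n <= n + 1)) ?(min_r (_ : - n <= y)); lra.
Qed.

Lemma truncr_id (n y : R) : `|y| <= n -> truncr n y = y.
Proof. by rewrite ler_norml => /andP[h1 h2]; rewrite /truncr max_l// min_l. Qed.

Lemma truncr_truncr (m n y : R) : 0 <= m <= n -> truncr m (truncr n y) = truncr m y.
Proof.
move=> /andP[m0 mn]; rewrite /truncr; have [h1|h1] := leP y (- n).
  rewrite (min_l (_ : - n <= n)); last by lra.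
  by rewrite !max_r//; lra.
have [h2|h2] := leP y n; first by [].
by rewrite (max_l (_ : - m <= n)) ?(max_l (_ : - m <= y)) ?min_r; lra.
Qed.

Lemma norm_truncr_lt (m y : R) : 0 <= m -> (`|truncr m y| < m) = (`|y| < m).
Proof.
move=> m0.
have [h1|h1] := ltP `|y| m; first by rewrite truncr_id// ?ltW.
apply/negbTE; rewrite -leNgt; case: (ler0P y) h1 => y0 h1.
  by rewrite /truncr max_r ?min_l ?normrN ?ger0_norm//; lra.
by rewrite /truncr max_l ?min_r ?ger0_norm//; lra.
Qed.

Lemma norm_truncr_gt (m n y : R) : 0 <= m < n -> (m < `|truncr n y|) = (m < `|y|).
Proof.
move=> /andP[m0 mn].
have [h1|h1] := leP `|y| n; first by rewrite truncr_id.
rewrite (lt_trans mn h1); apply: (lt_le_trans mn).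
rewrite leNgt norm_truncr_lt; last by lra.
by rewrite -leNgt ltW.
Qed.

Lemma truncN N y : trunc N (- y) = - trunc N y.
Proof. exact: truncrN. Qed.

Lemma trunc_step (M : nat) y :
  trunc M.+1 y - trunc M y = clip M%:R y + clip (- M.+1%:R) y.
Proof. by rewrite /trunc -natr1; exact: truncrB. Qed.

Lemma trunc_id (M : nat) y : `|y| <= M%:R -> trunc M y = y.
Proof. exact: truncr_id. Qed.

Lemma trunc_trunc (M N : nat) y : (M <= N)%N -> trunc M (trunc N y) = trunc M y.
Proof. by move=> MN; apply: truncr_truncr; rewrite ler0n ler_nat. Qed.

Lemma norm_trunc_lt (M : nat) y : (`|trunc M y| < M%:R) = (`|y| < M%:R).
Proof. exact: norm_truncr_lt. Qed.

Lemma norm_trunc_gt (M N : nat) y : (M < N)%N ->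
  (M%:R < `|trunc N y|) = (M%:R < `|y|).
Proof. by move=> MN; apply: norm_truncr_gt; rewrite ler0n ltr_nat. Qed.

Lemma trunc_increment g u (M : nat) s t : integrable_fun g -> (forall x, 0 <= g x) ->
  continuous u -> (forall x y, x <= y -> u y - u x <= itv_int g x y) ->
  s <= t ->
  (trunc M.+1 (u t) - trunc M (u t)) - (trunc M.+1 (u s) - trunc M (u s)) <=
    itv_int (fun x => if M%:R < `|u x| < M.+1%:R then g x else 0) s t.
Proof.
move=> ig g0 cu H st; rewrite !trunc_step.
have mu_ : measurable_fun setT u by exact: continuous_measurable_fun.
have iif (P : R -> bool) : measurable_fun setT P ->
  integrable_fun (fun x => if P x then g x else 0).
  by move=> mP; exact: integrable_fun_if.
have i1 (c : R) : integrable_fun (fun x => if c < u x < c + 1 then g x else 0).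
  by apply: iif; apply: measurable_and; exact: measurable_fun_ltr.
have := clip_increment M%:R ig g0 cu H st.
have := clip_increment (- M.+1%:R) ig g0 cu H st => A B.
have := lerD A B; rewrite -itv_intDfun// => C.
apply: (le_trans (_ : _ <= _) (le_trans C _)); first by lra.
apply: le_itv_int.
- exact: integrable_funD.
- apply: iif; apply: measurable_and; apply: measurable_fun_ltr => //;
  exact: measurableT_comp.
- apply: aeW => x _; have M0 : 0 <= M%:R :> R by [].
  have gx := g0 x; rewrite -natr1.
  case: ifPn => [/andP[h1 h2]|_]; case: ifPn => [/andP[h3 h4]|_].
  + lra.
  + rewrite ltr0_norm; last by lra.
    by case: ifPn => //; [lra|rewrite negb_and -!leNgt => /orP[]; lra].
  + rewrite gtr0_norm; last by lra.
    by rewrite h3 h4 /=; lra.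
  + by rewrite addr0; case: ifP.
Qed.

(* On the slice [N <= |phi| < N + 1] only the [N.+1]-st truncation varies, and a
   McShane extension of it has to spend the increment inside the slice. *)
Lemma glue_truncations phi (E : set R) a b : measurable_fun setT phi ->
  (forall x, E x -> 0 <= x <= 1) ->
  {ae mu, forall x, 0 <= x <= 1 -> E x} ->
  (forall N, integrable_fun (a N)) -> (forall N, integrable_fun (b N)) ->
  (forall N x, 0 <= a N x) -> (forall N x, 0 <= b N x) ->
  (forall N s t, E s -> E t ->
    trunc N (phi t) - trunc N (phi s) <= travel (a N) (b N) s t) ->
  let ha x := a (Num.bound (phi x)) x in
  let hb x := b (Num.bound (phi x)) x in
  integrable_fun ha -> integrable_fun hb ->
  forall s t, E s -> E t -> phi t - phi s <= travel ha hb s t.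
Proof.
move=> mphi E01 aeE ia ib a0 b0 H ha hb iha ihb s t Es Et.
(* [Num.bound y] is the integer part of [|y|] plus one: on the slice from [M] to [M + 1], the
   densities [ha] and [hb] are those of the truncation at [M + 1]. *)
have boundE (M : nat) x : M%:R <= `|phi x| < M.+1%:R -> Num.bound (phi x) = M.+1.
  by move=> h; rewrite /Num.bound (truncn_def h).
have ha0 x : 0 <= ha x by exact: a0.
have hb0 x : 0 <= hb x by exact: b0.
pose lt_ (h : R -> R) (M : nat) x := if `|phi x| < M%:R then h x else 0.
pose in_ (h : R -> R) (M : nat) x := if M%:R < `|phi x| < M.+1%:R then h x else 0.
have mn : measurable_fun setT (fun x => `|phi x|) by exact: measurableT_comp.
have ilt h M : integrable_fun h -> (forall x, 0 <= h x) -> integrable_fun (lt_ h M).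
  by move=> ih h0; apply: integrable_fun_if => //; exact: measurable_fun_ltr.
have iin h M : integrable_fun h -> (forall x, 0 <= h x) -> integrable_fun (in_ h M).
  move=> ih h0; apply: integrable_fun_if => //.
  by apply: measurable_and; exact: measurable_fun_ltr.
have step M : (trunc M.+1 (phi t) - trunc M (phi t)) -
      (trunc M.+1 (phi s) - trunc M (phi s)) <=
    travel (in_ (a M.+1) M) (in_ (b M.+1) M) s t.
  have [u uE Hu] := McShane_extension (ia M.+1) (ib M.+1) (a0 M.+1) (b0 M.+1)
    (ex_intro _ s Es) (H M.+1).
  have cu : continuous u.
    apply: (continuous_of_itv_int (integrable_funD (ia M.+1) (ib M.+1))).
    exact: travel_norm.
  have tE (x : R) : E x -> (trunc M.+1 (u x) = trunc M.+1 (phi x)) *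
      (trunc M (u x) = trunc M (phi x)).
    by move=> Ex; rewrite uE// !trunc_trunc.
  have inE_ x : E x -> (M%:R < `|u x| < M.+1%:R) = (M%:R < `|phi x| < M.+1%:R).
    by move=> Ex; rewrite uE// norm_trunc_lt norm_trunc_gt.
  have mu_ : measurable_fun setT u by exact: continuous_measurable_fun.
  have iif g : integrable_fun g -> (forall x, 0 <= g x) ->
      integrable_fun (fun x => if M%:R < `|u x| < M.+1%:R then g x else 0).
    move=> ig g0; apply: integrable_fun_if => //.
    by apply: measurable_and; apply: measurable_fun_ltr => //; exact: measurableT_comp.
  rewrite /travel; case: (leP s t) => [st|ts].
    rewrite -!(tE s Es) -!(tE t Et); apply: (le_trans (trunc_increment M (ia M.+1) (a0 M.+1) cu _ st)).
      by move=> x y xy; have := Hu x y; rewrite /travel xy.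
    apply: le_itv_int; [exact: iif|exact: iin|].
    apply: (ae_imp aeE) => x Ex /andP[sx xt].
    rewrite /in_ inE_//; apply: Ex.
    have /andP[s0 _] := E01 _ Es; have /andP[_ t1] := E01 _ Et.
    by rewrite (le_trans s0 (ltW sx)) (le_trans xt t1).
  (* For [t < s] the difference [phi t - phi s] becomes the increment of [- u] from [t] to [s],
     governed by [b]; truncation is odd, so the increasing case applies to [- u]. *)
  have cNu : continuous (fun x => - u x) by move=> x; apply: cvgN; exact: cu.
  have := trunc_increment M (ib M.+1) (b0 M.+1) cNu _ (ltW ts).
  rewrite !truncN !tE// => inc.
  apply: le_trans (_ : _ <= _) _; last first.
    apply: le_trans (inc _) _.
      move=> x y xy; rewrite opprK addrC.
      have [yx|xy'] := leP y x.
        have -> : x = y by apply/eqP; rewrite eq_le xy.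
        by rewrite subrr itv_int_ge0.
      by have := Hu y x; rewrite /travel (lt_geF xy').
    apply: le_itv_int; [|exact: iin|].
      by under eq_fun do rewrite normrN; exact: iif.
    apply: (ae_imp aeE) => x Ex /andP[sx xt].
    rewrite /in_ normrN inE_//; apply: Ex.
    have /andP[s0 _] := E01 _ Et; have /andP[_ t1] := E01 _ Es.
    by rewrite (le_trans s0 (ltW sx)) (le_trans xt t1).
  by lra.
have travelD f1 f2 g1 g2 : integrable_fun f1 -> integrable_fun f2 ->
   integrable_fun g1 -> integrable_fun g2 ->
   travel f1 g1 s t + travel f2 g2 s t =
   travel (fun x => f1 x + f2 x) (fun x => g1 x + g2 x) s t.
  by move=> *; rewrite /travel; case: ifP => _; rewrite itv_intDfun.
have main M : trunc M (phi t) - trunc M (phi s) <= travel (lt_ ha M) (lt_ hb M) s t.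
  elim: M => [|M IH].
    rewrite (_ : trunc 0 (phi t) - _ = 0).
      by apply: travel_ge0 => x; rewrite /lt_; case: ifP.
    have t0 y : trunc 0 y = 0 by rewrite /trunc oppr0; case: (leP y 0) => ?; rewrite ?minxx ?min_r// ltW.
    by rewrite !t0 subrr.
  have := lerD IH (step M); rewrite travelD; [|exact: ilt|exact: iin|exact: ilt|exact: iin].
  move=> h; apply: (le_trans (_ : _ <= _) (le_trans h _)); first by lra.
  apply: le_travel.
  - by apply: integrable_funD; [exact: ilt|exact: iin].
  - by apply: integrable_funD; [exact: ilt|exact: iin].
  - exact: ilt.
  - exact: ilt.
  - apply: aeW => x _; rewrite /lt_ /in_ /ha /hb.
    have [h1|h1] := ltP `|phi x| M%:R.
      by rewrite (lt_gtF h1)/= !addr0 (lt_trans h1) ?ltr_nat.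
    rewrite !add0r; case: ifPn => [/andP[h2 h3]|_].
      by rewrite h3 (@boundE M) ?h1//; split.
    by case: ifP; rewrite ?lexx; split; rewrite ?ha0 ?hb0.
(* At this level truncation leaves both end values unchanged. *)
pose M := maxn (Num.bound (phi s)) (Num.bound (phi t)).
have bM x : (Num.bound (phi x) <= M)%N -> trunc M (phi x) = phi x.
  rewrite -(ler_nat R) => bM; apply: trunc_id; apply: le_trans bM.
  by have /andP[_ /ltW] := truncn_itv (normr_ge0 (phi x)).
have := main M; rewrite !bM ?leq_maxl ?leq_maxr//.
move=> h; apply: (le_trans h); apply: le_travel => //; try exact: ilt.
by apply: aeW => x _; rewrite /lt_; case: ifP; rewrite ?ha0 ?hb0 ?lexx.
Qed.

End Truncations.

(** * Curves and their speed *)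

Section CurveSpace.
Context {R : realType} {X : ptopologicalType}.
Implicit Types (g : curve R X) (s t : R).

Lemma ev_clamp t g : ev (Num.min 1 (Num.max 0 t)) g = ev t g.
Proof.
rewrite /ev; congr ((g : continuousType _ _) _); apply: val_inj => /=.
set c := Num.min 1 (Num.max 0 t).
have c0 : 0 <= c by rewrite le_min ler01 le_max lexx.
have c1 : c <= 1 by rewrite ge_min lexx.
by rewrite (max_r c0) (min_r c1).
Qed.

Lemma ev_continuous g : continuous (ev ^~ g : R -> X).
Proof.
move=> t; apply: (@continuous_comp _ _ _ (@clamp R) (g : continuousType _ _)).
  exact: clamp_continuous.
exact: cts_fun.
Qed.

Lemma open_curve (K : set (unit_itv R)) (O : set X) : compact K -> open O ->
  open [set g : curve R X | (g : continuousType (unit_itv R) X) @` K `<=` O].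
Proof.
move=> cK oO.
have := @open_comp (curve R X) {compact-open, unit_itv R -> X}
  ((fun g => g) : curve R X -> {compact-open, unit_itv R -> X})
  [set g | g @` K `<=` O] _ (compact_open_open cK oO).
apply=> g _; exact: initial_continuous.
Qed.

Lemma measurable_borel (Y : ptopologicalType) (A : set Y) : open A ->
  measurable (A : set (borel Y)).
Proof. by move=> oA; apply: sub_sigma_algebra. Qed.

Lemma measurable_fun_borel d (T : measurableType d) (Y : ptopologicalType)
  (f : T -> borel Y) : (forall A : set Y, open A -> measurable (f @^-1` A)) ->
  measurable_fun setT f.
Proof.
move=> fo; apply: (@measurability _ _ T (borel Y) setT f (@open Y)) => //.
by move=> _ [A oA <-]; rewrite setTI; exact: fo.
Qed.

Lemma ev_measurable t : measurable_fun setT (ev t : borel (curve R X) -> borel X).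
Proof.
apply: measurable_fun_borel => A oA; apply: measurable_borel.
have := open_curve (@compact_set1 _ (clamp t)) oA.
congr open; apply/seteqP; split => g /=.
  by apply; exists (clamp t).
by move=> gt _ [_ -> <-].
Qed.

(** Precomposition is continuous for the compact-open topology: a condition on the stretched curve
    over [K] is one on the curve over the image of [K]. *)
Lemma stretch_measurable (t1 t2 : R) : measurable_fun setT
  (stretch t1 t2 : borel (curve R X) -> borel (curve R X)).
Proof.
apply: measurable_fun_borel => A oA; apply: measurable_borel.
apply: open_comp oA => g _; move: g.
apply: continuous_comp_initial => g; apply/compact_open_cvgP.
  apply: fmap_filter; exact: nbhs_filter.
move=> K O cK oO gKO.
have cAK : compact (@affine_itv R t1 t2 @` K).
  apply: continuous_compact => //; apply: continuous_subspaceT.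
  exact: affine_itv_continuous.
have := open_curve cAK oO; rewrite openE => /(_ g).
have sub (h : curve R X) : ((h : continuousType _ _) @` (@affine_itv R t1 t2 @` K) `<=` O) <->
   ((stretch t1 t2 h : continuousType _ _) @` K `<=` O).
  split => H.
    by move=> _ [k Kk <-]; apply: H; exists (affine_itv t1 t2 k) => //; exists k.
  by move=> _ [_ [k Kk <-] <-]; apply: H; exists k.
move=> H; have := H ((sub g).2 gKO); rewrite /interior.
by apply: filterS => h /sub.
Qed.

Lemma ev_stretch t1 t2 t g : 0 <= t <= 1 ->
  ev t (stretch t1 t2 g) = ev ((1 - t) * t1 + t * t2) g.
Proof.
move=> /andP[t0 t1']; rewrite /ev /stretch /=; congr ((g : continuousType _ _) _).
have E : set_val (clamp t) = t.
  by rewrite -[LHS]/(Num.min 1 (Num.max 0 t)) (max_r t0) (min_r t1').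
by rewrite -[LHS]/(clamp ((1 - set_val (clamp t)) * t1 + set_val (clamp t) * t2)) E.
Qed.

End CurveSpace.

(** * Joint measurability of evaluation and speed *)

Section JointMeasurability.
Context {R : realType} {X : ptopologicalType}.
Implicit Types (g : curve R X) (s t : R).

Lemma truncn_measurable (i : nat) :
  measurable [set t : R | Num.truncn t = i].
Proof.
case: i => [|i].
  rewrite (_ : [set _ | _] = `]-oo, 1[%classic) //.
  apply/seteqP; split => t /=; rewrite in_itv/=.
    by move/truncn0Pn; rewrite -ltNge.
  by move=> t1; apply/truncn0Pn; rewrite -ltNge.
rewrite (_ : [set _ | _] = `[i.+1%:R, i.+2%:R[%classic) //.
apply/seteqP; split => t /=; rewrite in_itv/=; last exact: truncn_def.
move=> ti; have [t_0|t_0] := leP 0 t; first by rewrite -ti truncn_itv.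
have /truncn0Pn : ~~ (1 <= t) by rewrite -ltNge (lt_trans t_0).
by rewrite ti.
Qed.

Hypothesis metX : completely_metrizable R X.

(** Evaluation at the largest multiple of [1 / (n + 1)] before [t] is jointly measurable, as it
    involves countably many fixed times. By continuity of the curves it converges to evaluation at
    [t]. *)
Lemma ev_pair_measurable :
  measurable_fun setT (fun z : borel (curve R X) * R => ev z.2 z.1 : borel X).
Proof.
have [rho [rho0 rhoC rhoD nbhsE _]] := metX.
pose e (n : nat) (z : borel (curve R X) * R) : X :=
  ev ((Num.truncn (z.2 * n.+1%:R))%:R / n.+1%:R) z.1.
have me n (O : set X) : open O -> measurable (e n @^-1` O).
  move=> oO.
  have -> : e n @^-1` O = \bigcup_i (
      (ev (i%:R / n.+1%:R) @^-1` O : set (borel (curve R X))) `*`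
      ((fun t : R => t * n.+1%:R) @^-1` [set t | Num.truncn t = i])).
    apply/seteqP; split => -[g t] /=; rewrite /e /=.
      by move=> H; exists (Num.truncn (t * n.+1%:R)).
    by move=> [i _ [/= H ti]]; rewrite ti.
  apply: bigcupT_measurable => i; apply: measurableX.
    rewrite -[X in measurable X]setTI.
    by apply: (@ev_measurable R X) => //; exact: measurable_borel.
  rewrite -[X in measurable X]setTI.
  have mm : measurable_fun setT (fun t : R => t * n.+1%:R) by exact: mulrr_measurable.
  by apply: mm => //; exact: truncn_measurable.
apply: measurable_fun_borel => U oU.
(* Points inside [U] with a margin above [1 / (k + 1)]: a limit of points of [Uk k] is still in [U],
   so that being in [U] reads as being eventually in some [Uk k]. *)
pose Uk (k : nat) := [set x : X | exists r, k.+1%:R^-1 < r /\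
  [set y | rho x y < r] `<=` U].
have oUk k : open (Uk k).
  rewrite openE => x [r [kr xrU]]; rewrite /interior nbhsE.
  exists ((r - k.+1%:R^-1) / 2); first by rewrite /= divr_gt0// subr_gt0.
  move=> y /= xy; exists ((r + k.+1%:R^-1) / 2); split.
    have mid (c c' : R) : c < c' -> c < (c' + c) / 2 by move=> ?; lra.
    exact: mid.
  move=> z /= yz; apply: xrU => /=; apply: (le_lt_trans (rhoD _ y _)).
  have mid (c c' p p' : R) : p < (c' - c) / 2 -> p' < (c' + c) / 2 -> p + p' < c'.
    by move=> ? ?; lra.
  exact: mid xy yz.
have -> : (fun z : borel (curve R X) * R => ev z.2 z.1) @^-1` U =
    \bigcup_k \bigcup_N \bigcap_(n in [set n | (N <= n)%N]) (e n @^-1` Uk k).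
  have near_e (z : borel (curve R X) * R) r : 0 < r ->
      exists N, forall n, (N <= n)%N -> rho (ev z.2 z.1) (e n z) < r.
    case: z => g t r0 /=.
    have rhoxx x : rho x x = 0 by apply/rho0.
    (* At negative numbers [Num.truncn] is [0], in accordance with the clamping in [ev]. *)
    have [t0|t0] := ltP t 0.
      exists 0%N => n _; rewrite /e /=.
      have -> : Num.truncn (t * n.+1%:R) = 0%N.
        by apply/truncn0Pn; rewrite -ltNge (@lt_le_trans _ _ 0)// pmulr_llt0.
      rewrite mul0r -(ev_clamp t) (max_l (ltW t0)) min_r// rhoxx//.
    have : \forall s \near t, rho (ev t g) (ev s g) < r.
      have /(_ [set y | rho (ev t g) y < r]) := @ev_continuous _ _ g t; apply.
      by rewrite nbhsE; exists r.
    move=> [del /= del0 Hdel].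
    have [N _ HN] := near_infty_natSinv_lt (PosNum del0).
    exists N => n Nn; rewrite /e /=; apply: Hdel => /=.
    apply: le_lt_trans (HN _ Nn).
    have n0 : 0 < n.+1%:R :> R by [].
    have /truncn_itv/andP[h1 h2] : 0 <= t * n.+1%:R by rewrite mulr_ge0.
    rewrite ger0_norm ?subr_ge0 ?ler_pdivrMr//.
    rewrite -(ler_pM2r n0) mulrBl divfK ?gt_eqF// mulVf ?gt_eqF//.
    by move: h2; rewrite -natr1 => h2; lra.
  apply/seteqP; split => z /=.
    move=> Uz; move: (oU); rewrite openE => /(_ _ Uz).
    rewrite /interior nbhsE => -[r /= r0 rU].
    have [k _ kr] : exists2 k, True & k.+1%:R^-1 < r / 2.
      have r20 : 0 < r / 2 by rewrite divr_gt0.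
      have [N _ HN] := near_infty_natSinv_lt (PosNum r20).
      by exists N => //; exact: (HN N (leqnn N)).
    have [N HN] := near_e z (r / 2) (divr_gt0 r0 (ltr0n _ 2)).
    exists k => //; exists N => // n /= Nn; exists (r / 2); split => // y /= ey.
    apply: rU => /=; apply: (le_lt_trans (rhoD _ (e n z) _)).
    by have := HN _ Nn; lra.
  move=> [k _ [N _ HN]].
  have k0 : 0 < k.+1%:R^-1 :> R by rewrite invr_gt0.
  have [N' HN'] := near_e z _ k0.
  have := HN (maxn N N') (leq_maxl _ _) => -[r [kr]]; apply => /=.
  by rewrite rhoC (lt_trans _ kr)// HN'// leq_maxr.
apply: bigcupT_measurable => k; apply: bigcupT_measurable => N.
by apply: bigcap_measurable => [|n _]; [exists N => /=|exact: me].
Qed.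

End JointMeasurability.

Section ProductMeasurability.
Context {R : realType} {X : ptopologicalType}.
Hypotheses (sepX : separable X) (metX : completely_metrizable R X).

(** By separability an open set is a countable union of products of balls centred in [S] with radii
    [1 / (k + 1)]. This makes a lower semicontinuous [d] measurable for the product of the Borel
    sigma-algebras. *)
Lemma open_prod_measurable (A : set (X * X)) : open A ->
  measurable (A : set (borel X * borel X)).
Proof.
move=> oA; have [S /countable_injP[f injf] denS] := sepX.
have [rho [rho0 rhoC rhoD nbhsE _]] := metX.
pose s n : X := xget point [set x | S x /\ f x = n].
have sS x : S x -> s (f x) = x.
  move=> Sx; rewrite /s; case: xgetP => [y -> [Sy fxy]|/(_ x)[]//].
  by apply: injf; rewrite ?inE.
pose B x (k : nat) := [set y | rho x y < k.+1%:R^-1].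
have oB x k : open (B x k).
  rewrite openE => y /= xy; rewrite /interior nbhsE.
  exists (k.+1%:R^-1 - rho x y); first by rewrite /= subr_gt0.
  move=> z /= yz; apply: (le_lt_trans (rhoD _ y _)).
  by rewrite addrC -ltrBrDr.
pose F (i : nat * nat * nat) : set (borel X * borel X) :=
  if `[< B (s i.1.1) i.2 `*` B (s i.1.2) i.2 `<=` A >]
  then B (s i.1.1) i.2 `*` B (s i.1.2) i.2 else set0.
have -> : A = \bigcup_i F i.
  apply/seteqP; split => [[x y] Axy|z [i _]]; last first.
    by rewrite /F; case: asboolP => // sub /sub.
  move: oA; rewrite openE => /(_ _ Axy)[[/= U V] []].
  rewrite !nbhsE => -[r /= r0 rU] [r' /= r'0 rV] UVA.
  (* Half of the smaller radius, because the ball around [s n] is reached from [x] in two steps. *)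
  pose e := Num.min r r' / 2.
  have e0 : 0 < e by rewrite divr_gt0// lt_min r0.
  have [k _ /(_ _ (leqnn k)) /= ke] := near_infty_natSinv_lt (PosNum e0).
  have k0 : 0 < k.+1%:R^-1 :> R by rewrite invr_gt0.
  have near_ z : exists2 n, B z k (s n) & B (s n) k z.
    have [|w [zw Sw]] := denS (B z k) _ (oB z k).
      by exists z; rewrite /B /= (rho0 z z).2.
    by exists (f w); rewrite sS// /B /= rhoC.
  have [n xn nx] := near_ x; have [l yl ly] := near_ y.
  exists (n, l, k) => //; rewrite /F /=; case: asboolP => //=.
  case => -[a b] /= [na lb]; apply: UVA; split => /=.
    apply: rU => /=; apply: (le_lt_trans (rhoD _ (s n) _)).
    apply: (lt_le_trans (ltrD xn na)).
    apply: (@le_trans _ _ (e + e)); first by rewrite lerD// ltW.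
    by rewrite /e -splitr ge_min lexx.
  apply: rV => /=; apply: (le_lt_trans (rhoD _ (s l) _)).
  apply: (lt_le_trans (ltrD yl lb)).
  apply: (@le_trans _ _ (e + e)); first by rewrite lerD// ltW.
  by rewrite /e -splitr ge_min lexx orbT.
apply: countable_bigcupT_measurable; first exact: countableP.
move=> i; rewrite /F; case: asboolP => // _.
by apply: measurableX; apply: measurable_borel.
Qed.

Lemma lower_semicontinuous_prod_measurable (d : X -> X -> \bar R) :
  lower_semicontinuous (fun z : X * X => d z.1 z.2) ->
  measurable_fun setT (fun z : borel X * borel X => d z.1 z.2).
Proof.
move=> /lower_semicontinuousP od.
apply: (measurability (@ErealGenOInfty.G R)); first exact: ErealGenOInfty.measurableE.
move=> _ [_ [r ->] <-]; rewrite setTI.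
rewrite (_ : _ @^-1` _ = [set z | r%:E < d z.1 z.2]%E); last first.
  by apply/seteqP; split => z /=; rewrite in_itv/= andbT.
exact: open_prod_measurable.
Qed.

(* The liminf along [1 / (n + 1)] is a jointly measurable version of the speed to
   the right ([sg = 1]) and to the left ([sg = -1]). *)
Definition speed (d : X -> X -> \bar R) (sg : R) (z : curve R X * R) : \bar R :=
  limn_einf (fun n => d (ev z.2 z.1) (ev (z.2 + sg * n.+1%:R^-1) z.1) * n.+1%:R%:E)%E.

Lemma speed_measurable (d : X -> X -> \bar R) (sg : R) :
  lower_semicontinuous (fun z : X * X => d z.1 z.2) ->
  measurable_fun setT (speed d sg : borel (curve R X) * R -> \bar R).
Proof.
move=> lsc; rewrite /speed /limn_einf.
apply: measurableT_comp; first exact: oppe_measurable.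
apply: (@measurable_fun_limn_esup _ _ _ _ (fun n (z : borel (curve R X) * R) =>
 (- (d (ev z.2 z.1) (ev (z.2 + sg * n.+1%:R^-1) z.1) * n.+1%:R%:E))%E)) => n.
apply: measurableT_comp; first exact: oppe_measurable.
apply: emeasurable_funM; last exact: measurable_cst.
have md := lower_semicontinuous_prod_measurable lsc.
have me := ev_pair_measurable metX.
apply: (@measurableT_comp _ _ _ _ _ _ (fun z : borel X * borel X => d z.1 z.2) _
  (fun z : borel (curve R X) * R =>
    (ev z.2 z.1, ev (z.2 + sg * n.+1%:R^-1) z.1) : borel X * borel X)) => //.
apply/measurable_fun_pairP; split; first exact: me.
apply: (@measurableT_comp _ _ _ _ _ _ (fun z : borel (curve R X) * R => ev z.2 z.1 : borel X) _
  (fun z : borel (curve R X) * R => (z.1, z.2 + sg * n.+1%:R^-1))) => //.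
apply/measurable_fun_pairP; split => /=; first exact: measurable_fst.
by apply: measurable_funD => //; exact: measurable_snd.
Qed.

Lemma speed_ge0 (d : X -> X -> \bar R) (sg : R) z :
  (forall x y, 0 <= d x y)%E -> (0 <= speed d sg z)%E.
Proof.
move=> d0; rewrite /speed limn_einf_lim; apply: lime_ge.
  exact: is_cvg_einfs.
by apply: nearW => n; apply: le_ereal_inf_tmp => _ [k _ <-]; rewrite mule_ge0.
Qed.

End ProductMeasurability.

(** * Absolutely continuous curves, slopes and speeds *)

Section ACCurves.
Context {R : realType} {X : ptopologicalType}.
Local Notation leb := (@lebesgue_measure R).
Variables (d : X -> X -> \bar R) (p : R).
Hypotheses (p1 : 1 <= p).
Implicit Types (g : curve R X).

Definition clampr (t : R) : R := Num.min 1 (Num.max 0 t).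

Lemma clampr_itv t : 0 <= clampr t <= 1.
Proof. by rewrite le_min ler01 le_max lexx ge_min lexx. Qed.

Lemma clampr_le s t : s <= t -> clampr s <= clampr t.
Proof.
move=> st; rewrite /clampr le_min ge_min lexx/= ge_min.
by rewrite ge_max !le_max lexx st !orbT.
Qed.

Lemma unit_itv_measurable : measurable (unit_itv R).
Proof. exact: measurable_itv. Qed.

(** The unit interval has finite measure and [G <= 1 + G^p] holds on it, so the extension by zero is
    integrable on the line, as [itv_int] and [travel] need. *)
Lemma powR_integrable_restrict (G : R -> R) : measurable_fun (unit_itv R) G ->
  (forall x, 0 <= G x) -> (\int[leb]_(x in unit_itv R) (G x `^ p)%:E < +oo)%E ->
  let a := G \_ (unit_itv R) in
  [/\ forall x, 0 <= a x, integrable_fun a &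
    (\int[leb]_(x in unit_itv R) (a x `^ p)%:E < +oo)%E].
Proof.
move=> mG G0 Gp a.
have mU := unit_itv_measurable.
have a0 x : 0 <= a x by rewrite /a patchE; case: ifP.
have ma : measurable_fun setT a by apply/(measurable_restrictT _ _).1.
have mGp : measurable_fun (unit_itv R) (fun x => 1 + G x `^ p).
  by apply: measurable_funD => //; exact: measurableT_comp (measurable_powR _) mG.
split; first exact: a0; last first.
  rewrite (_ : (\int[leb]_(x in _) _)%E =
    (\int[leb]_(x in unit_itv R) (G x `^ p)%:E)%E); first exact: Gp.
  by apply: eq_integral => x xU; rewrite /a patchE xU.
pose c := (fun x => 1 + G x `^ p) \_ (unit_itv R).
have mc : measurable_fun setT c by apply/(measurable_restrictT _ _).1.
have ac x : 0 <= a x <= c x.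
  rewrite a0/= /a /c !patchE; case: ifP => // _.
  have [G1|G1] := leP (G x) 1.
    by apply: (le_trans G1); rewrite lerDl powR_ge0.
  apply: (@le_trans _ _ (G x `^ p)); last by rewrite lerDr ler01.
  by rewrite -{1}(powRr1 (G0 x)) ler_powR// ltW.
apply: (integrable_fun_le ma ac).
apply/integrableP; split; first exact/measurable_EFinP.
rewrite (_ : (\int[leb]_x _)%E =
    (\int[leb]_(x in unit_itv R) (1 + (G x `^ p)%:E))%E); last first.
  rewrite [RHS]integral_mkcond; apply: eq_integral => x _.
  rewrite [LHS]/= /c !patchE; case: ifP => _; last by rewrite normr0.
  by rewrite ger0_norm ?EFinD// addr_ge0 ?powR_ge0.
rewrite ge0_integralD//; last 2 first.
- by move=> x _; rewrite lee_fin powR_ge0.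
- by apply/measurable_EFinP; exact: measurableT_comp (measurable_powR _) mG.
rewrite lte_add_pinfty// integral_cst//= mul1e lebesgue_measure_itv/=.
by case: ifP => _; rewrite -?EFinB ltry.
Qed.

(** A curve is constant before [0] and after [1], so clamping both times costs nothing and [G] may
    be extended by zero. A general [E] covers both directions of motion. *)
Lemma AC_bound_extend (E : R -> R -> \bar R) (G : R -> R) :
  measurable_fun (unit_itv R) G -> (forall x, 0 <= G x) ->
  integrable_fun (G \_ (unit_itv R)) ->
  (forall s t, E (clampr s) (clampr t) = E s t) ->
  (forall s t : R, (0 <= s)%R -> (s <= t)%R -> (t <= 1)%R ->
    (E s t <= \int[leb]_(x in `[s, t]) (G x)%:E)%E) ->
  forall s t, s <= t -> (E s t <= (itv_int (G \_ (unit_itv R)) s t)%:E)%E.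
Proof.
move=> mG G0 ia EC H s t st; rewrite -EC.
have /andP[s0 s1] := clampr_itv s; have /andP[t0 t1] := clampr_itv t.
apply: (le_trans (H _ _ s0 (clampr_le st) t1)).
have sub : `[clampr s, clampr t]%classic `<=` unit_itv R.
  move=> x; rewrite /unit_itv /= !in_itv/= => /andP[h1 h2].
  by rewrite (le_trans s0 h1) (le_trans h2 t1).
rewrite (_ : (\int[leb]_(x in _) _)%E =
  (\int[leb]_(x in `[clampr s, clampr t]) ((G \_ (unit_itv R)) x)%:E)%E); last first.
  by apply: eq_integral => x /set_mem /sub xU; rewrite patchE mem_set.
have mGe : measurable_fun setT (EFin \o (G \_ (unit_itv R))).
  exact: (measurable_int leb ia).
rewrite -integral_itv_obnd_cbnd; last exact: measurable_funTS.
rewrite itv_intE//; apply: ge0_subset_integral => //.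
- exact: measurable_funTS.
- by move=> x _; rewrite lee_fin patchE; case: ifP.
- move=> x /=; rewrite !in_itv/= => /andP[h1 h2].
  have x0 : 0 < x by exact: le_lt_trans s0 h1.
  have x1 : x <= 1 by exact: le_trans h2 t1.
  move: h1 h2; rewrite /clampr gt_min gt_max le_min le_max.
  rewrite (lt_geF x0) x1/= => h1 ->; rewrite andbT.
  by move: h1; rewrite ltNge x1/= => /andP[].
Qed.

Hypothesis dA : asymmetric_extended_metric d.

Lemma AC_modulus g : Defs.AC d p g -> exists a b : R -> R,
  [/\ (forall x, 0 <= a x) /\ (forall x, 0 <= b x),
      integrable_fun a /\ integrable_fun b,
      (\int[leb]_(x in unit_itv R) (a x `^ p)%:E < +oo)%E /\
      (\int[leb]_(x in unit_itv R) (b x `^ p)%:E < +oo)%E,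
      forall s t, s <= t -> (d (ev s g) (ev t g) <= (itv_int a s t)%:E)%E &
      forall s t, s <= t -> (d (ev t g) (ev s g) <= (itv_int b s t)%:E)%E].
Proof.
move=> [[G [mG G0 Gp HG]] [H [mH H0 Hp HH]]].
have [a0 ia ap] := powR_integrable_restrict mG G0 Gp.
have [b0 ib bp] := powR_integrable_restrict mH H0 Hp.
exists (G \_ (unit_itv R)), (H \_ (unit_itv R)); split => //.
- apply: (@AC_bound_extend (fun s t => d (ev s g) (ev t g))) => // s t.
  by rewrite !ev_clamp.
- apply: (@AC_bound_extend (fun s t => d (ev t g) (ev s g))) => // s t.
  by rewrite !ev_clamp.
Qed.

End ACCurves.

Lemma le_poweR {R : realType} (p : R) (x y : \bar R) : 0 <= p -> (0 <= x)%E ->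
  (x <= y)%E -> (x `^ p <= y `^ p)%E.
Proof.
move=> p0 x0 xy; apply: gt0_ler_poweR => //; rewrite in_itv/= leey andbT//.
exact: le_trans xy.
Qed.

Section LimInf.
Context {R : realType}.
Local Open Scope ereal_scope.
Implicit Types u : nat -> \bar R.

Lemma limn_einf_ge u c N : (forall n, (N <= n)%N -> c <= u n) -> c <= limn_einf u.
Proof.
move=> H; rewrite limn_einf_lim; apply: lime_ge; first exact: is_cvg_einfs.
exists N => // n /= Nn; apply: le_ereal_inf_tmp => _ [k /= nk <-].
by apply: H; exact: leq_trans nk.
Qed.

Lemma limn_einf_le u c N : (forall n, (N <= n)%N -> u n <= c) -> limn_einf u <= c.
Proof.
move=> H; rewrite limn_einf_lim; apply: lime_le; first exact: is_cvg_einfs.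
apply: nearW => n; apply: (@le_trans _ _ (u (maxn n N))); last first.
  by apply: H; exact: leq_maxr.
by apply: ereal_inf_lbound; exists (maxn n N) => //=; exact: leq_maxl.
Qed.

End LimInf.

Section Slope.
Context {R : realType} {X : choiceType}.
Variable d : X -> X -> \bar R.
Hypothesis dA : asymmetric_extended_metric d.
Implicit Types (f : X -> R) (x y : X).

Lemma ascending_slope_ge0 f x : (0 <= ascending_slope d f x)%E.
Proof. by rewrite /ascending_slope le_max lexx. Qed.

Lemma forward_Lipschitz_slope f x : forward_Lipschitz d f ->
  (ascending_slope d f x < +oo)%E.
Proof.
have [d0 deq dtri] := dA.
move=> [C C0 fC]; apply: (@le_lt_trans _ _ C%:E); last exact: ltry.
rewrite /ascending_slope ge_max lee_fin (ltW C0)/=.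
apply: ge_ereal_inf; exists (ereal_sup [set (Num.max 0 (f y - f x) / fine (d x y))%:E |
  y in fball d x 1 `\ x]).
  by exists (fball d x 1) => //; exists 1 => /=.
apply: ge_ereal_sup => _ [y [/= dxy yx] <-]; rewrite lee_fin.
have dfin : d x y \is a fin_num by rewrite ge0_fin_numE// (lt_trans dxy)// ltry.
have dpos : 0 < fine (d x y).
  rewrite lt_neqAle fine_ge0// andbT; apply/eqP => d00.
  by apply: yx; apply/esym/deq; rewrite -(fineK dfin) -d00.
rewrite ler_pdivrMr// ge_max mulr_ge0 ?(ltW C0) ?(ltW dpos)//=.
by have := fC x y; rewrite -(fineK dfin) -EFinM lee_fin.
Qed.

Lemma ascending_slope_lt f x (K : R) : (ascending_slope d f x < K%:E)%E ->
  exists2 r, 0 < r & forall y, (d x y < r%:E)%E ->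
    f y - f x <= K * fine (d x y).
Proof.
have [d0 deq dtri] := dA.
rewrite /ascending_slope gt_max lte_fin => /andP[K0].
move=> /ereal_inf_lt[_ [A [r /= r0 rA] <-] supK].
exists r => // y dxy; have [->|/eqP yx] := eqVneq y x.
  by rewrite subrr mulr_ge0 ?(ltW K0)// fine_ge0.
have dfin : d x y \is a fin_num by rewrite ge0_fin_numE// (lt_trans dxy)// ltry.
have dpos : 0 < fine (d x y).
  rewrite lt_neqAle fine_ge0// andbT; apply/eqP => d00.
  by apply: yx; apply/esym/deq; rewrite -(fineK dfin) -d00.
have : ((Num.max 0 (f y - f x) / fine (d x y))%:E < K%:E)%E.
  apply: le_lt_trans supK; apply: ereal_sup_ubound; exists y => //.
  by split => //; exact: rA.
rewrite lte_fin ltr_pdivrMr// => /ltW; apply: le_trans.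
by rewrite le_max lexx orbT.
Qed.

End Slope.

Section CurveSpeed.
Context {R : realType} {X : ptopologicalType}.
Local Notation leb := (@lebesgue_measure R).
Variables (d : X -> X -> \bar R) (p : R).
Hypotheses (p1 : 1 <= p) (dA : asymmetric_extended_metric d).
Implicit Types (g : curve R X) (a b : R -> R).

Let d0 x y : (0 <= d x y)%E. Proof. by case: dA. Qed.

Definition curve_dist g (s t : R) := fine (d (ev s g) (ev t g)).

Section FixedCurve.
Variables (g : curve R X) (a b : R -> R).
Hypotheses (ia : integrable_fun a) (ib : integrable_fun b)
  (a0 : forall x, 0 <= a x) (b0 : forall x, 0 <= b x)
  (Ha : forall s t, s <= t -> (d (ev s g) (ev t g) <= (itv_int a s t)%:E)%E)
  (Hb : forall s t, s <= t -> (d (ev t g) (ev s g) <= (itv_int b s t)%:E)%E).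

Lemma curve_distK s t : (curve_dist g s t)%:E = d (ev s g) (ev t g).
Proof.
rewrite /curve_dist fineK// ge0_fin_numE//.
have [st|/ltW ts] := leP s t; first by rewrite (le_lt_trans (Ha st))// ltry.
by rewrite (le_lt_trans (Hb ts))// ltry.
Qed.

Lemma curve_dist_ge0 s t : 0 <= curve_dist g s t.
Proof. exact: fine_ge0. Qed.

Lemma curve_dist_triangle s t r :
  curve_dist g s r <= curve_dist g s t + curve_dist g t r.
Proof. by rewrite -lee_fin EFinD !curve_distK; case: dA. Qed.

Lemma curve_dist_fwd s t : s <= t -> curve_dist g s t <= itv_int a s t.
Proof. by move=> st; rewrite -lee_fin curve_distK Ha. Qed.

Lemma curve_dist_bwd s t : s <= t -> curve_dist g t s <= itv_int b s t.
Proof. by move=> st; rewrite -lee_fin curve_distK Hb. Qed.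

(** [metric_derivative] provides a true limit at almost every time, with which the lower limit
    [speed] then agrees. *)
Lemma forward_speed_ae : exists m, [/\ forall x, 0 <= m x <= a x,
  integrable_fun m &
  {ae leb, forall x,
    (d (ev x g) (ev (x + h) g) * (h^-1)%:E)%E @[h --> 0%R^'+] --> (m x)%:E /\
    speed d 1 (g, x) = (m x)%:E}].
Proof.
have [m [ma im _ aem]] := metric_derivative ia ib a0 b0 curve_dist_ge0
  curve_dist_triangle curve_dist_fwd curve_dist_bwd.
exists m; split => //; apply: (ae_imp aem) => x Hx.
have bound e : 0 < e -> exists2 del, 0 < del & forall h, 0 < h < del ->
    `|m x - curve_dist g x (x + h) / h| <= e.
  move=> e0; have [del del0 H] := Hx _ e0; exists del => // h /andP[h0 hd].
  have := H h; rewrite h0 hd => /(_ isT) {}H.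
  have -> : m x - curve_dist g x (x + h) / h = - ((curve_dist g x (x + h) - m x * h) / h).
    by rewrite mulrBl mulfK ?gt_eqF// opprB.
  by rewrite normrN normrM normfV (gtr0_norm h0) ler_pdivrMr.
split.
- have -> : (fun h : R => (d (ev x g) (ev (x + h) g) * (h^-1)%:E)%E) =
      EFin \o (fun h => curve_dist g x (x + h) / h).
    by apply/funext => h; rewrite /= -curve_distK EFinM.
  apply/cvg_EFin; first exact: nearW.
  apply/cvgrPdist_le => e e0; have [del del0 H] := bound _ e0.
  near=> h; apply: H; apply/andP; split.
    by near: h; exact: nbhs_right_gt.
  by near: h; exact: nbhs_right_lt.
- have near_n e : 0 < e -> exists N, forall n, (N <= n)%N ->
      `|m x - curve_dist g x (x + 1 * n.+1%:R^-1) * n.+1%:R| <= e.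
    move=> e0; have [del del0 H] := bound _ e0.
    have [N _ HN] := near_infty_natSinv_lt (PosNum del0).
    exists N => n Nn; have := H (n.+1%:R^-1); rewrite invr_gt0 ltr0n /=.
    by rewrite invrK mul1r; apply; exact: HN.
  apply/eqP; rewrite eq_le; apply/andP; split; apply/lee_addgt0Pr => e e0;
    have [N HN] := near_n e e0.
    apply: (limn_einf_le (N := N)) => n /HN.
    rewrite /= -curve_distK -EFinM -EFinD lee_fin ler_norml => /andP[h1 _].
    by lra.
  rewrite -leeBlDr//; apply: (limn_einf_ge (N := N)) => n /HN.
  rewrite /= -curve_distK -EFinM -EFinB lee_fin ler_norml => /andP[_ h1].
  by lra.
Unshelve. all: by end_near. Qed.

(** Motion to the left enters only as a weight, for which an upper bound is enough: differentiate
    the primitive of [b]. *)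
Lemma backward_speed_ae : {ae leb, forall x, (speed d (-1) (g, x) <= (b x)%:E)%E}.
Proof.
have aeb := itv_int_deriv ib (fun s t => @primitiveB _ b s t ib).
apply: (ae_imp aeb) => x Hx; apply/lee_addgt0Pr => e e0.
have [del del0 H] := Hx _ e0.
have [N _ HN] := near_infty_natSinv_lt (PosNum del0).
apply: (limn_einf_le (N := N)) => n Nn /=.
have n0 : 0 < n.+1%:R^-1 :> R by rewrite invr_gt0.
have le1 : x - n.+1%:R^-1 <= x by rewrite gerBl ltW.
have := H (- n.+1%:R^-1); rewrite normrN gtr0_norm// => /(_ (HN _ Nn)).
rewrite -[X in `|X|]opprK normrN opprB => {}H.
rewrite -curve_distK -EFinM -EFinD lee_fin mulN1r.
rewrite -ler_pdivlMr//.
apply: (le_trans (curve_dist_bwd le1)).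
rewrite -primitiveB// mulrDl.
have aux (P Q B h k : R) : B * - h - (Q - P) <= k -> P - Q <= B * h + k.
  by move=> ?; lra.
by apply: aux; move: H; rewrite ler_norml => /andP[].
Qed.

(** For [K] slightly above the slope and [h = sg / (n + 1)], the increment of [f] over [h] is at
    most [K] times the distance travelled. Dividing by [K > 0] bounds the quotients whose lower
    limit is the speed from below. *)
Lemma le_slope_speed (f : X -> R) (w : R) (sg x : R) : forward_Lipschitz d f ->
  `|sg| = 1 -> has_deriv (fun t => f (ev t g)) x w ->
  (speed d sg (g, x) < +oo)%E ->
  ((sg * w)%:E <= ascending_slope d f (ev x g) * speed d sg (g, x))%E.
Proof.
move=> fL sg1 dw spy.
have sp0 : (0 <= speed d sg (g, x))%E by exact: speed_ge0.
have sl0 := ascending_slope_ge0 d f (ev x g).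
have sly := forward_Lipschitz_slope dA (ev x g) fL.
set sl := ascending_slope _ _ _ in sl0 sly *; set l := speed _ _ _ in sp0 spy *.
have slK : sl = (fine sl)%:E by rewrite fineK// ge0_fin_numE.
have lK : l = (fine l)%:E by rewrite fineK// ge0_fin_numE.
have l0 : 0 <= fine l by exact: fine_ge0.
rewrite slK lK -EFinM lee_fin.
have main e : 0 < e -> sg * w <= (fine sl + e) * fine l + e.
  move=> e0; have K0 : 0 < fine sl + e by rewrite ltr_wpDl// fine_ge0.
  have [|r r0 Hr] := @ascending_slope_lt _ _ _ dA f (ev x g) (fine sl + e).
    by rewrite -/sl slK lte_fin ltrDl.
  have [d1 d10 H1] := itv_int_small ia r0.
  have [d2 d20 H2] := itv_int_small ib r0.
  have [d3 d30 H3] := dw _ e0.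
  have dd : 0 < Num.min d1 (Num.min d2 d3) by rewrite !lt_min d10 d20 d30.
  have [N _ HN] := near_infty_natSinv_lt (PosNum dd).
  suff : (((sg * w - e) / (fine sl + e))%:E <= l)%E.
    by rewrite lK lee_fin ler_pdivrMr// mulrC; lra.
  apply: (limn_einf_ge (N := N)) => n Nn /=.
  have n0 : 0 < n.+1%:R^-1 :> R by rewrite invr_gt0.
  have := HN _ Nn; rewrite /= !lt_min => /and3P[n1 n2 n3].
  set h := sg * n.+1%:R^-1.
  have hn : `|h| = n.+1%:R^-1 by rewrite /h normrM sg1 mul1r gtr0_norm.
  have dr : (d (ev x g) (ev (x + h) g) < r%:E)%E.
    have [h0|h0] := leP 0 h.
      have xh : x <= x + h by rewrite lerDl.
      apply: (le_lt_trans (Ha xh)); rewrite lte_fin.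
      apply: (le_lt_trans (ler_norm _)); apply: H1 => //.
      by rewrite addrAC subrr add0r -(ger0_norm h0) hn.
    have xh : x + h <= x by rewrite gerDl ltW.
    apply: (le_lt_trans (Hb xh)); rewrite lte_fin.
    apply: (le_lt_trans (ler_norm _)); apply: H2 => //.
    by rewrite opprD addrA subrr add0r -(ltr0_norm h0) hn.
  have := Hr _ dr; have := H3 h; rewrite hn => /(_ n3).
  rewrite -/(curve_dist g x (x + h)) => A B.
  rewrite -curve_distK -EFinM lee_fin ler_pdivrMr//.
  have aux (N' K D f1 f0 h' : R) : 0 < N' -> h' = sg * N'^-1 ->
      - (e * N'^-1) <= f1 - f0 - w * h' -> f1 - f0 <= K * D ->
      sg * w - e <= D * N' * K.
    move=> N0 -> h1 h2.
    have -> : sg * w - e = (w * (sg * N'^-1) - e * N'^-1) * N'.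
      by field; rewrite gt_eqF.
    have -> : D * N' * K = (K * D) * N' by ring.
    by rewrite ler_pM2r//; lra.
  by apply: aux B => //; move: A; rewrite ler_norml => /andP[].
(* The error terms of [main] amount to its [e] times [l + 1], hence the division by [l + 1]. *)
apply/ler_addgt0Pr => e e0.
have l1 : 0 < fine l + 1 by rewrite ltr_wpDl.
have := main (e / (fine l + 1)) (divr_gt0 e0 l1); move=> /le_trans; apply.
rewrite mulrDl -addrA lerD2l -[X in _ + X]mulr1 -mulrDr.
by rewrite divfK ?gt_eqF.
Qed.

End FixedCurve.

Lemma itv_intZl (k : R) a s t : integrable_fun a ->
  itv_int (fun x => k * a x) s t = k * itv_int a s t.
Proof. by move=> ia; rewrite /itv_int RintegralZl//; exact: integrable_funS. Qed.

Lemma integrable_funZl (k : R) a : integrable_fun a -> integrable_fun (fun x => k * a x).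
Proof.
move=> ia; rewrite /integrable_fun (_ : _ \o _ = fun x => (k%:E * (EFin \o a) x)%E).
  exact: integrableZl.
by apply/funext => x /=; rewrite EFinM.
Qed.

Lemma AC_speed_Lp g : Defs.AC d p g ->
  [/\ (\int[leb]_(x in unit_itv R) (speed d 1 (g, x) `^ p) < +oo)%E,
      (\int[leb]_(x in unit_itv R) (speed d (-1) (g, x) `^ p) < +oo)%E &
      {ae leb, forall x, (d (ev x g) (ev (x + h) g) * (h^-1)%:E)%E @[h --> 0%R^'+] -->
        speed d 1 (g, x)}].
Proof.
move=> /(AC_modulus p1)[a [b [[a0 b0] [ia ib] [ap bp] Ha Hb]]].
have p0 : 0 < p by exact: lt_le_trans p1.
have [m [ma im aem]] := forward_speed_ae ia ib a0 b0 Ha Hb.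
have aeb := backward_speed_ae ib Ha Hb.
have le_int (c : R -> R) sg : (forall x, 0 <= c x) ->
    {ae leb, forall x, (speed d sg (g, x) <= (c x)%:E)%E} ->
    (\int[leb]_(x in unit_itv R) (c x `^ p)%:E < +oo)%E ->
    (\int[leb]_(x in unit_itv R) (speed d sg (g, x) `^ p) < +oo)%E.
  move=> c0 aec; apply: le_lt_trans; apply: ae_le_integral_raw.
  - exact: unit_itv_measurable.
  - by move=> x _; exact: poweR_ge0.
  - by move=> x _; rewrite lee_fin powR_ge0.
  - apply: (ae_imp aec) => x cx _; rewrite -poweR_EFin.
    by apply: le_poweR => //; [exact: ltW|exact: speed_ge0].
split.
- apply: le_int a0 _ ap; apply: (ae_imp aem) => x [_ ->].
  by rewrite lee_fin; have /andP[] := ma x.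
- exact: le_int b0 aeb bp.
- by apply: (ae_imp aem) => x [+ ->].
Qed.

Lemma AC_slope_speed g (f : X -> R) : Defs.AC d p g -> forward_Lipschitz d f ->
  forall s t, s <= t ->
  ((f (ev t g) - f (ev s g))%:E <= \int[leb]_(x in `[s, t])
     (ascending_slope d f (ev x g) * speed d 1 (g, x)))%E /\
  ((f (ev s g) - f (ev t g))%:E <= \int[leb]_(x in `[s, t])
     (ascending_slope d f (ev x g) * speed d (-1) (g, x)))%E.
Proof.
move=> /(AC_modulus p1)[a [b [[a0 b0] [ia ib] _ Ha Hb]]] fL s t st.
have [m [ma im aem]] := forward_speed_ae ia ib a0 b0 Ha Hb.
have aeb := backward_speed_ae ib Ha Hb.
have [C C0 fC] := fL.
have fC' x y : f (ev y g) - f (ev x g) <= C * curve_dist g x y.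
  by rewrite -lee_fin EFinM (curve_distK Ha Hb).
have [||||||w [iw wE dw]] := @has_deriv_of_itv_int _ (fun x => C * a x) (fun x => C * b x)
    (fun t => f (ev t g)).
- exact: integrable_funZl.
- exact: integrable_funZl.
- by move=> x; rewrite mulr_ge0// ltW.
- by move=> x; rewrite mulr_ge0// ltW.
- move=> x y xy; rewrite itv_intZl//; apply: (le_trans (fC' _ _)).
  by rewrite ler_pM2l// (curve_dist_fwd Ha Hb).
- move=> x y xy; rewrite itv_intZl//; apply: (le_trans (fC' _ _)).
  by rewrite ler_pM2l// (curve_dist_bwd Ha Hb).
have key sg : `|sg| = 1 -> {ae leb, forall x, (speed d sg (g, x) < +oo)%E} ->
    ((sg * (f (ev t g) - f (ev s g)))%:E <= \int[leb]_(x in `[s, t])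
     (ascending_slope d f (ev x g) * speed d sg (g, x)))%E.
  move=> sg1 spy.
  (* The positive part of the density is taken because the comparison without measurability, needed
     for the slope along the curve, is between nonnegative functions. *)
  apply: (@le_trans _ _ (\int[leb]_(x in `[s, t]) (Num.max 0 (sg * w x))%:E)%E).
    have mmax : measurable_fun setT (fun x => Num.max 0 (sg * w x)).
      apply: measurable_maxr => //; apply: measurable_funM => //.
      exact: integrable_fun_measurable.
    rewrite wE// -itv_intZl// itv_intE; last exact: integrable_funZl.
    rewrite -integral_itv_obnd_cbnd; last first.
      by apply: measurable_funTS; exact/measurable_EFinP.
    apply: le_integral => //.
    + by apply: integrable_funS => //; exact: integrable_funZl.
    + apply: integrable_funS => //.
      apply: (integrable_fun_le (b := fun x => `|w x|)) => //.
        move=> x; rewrite le_max lexx /= ge_max normr_ge0 /=.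
        by rewrite (le_trans (ler_norm _))// normrM sg1 mul1r.
      have := integrable_abse iw; rewrite /integrable_fun; congr (_.-integrable _ _).
    + by move=> x _; rewrite lee_fin le_max lexx orbT.
  apply: ae_le_integral_raw => //.
  - by move=> x _; rewrite lee_fin le_max lexx.
  - by move=> x _; rewrite mule_ge0 ?ascending_slope_ge0 ?speed_ge0.
  - apply: (ae_imp2 dw spy) => x dwx spx _.
    have := le_slope_speed ia ib Ha Hb fL sg1 dwx spx.
    rewrite EFin_max ge_max => ->; rewrite andbT.
    by rewrite mule_ge0 ?ascending_slope_ge0 ?speed_ge0.
split.
- rewrite -[X in X%:E]mul1r; apply: key; first by rewrite normr1.
  by apply: (ae_imp aem) => x [_ ->]; rewrite ltry.
- rewrite -opprB -[X in X%:E]mulN1r; apply: key; first by rewrite normrN1.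
  by apply: (ae_imp aeb) => x /le_lt_trans; apply; rewrite ltry.
Qed.

End CurveSpeed.

(** * Test plans *)

Section ImageDensity.
Context d1 d2 (T1 : measurableType d1) (T2 : measurableType d2) (R : realType).
Variables (mu : {measure set T1 -> \bar R}) (W : T1 -> \bar R) (e : T1 -> T2).
Hypotheses (mW : measurable_fun setT W) (W0 : forall x, (0 <= W x)%E)
  (me : measurable_fun setT e).

(** The push-forward under [e] of the measure with density [W]: an occupation measure when [e] is
    the evaluation and [W] the speed. *)
Definition image_density of measurable_fun setT W & (forall x, (0 <= W x)%E)
    & measurable_fun setT e :=
  fun B : set T2 => (\int[mu]_(x in e @^-1` B) W x)%E.

Local Notation nu := (image_density mW W0 me).

Let nu0 : nu set0 = 0%E.
Proof. by rewrite /image_density preimage_set0 integral_set0. Qed.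

Let nu_ge0 A : (0 <= nu A)%E. Proof. by apply: integral_ge0 => x _; exact: W0. Qed.

Let nu_sigma : semi_sigma_additive nu.
Proof.
move=> F mF tF mUF; rewrite /image_density preimage_bigcup.
apply: (@measure_semi_sigma_additive _ _ _ (density_measure mu mW W0)).
- by move=> n; rewrite -[X in measurable X]setTI; exact: me.
- apply/trivIsetP => /= i j _ _ ij; rewrite -preimage_setI.
  by move/trivIsetP : tF => /(_ _ _ _ _ ij) ->//; rewrite preimage_set0.
- by rewrite -preimage_bigcup -[X in measurable X]setTI; exact: me.
Qed.

HB.instance Definition _ := isMeasure.Build _ _ _ nu nu0 nu_ge0 nu_sigma.

End ImageDensity.

Section Occupation.
Context d1 d2 (Z : measurableType d1) (Y : measurableType d2) (R : realType).
Variables (P : {measure set Z -> \bar R}) (m : {sigma_finite_measure set Y -> \bar R}).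
Variables (W : Z -> \bar R) (e : Z -> Y) (p q C : R).
Hypotheses (mW : measurable_fun setT W) (W0 : forall z, (0 <= W z)%E)
  (me : measurable_fun setT e) (p1 : 1 < p) (q1 : 1 < q)
  (pq : p^-1 + q^-1 = 1) (C0 : 0 < C).
Local Open Scope ereal_scope.
Hypotheses (Wfin : \int[P]_z W z < +oo) (Wp : \int[P]_z (W z `^ p) < +oo)
  (Wm : forall B, measurable B ->
    \int[P]_z ((\1_B (e z))%:E * (\1_[set z | (0 < W z)%E] z)%:E) <= C%:E * m B).

Let mW0 : measurable [set z | 0 < W z].
Proof.
rewrite (_ : [set z | _] = W @^-1` `]0, +oo[%classic); last first.
  by apply/seteqP; split => z /=; rewrite in_itv/= andbT.
by rewrite -[X in measurable X]setTI; apply: mW => //; exact: emeasurable_itv.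
Qed.

Let p0 : (0 < p)%R. Proof. exact: lt_trans p1. Qed.
Let q0 : (0 < q)%R. Proof. exact: lt_trans q1. Qed.

(** Young's inequality for [l * x] and [y / l]. The term in [x] carries the indicator of [y > 0],
    since [Wm] controls the occupation measure only where [W > 0]. *)
Let young (x : R) (y : \bar R) (l : R) : (0 < l)%R -> (0 <= x)%R -> 0 <= y ->
  x%:E * y <= ((l `^ q * x `^ q)%:E * (\1_[set z : \bar R | (0 < z)%E] y)%:E) +
              (l `^ (- p))%:E * y `^ p.
Proof.
move=> l0 x0; case: y => [y| |//] y0; last first.
  rewrite poweRyr ?gt_eqF// [X in _ + X]gt0_muley ?lte_fin ?powR_gt0//.
  by rewrite addey ?leey// -ltNye (@lt_le_trans _ _ 0).
rewrite lee_fin in y0; rewrite indicE.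
have [y00|ypos] := eqVneq y 0%R.
  rewrite y00 mule0 adde_ge0//.
    by rewrite mule_ge0 ?lee_fin// mulr_ge0 ?powR_ge0.
  by rewrite mule_ge0 ?lee_fin ?powR_ge0.
have {}ypos : (0 < y)%R by rewrite lt_neqAle eq_sym ypos.
rewrite poweR_EFin mem_set; last by rewrite /= lte_fin.
rewrite mule1 -!EFinM -EFinD lee_fin.
have lx : (0 <= l * x)%R by rewrite mulr_ge0// ltW.
have yl : (0 <= y / l)%R by rewrite divr_ge0// ltW.
have -> : (x * y = (l * x) * (y / l))%R by field; rewrite gt_eqF.
apply: (le_trans (conjugate_powR lx yl q0 p0 _)); first by rewrite addrC.
rewrite -powRM ?(ltW l0)//.
have -> : (l `^ (- p) * y `^ p = (y / l) `^ p)%R.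
  by rewrite powRM ?invr_ge0 ?(ltW l0)// -powR_inv1 ?(ltW l0)// -powRrM mulN1r mulrC.
by apply: lerD; rewrite ler_pdivrMr// ler_peMr ?powR_ge0// ltW.
Qed.

(** By [Wm] a null set of [m] is not visited where [W > 0], so Radon-Nikodym gives [h]. Its L^p norm
    is estimated by duality with L^q: the pairing of [phi] with [h] is an integral of [phi * W] over
    [P], where [Wm] controls [phi^q] and [Wp] controls [W^p]. *)
Lemma occupation_density : exists h : Y -> R,
  [/\ measurable_fun setT h, forall y, (0 <= h y)%R,
      \int[m]_y ((h y `^ p)%:E) < +oo &
      forall phi : Y -> \bar R, measurable_fun setT phi -> (forall y, 0 <= phi y) ->
        \int[P]_z (phi (e z) * W z) = \int[m]_y (phi y * (h y)%:E)].
Proof.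
pose nu := image_density P mW W0 me.
have nuE B : measurable B -> nu B = \int[P]_z ((\1_B (e z))%:E * W z).
  move=> mB; rewrite /nu/= /image_density integral_mkcond; apply: eq_integral => z _.
  rewrite patchE indicE; case: ifPn => /= [zB|zB].
    by rewrite mem_set ?mul1e//; move: zB; rewrite inE.
  by rewrite memNset ?mul0e//; move: zB; rewrite notin_setE.
have fin1 : fin_num_fun nu.
  apply: lty_fin_num_fun; rewrite /nu/= /image_density preimage_setT.
  exact: Wfin.
pose fnu : {finite_measure set Y -> \bar R} :=
  HB.pack nu (Measure_isFinite.Build _ _ _ nu fin1).
have ac : fnu `<< m.
  apply/null_content_dominatesP => B mB B0; rewrite -[LHS]/(nu B) nuE//.
  have := Wm mB; rewrite B0 mule0 => W00.
  have mi : measurable_fun setT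
      (fun z => (\1_B (e z))%:E * (\1_[set z | (0 < W z)%E] z)%:E : \bar R).
    apply: emeasurable_funM; apply/measurable_EFinP.
      exact: (measurableT_comp (measurable_indic mB) me).
    exact: measurable_indic.
  have : \int[P]_z `|(\1_B (e z))%:E * (\1_[set z | (0 < W z)%E] z)%:E| = 0.
    apply/eqP; rewrite eq_le integral_ge0 ?andbT//.
    by under eq_integral => z _ do rewrite gee0_abs ?mule_ge0 ?lee_fin//.
  move/(ae_eq_integral_abs P measurableT mi) => ae0.
  rewrite -(integral0 P setT).
  apply: ae_eq_integral_raw => //.
    by move=> z _; rewrite mule_ge0// lee_fin.
  apply: (ae_imp ae0) => z /= /(_ Logic.I) H _.
  have [Wz|Wz] := ltP 0 (W z); last first.
    have -> : W z = 0 by apply/eqP; rewrite eq_le Wz W0.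
    by rewrite mule0.
  move: H; rewrite [X in _ * X%:E = _]indicE mem_set// mule1 => ->.
  by rewrite mul0e.
have [h' [h0 hfin ih hE]] := radon_nikodym_sigma_finite ac.
pose h := fine \o h'.
have hE' y : (h y)%:E = h' y by rewrite /h/= fineK.
have mh' : measurable_fun setT h' by exact: (measurable_int m).
have mh : measurable_fun setT h by exact: measurableT_comp.
have h_ge0 y : (0 <= h y)%R by exact: fine_ge0.
have base B : measurable B ->
    \int[P]_z ((\1_B (e z))%:E * W z) = \int[m]_y ((\1_B y)%:E * (h y)%:E).
  move=> mB; rewrite -nuE// -[LHS]/(fnu B) hE// integral_mkcond.
  apply: eq_integral => y _; rewrite patchE indicE hE'; case: ifP => _ /=.
    by rewrite mul1e.
  by rewrite mul0e.
have mhE : measurable_fun setT (EFin \o h) by exact/measurable_EFinP.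
have h0E y : 0 <= (EFin \o h) y by rewrite /= lee_fin.
have change (phi : Y -> \bar R) : measurable_fun setT phi -> (forall y, 0 <= phi y) ->
    \int[P]_z (phi (e z) * W z) = \int[m]_y (phi y * (h y)%:E).
  move=> mphi phi0; apply/eqP; rewrite eq_le; apply/andP; split.
    apply: (@le_integral_comp _ _ _ _ _ _ _ P m setT setT W (EFin \o h) e id) => //.
    by move=> B mB; rewrite base.
  apply: (@le_integral_comp _ _ _ _ _ _ _ m P setT setT (EFin \o h) W id e) => //.
  by move=> B mB; rewrite base.
have occ (phi : Y -> \bar R) : measurable_fun setT phi -> (forall y, 0 <= phi y) ->
    \int[P]_z (phi (e z) * (\1_[set z | (0 < W z)%E] z)%:E) <=
    \int[m]_y (phi y * C%:E).
  move=> mphi phi0.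
  apply: (@le_integral_comp _ _ _ _ _ _ _ P m setT setT
    (fun z => (\1_[set z | (0 < W z)%E] z)%:E) (cst C%:E) e id) => //.
  - by apply/measurable_EFinP; exact: measurable_indic.
  - by move=> y; rewrite lee_fin ltW.
  - move=> B mB; apply: (le_trans (Wm mB)).
    rewrite ge0_integralZr//; last 2 first.
    + by apply/measurable_EFinP; exact: measurable_indic.
    + by rewrite lee_fin ltW.
    by rewrite integral_indic// setIT muleC.
have /sigma_finiteP[A [AT ndA Afin]] := sigma_finiteT m.
exists h; split => //.
(* With [phi] close to [h ^ (p - 1)], the integral of [phi * h] is that of [phi * W]
   along curves; Young's inequality bounds it by half of the integral of [h ^ p]
   plus a multiple of that of [W ^ p]. *)
pose l := ((2 * C) `^ (- q^-1))%R.
have l0 : (0 < l)%R by rewrite powR_gt0// mulr_gt0.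
have lq : (l `^ q * C = 2^-1)%R.
  rewrite /l -powRrM mulNr mulVf ?gt_eqF// powR_inv1 ?mulr_ge0 ?(ltW C0)//.
  by field; rewrite gt_eqF.
(* Truncating in height and to sets of finite measure makes the integral finite in advance, so that
   half of it can be absorbed into the left-hand side. *)
pose psi n y := (Num.min (h y) n%:R `^ p * \1_(A n) y)%R.
have mn n : measurable_fun setT (fun y => Num.min (h y) n%:R)%R by exact: measurable_minr.
have min0 n y : (0 <= Num.min (h y) n%:R)%R by rewrite le_min h_ge0 ler0n.
have mpsi n : measurable_fun setT (psi n).
  apply: measurable_funM; first exact: (measurableT_comp (measurable_powR _)).
  by apply: measurable_indic; case: (Afin n).
have psi0 n y : (0 <= psi n y)%R by rewrite mulr_ge0 ?powR_ge0.
pose phi n y := (Num.min (h y) n%:R `^ (p - 1) * \1_(A n) y)%R.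
have mphi n : measurable_fun setT (phi n).
  apply: measurable_funM; first exact: (measurableT_comp (measurable_powR _)).
  by apply: measurable_indic; case: (Afin n).
have phi0 n y : (0 <= phi n y)%R by rewrite mulr_ge0 ?powR_ge0.
have pq' : ((p - 1) * q = p)%R.
  have : (p * q * (p^-1 + q^-1) = p * q)%R by rewrite pq mulr1.
  by rewrite mulrDr mulrAC mulfV ?gt_eqF// mul1r mulfK ?gt_eqF// => ?; lra.
have phiq n y : (phi n y `^ q = psi n y)%R.
  rewrite /phi /psi indicE; case: (_ \in _) => /=.
    by rewrite !mulr1 -powRrM pq'.
  by rewrite !mulr0 powR0 ?gt_eqF.
have psile n y : (psi n y <= phi n y * h y)%R.
  rewrite /phi /psi mulrAC ler_wpM2r// mulrC.
  rewrite -mulr_powRB1//; apply: ler_wpM2r; first exact: powR_ge0.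
  by rewrite ge_min lexx.
pose E := \int[P]_z (W z `^ p).
have E0 : 0 <= E by apply: integral_ge0 => z _; exact: poweR_ge0.
have bound n : \int[m]_y (psi n y)%:E <= 2%:E * ((l `^ (- p))%:E * E).
  have psifin : \int[m]_y (psi n y)%:E < +oo.
    apply: (@le_lt_trans _ _ (\int[m]_y ((n%:R `^ p)%:E * (\1_(A n) y)%:E))).
      apply: ge0_le_integral => //.
      + by move=> y _; rewrite lee_fin.
      + exact/measurable_EFinP.
      + apply/measurable_EFinP; apply: measurable_funM => //.
        by apply: measurable_indic; case: (Afin n).
      + move=> y _; rewrite lee_fin ler_wpM2r// ge0_ler_powR ?nnegrE ?(ltW p0)//.
        by rewrite ge_min lexx orbT.
    rewrite ge0_integralZl//; last first.
      by apply/measurable_EFinP/measurable_indic; case: (Afin n).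
    rewrite integral_indic ?setIT//; last by case: (Afin n).
    by rewrite lte_mul_pinfty ?lee_fin ?powR_ge0//; case: (Afin n).
  have step : \int[m]_y (psi n y)%:E <=
      (2^-1)%:E * \int[m]_y (psi n y)%:E + (l `^ (- p))%:E * E.
    apply: (@le_trans _ _ (\int[m]_y ((phi n y)%:E * (h y)%:E))).
      apply: ge0_le_integral => //.
      + by move=> y _; rewrite lee_fin.
      + exact/measurable_EFinP.
      + by apply/measurable_EFinP; exact: measurable_funM.
      + by move=> y _; rewrite lee_fin.
    rewrite -(change (EFin \o phi n))//; last 2 first.
      exact/measurable_EFinP.
      by move=> y; rewrite /= lee_fin.
    have mWp : measurable_fun setT (fun z => W z `^ p).
      exact: (measurableT_comp (measurable_poweR _)).
    have mphie : measurable_fun setT (fun z => (phi n (e z))%:E).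
      by apply/measurable_EFinP; exact: (measurableT_comp (mphi n) me).
    have mpsie : measurable_fun setT (fun z => (psi n (e z))%:E).
      by apply/measurable_EFinP; exact: (measurableT_comp (mpsi n) me).
    have mind : measurable_fun setT (fun z => (\1_[set z | (0 < W z)%E] z)%:E : \bar R).
      by apply/measurable_EFinP; exact: measurable_indic.
    apply: (@le_trans _ _ (\int[P]_z ((l `^ q)%:E * ((psi n (e z))%:E *
      (\1_[set z | (0 < W z)%E] z)%:E) + (l `^ (- p))%:E * W z `^ p))).
      apply: ge0_le_integral => //.
      + by move=> z _; rewrite mule_ge0// lee_fin.
      + exact: emeasurable_funM.
      + apply: emeasurable_funD; apply: measurable_funeM => //.
        exact: emeasurable_funM.
      + move=> z _; apply: (le_trans (young l0 (phi0 n (e z)) (W0 z))).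
        by rewrite phiq muleA -EFinM !indicE.
    rewrite ge0_integralD//; last 4 first.
    + by move=> z _; rewrite !mule_ge0 ?lee_fin ?powR_ge0.
    + by apply: measurable_funeM; exact: emeasurable_funM.
    + by move=> z _; rewrite mule_ge0 ?poweR_ge0// lee_fin powR_ge0.
    + exact: measurable_funeM.
    apply: leeD.
      rewrite ge0_integralZl//; last 3 first.
      + exact: emeasurable_funM.
      + by move=> z _; rewrite mule_ge0 ?lee_fin.
      + by rewrite lee_fin powR_ge0.
      apply: (@le_trans _ _ ((l `^ q)%:E * \int[m]_y ((psi n y)%:E * C%:E))).
        apply: lee_wpmul2l; first by rewrite lee_fin powR_ge0.
        apply: (occ (EFin \o psi n)); first exact/measurable_EFinP.
        by move=> y; rewrite /= lee_fin.
      rewrite ge0_integralZr//; last 3 first.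
      + exact/measurable_EFinP.
      + by move=> y _; rewrite lee_fin.
      + by rewrite lee_fin ltW.
      by rewrite [X in _ * X]muleC muleA -EFinM lq.
    rewrite ge0_integralZl//; last by rewrite lee_fin powR_ge0.
    by move=> z _; exact: poweR_ge0.
  have If : \int[m]_y (psi n y)%:E \is a fin_num.
    by rewrite ge0_fin_numE// integral_ge0// => y _; rewrite lee_fin.
  have Ef : E \is a fin_num by rewrite ge0_fin_numE.
  move: step; rewrite -(fineK If) -(fineK Ef) -!EFinM -EFinD !lee_fin.
  by lra.
(* At each point [psi n] is eventually [h^p], so Fatou carries the uniform bound over to [h^p]. *)
apply: (@le_lt_trans _ _ (\int[m]_y limn_einf (fun n => (psi n y)%:E))).
  apply: ge0_le_integral => //.
  - by move=> y _; rewrite lee_fin powR_ge0.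
  - by apply/measurable_EFinP; exact: (measurableT_comp (measurable_powR _)).
  - rewrite /limn_einf; apply: measurableT_comp; first exact: oppe_measurable.
    apply: (@measurable_fun_limn_esup _ _ _ _ (fun n y => - (psi n y)%:E)) => n.
    by apply: measurableT_comp => //; exact/measurable_EFinP.
  - move=> y _; have : [set: Y] y by []. rewrite AT => -[N _ ANy].
    apply: (@limn_einf_ge _ _ _ (maxn N (Num.bound (h y)))) => n.
    rewrite geq_max => /andP[Nn bn]; rewrite /psi indicE mem_set; last first.
      by have /subsetPset := ndA _ _ Nn; apply.
    rewrite mulr1 min_l//; apply: (@le_trans _ _ (Num.bound (h y))%:R%R).
      apply: (le_trans (ler_norm _)).
      by have /andP[_ /ltW] := truncn_itv (normr_ge0 (h y)).
    by rewrite ler_nat.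
apply: (@le_lt_trans _ _ (2%:E * ((l `^ (- p))%:E * E))); last first.
  by rewrite lte_mul_pinfty// lte_mul_pinfty// lee_fin powR_ge0.
apply: (le_trans (fatou _ _ _ _)) => //.
- by move=> n; exact/measurable_EFinP.
- by move=> n y _; rewrite lee_fin.
by apply: (@limn_einf_le _ _ _ 0%N) => n _; exact: bound.
Qed.

End Occupation.

Section MeasureTools.
Context d (T : measurableType d) (R : realType).
Variable mu : {measure set T -> \bar R}.
Local Open Scope ereal_scope.

(** On the set where [a >= b + 1 / (n + 1)] the hypothesis leaves no room for positive measure, the
    integral of [b] being finite. *)
Lemma ae_le_of_le_integral (A : set T) (a b : T -> \bar R) : measurable A ->
  measurable_fun setT a -> measurable_fun setT b ->
  (forall x, 0 <= a x) -> (forall x, 0 <= b x) ->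
  \int[mu]_(x in A) b x < +oo ->
  (forall G, measurable G -> G `<=` A ->
    \int[mu]_(x in G) a x <= \int[mu]_(x in G) b x) ->
  {ae mu, forall x, A x -> a x <= b x}.
Proof.
move=> mA ma mb a0 b0 bfin H.
pose G n := A `&` [set x | b x + (n.+1%:R^-1)%:E <= a x].
have mG n : measurable (G n).
  apply: measurableI => //; rewrite -[X in measurable X]setTI.
  apply: measurable_lee => //.
  by apply: emeasurable_funD.
have GA n : G n `<=` A by apply: subIsetl.
have G0 n : mu (G n) = 0.
  have n0 : (0 < n.+1%:R^-1 :> R)%R by rewrite invr_gt0.
  have bGfin : \int[mu]_(x in G n) b x < +oo.
    by apply: le_lt_trans bfin; apply: ge0_subset_integral => //; exact: measurable_funTS.
  have bGf : \int[mu]_(x in G n) b x \is a fin_num.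
    by rewrite ge0_fin_numE// integral_ge0.
  have : \int[mu]_(x in G n) b x + (n.+1%:R^-1)%:E * mu (G n) <= \int[mu]_(x in G n) b x.
    apply: le_trans (H _ (mG n) (GA n)).
    rewrite -integral_cst// -ge0_integralD//; last 2 first.
    - exact: measurable_funTS.
    - by move=> x _; rewrite lee_fin ltW.
    apply: ge0_le_integral => //.
    - by move=> x _; rewrite adde_ge0// lee_fin ltW.
    - by apply: measurable_funTS; apply: emeasurable_funD.
    - exact: measurable_funTS.
    - by move=> x [].
  rewrite -leeBrDl// subee// => le0.
  apply/eqP; rewrite eq_le measure_ge0 andbT.
  by rewrite -(pmule_rle0 _ (_ : 0 < (n.+1%:R^-1)%:E)) ?lte_fin.
have : mu.-negligible (\bigcup_n G n).
  by apply: negligible_bigcup => n; apply/negligibleP => //; exact: G0.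
apply: negligibleS => x /= /not_implyP[Ax /negP]; rewrite -ltNge => bax.
have bf : b x \is a fin_num by rewrite ge0_fin_numE// (lt_le_trans bax)// leey.
have [c c0 bca] : exists2 c : R, (0 < c)%R & b x + c%:E <= a x.
  case: (a x) bax => [r| |]; last by rewrite ltNge leNye.
    rewrite -{1}(fineK bf) lte_fin => br; exists (r - fine (b x))%R.
      by rewrite subr_gt0.
    by rewrite -{1}(fineK bf) -EFinD lee_fin addrC subrK.
  by move=> _; exists 1%R => //; rewrite leey.
have [n _ /(_ _ (leqnn n)) /= nc] := near_infty_natSinv_lt (PosNum c0).
exists n => //; split => //=; apply: le_trans bca.
by rewrite leeD2l// lee_fin ltW.
Qed.

(** The indices are chosen to make the integrals summable, so the sum of the integrands is finite
    almost everywhere and its tails vanish. The [k j] need not increase: [j <= k j] suffices for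
    passing to limits along them. *)
Lemma Lnorm_cvg_ae_subseq (q : R) (v : nat -> T -> R) (w : T -> R) : (0 < q)%R ->
  (forall n, measurable_fun setT (v n)) -> measurable_fun setT w ->
  (forall e : R, (0 < e)%R -> exists N, forall n, (N <= n)%N ->
    \int[mu]_x (`|v n x - w x| `^ q)%:E <= e%:E) ->
  exists k : nat -> nat, (forall j, (j <= k j)%N) /\
    {ae mu, forall x, (v (k j) x) @[j --> \oo] --> w x}.
Proof.
move=> q0 mv mw H.
have e0 j : (0 < 1 / (2 ^ j.+1)%:R :> R)%R by rewrite divr_gt0// ltr0n expn_gt0.
have /choice[k Hk] : forall j, exists k, (j <= k)%N /\
    \int[mu]_x (`|v k x - w x| `^ q)%:E <= (1 / (2 ^ j.+1)%:R)%:E.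
  move=> j; have [N HN] := H _ (e0 j).
  by exists (maxn j N); split; [exact: leq_maxl|apply: HN; exact: leq_maxr].
exists k; split; first by move=> j; case: (Hk j).
pose F j x := (`|v (k j) x - w x| `^ q)%:E.
have mF j : measurable_fun setT (F j).
  apply/measurable_EFinP; apply: (measurableT_comp (measurable_powR _)).
  by apply: measurableT_comp => //; exact: measurable_funB.
have F0 j x : 0 <= F j x by rewrite lee_fin powR_ge0.
have sumfin : \int[mu]_x (\sum_(j <oo) F j x) < +oo.
  rewrite integral_nneseries//.
  apply: (@le_lt_trans _ _ (\sum_(j <oo) (1 / (2 ^ j.+1)%:R)%:E)).
    by apply: lee_nneseries => [j _ _|j _]; [exact: integral_ge0|case: (Hk j)].
  exact: le_lt_trans (epsilon_trick0 xpredT ler01) (ltry _).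
have mS : measurable_fun setT (fun x => \sum_(j <oo) F j x).
  by apply: ge0_emeasurable_sum.
have S0 x : 0 <= \sum_(j <oo) F j x by apply: nneseries_ge0.
have aeF := ae_lty_integral measurableT mS (fun x _ => S0 x) sumfin.
apply: (ae_imp aeF) => x /(_ Logic.I) Fx.
have := @nneseries_tail_cvg R (F ^~ x) xpredT Fx (fun j _ => F0 j x).
move=> /fine_cvgP[tfin /cvgrPdist_lt tail] /=.
apply/cvgrPdist_lt => e e0'.
have eq0 : (0 < e `^ q)%R by rewrite powR_gt0.
apply: filterS2 tfin (tail _ eq0) => j tf; rewrite sub0r normrN.
rewrite ger0_norm; last by rewrite fine_ge0// nneseries_ge0.
rewrite -lte_fin fineK// => tlt; rewrite distrC ltNge; apply/negP => le.
have : F j x < (e `^ q)%:E.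
  apply: le_lt_trans tlt.
  have -> : F j x = \sum_(j <= i < j.+1) F i x by rewrite big_nat1.
  exact: nneseries_lim_ge.
rewrite lte_fin ltNge => /negP; apply; apply: ge0_ler_powR => //.
- exact: ltW.
- by rewrite nnegrE ltW.
Qed.

End MeasureTools.

Section PlanTools.
Context {R : realType} {X : ptopologicalType}.
Local Notation leb := (@lebesgue_measure R).
Local Notation CX := (borel (curve R X)).
Variables (m : {measure set (borel X) -> \bar R}) (eta : probability CX R).
Hypothesis metX : completely_metrizable R X.
Hypothesis etam : forall t : R, t \in `[0%R, 1%R] ->
  pushforward eta (ev t : CX -> borel X) `<< m.
Local Open Scope ereal_scope.

Let unitE (t : R) : (unit_itv R) t = (0 <= t <= 1)%R :> Prop.
Proof. by rewrite /unit_itv /= in_itv. Qed.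

Section Tonelli.
Variables (D : set R) (F : CX * R -> \bar R).
Hypotheses (mD : measurable D) (mF : measurable_fun setT F) (F0 : forall z, 0 <= F z).

Let F' z := F z * (\1_D z.2)%:E.
Let mF' : measurable_fun setT F'.
Proof.
apply: emeasurable_funM => //; apply/measurable_EFinP.
by apply: (measurableT_comp (measurable_indic mD)); exact: measurable_snd.
Qed.
Let F'0 z : 0 <= F' z. Proof. by rewrite mule_ge0// lee_fin. Qed.

Let restr (h : R -> \bar R) :
  \int[leb]_(t in D) h t = \int[leb]_t (h t * (\1_D t)%:E).
Proof.
rewrite integral_mkcond; apply: eq_integral => t _.
by rewrite patchE indicE; case: ifP => _; rewrite ?mule1 ?mule0.
Qed.

Lemma measurable_inner : measurable_fun setT (fun g : CX => \int[leb]_(t in D) F (g, t)).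
Proof.
rewrite (_ : (fun g => _) = fubini_F leb F'); last first.
  by apply/funext => g; rewrite restr.
exact: measurable_fun_fubini_tonelli_F.
Qed.

Lemma tonelli_product : \int[eta]_g \int[leb]_(t in D) F (g, t) =
  \int[(eta \x leb)%E]_z (F z * (\1_D z.2)%:E).
Proof.
transitivity (\int[eta]_g fubini_F leb F' g); last first.
  by apply: esym; exact: (@fubini_tonelli1 _ _ _ _ _ eta leb F' mF' F'0).
by apply: eq_integral => g _; rewrite restr.
Qed.

Lemma tonelli_swap : \int[eta]_g \int[leb]_(t in D) F (g, t) =
  \int[leb]_(t in D) \int[eta]_g F (g, t).
Proof.
rewrite tonelli_product restr.
transitivity (\int[leb]_t fubini_G eta F' t).
  exact: (@fubini_tonelli2 _ _ _ _ _ eta leb F' mF' F'0).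
apply: eq_integral => t _.
rewrite /fubini_G /F' /= ge0_integralZr//.
exact: (measurableT_comp mF (pair2_measurable t)).
Qed.

End Tonelli.

Lemma ae_point (N : set (borel X)) t : (0 <= t <= 1)%R -> m.-negligible N ->
  {ae eta, forall g, ~ N (ev t g)}.
Proof.
move=> t01 [A [mA A0 NA]]; exists ((ev t : CX -> borel X) @^-1` A); split.
- by rewrite -[X in measurable X]setTI; exact: (@ev_measurable R X).
- have tI : t \in `[0%R, 1%R] by rewrite in_itv.
  by have /null_content_dominatesP /(_ A mA A0) := etam tI.
- by move=> g /= /contrapT /NA.
Qed.

Lemma ae_section (B : set (CX * R)) : measurable B ->
  (forall t, (0 <= t <= 1)%R -> {ae eta, forall g, ~ B (g, t)}) ->
  {ae eta, forall g, {ae leb, forall t, (0 <= t <= 1)%R -> ~ B (g, t)}}.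
Proof.
move=> mB B0.
pose F (z : CX * R) := (\1_B z)%:E : \bar R.
have mF : measurable_fun setT F by apply/measurable_EFinP; exact: measurable_indic.
have F0 z : 0 <= F z by rewrite lee_fin.
have mU := @unit_itv_measurable R.
have int0 : \int[eta]_g \int[leb]_(t in unit_itv R) F (g, t) = 0.
  rewrite tonelli_swap//; apply: integral0_eq => t; rewrite unitE => t01.
  rewrite -(integral0 eta setT); apply: ae_eq_integral_raw => //.
  by apply: (ae_imp (B0 t t01)) => g Bg _; rewrite /F indicE memNset.
have mI := measurable_inner mU mF F0.
have I0 g : 0 <= \int[leb]_(t in unit_itv R) F (g, t) by apply: integral_ge0.
have : \int[eta]_g `|\int[leb]_(t in unit_itv R) F (g, t)| = 0.
  by rewrite -[RHS]int0; apply: eq_integral => g _; apply: gee0_abs; exact: I0.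
move=> /(ae_eq_integral_abs eta measurableT mI) aeI.
apply: (ae_imp aeI) => g /(_ Logic.I) /= Ig0.
have mFg : measurable_fun (unit_itv R) (fun t => F (g, t)).
  by apply: measurable_funTS; exact: (measurableT_comp mF (pair1_measurable g)).
have : \int[leb]_(t in unit_itv R) `|F (g, t)| = 0.
  by rewrite -[RHS]Ig0; apply: eq_integral => t _; apply: gee0_abs; exact: F0.
move=> /(ae_eq_integral_abs leb mU mFg) aet.
apply: (ae_imp aet) => t /=; rewrite unitE => /[apply].
rewrite /F /= indicE => H Bt; move: H; rewrite mem_set//.
by move=> /eqP; rewrite eqe oner_eq0.
Qed.

Lemma ae_time (N : set (borel X)) : m.-negligible N ->
  {ae eta, forall g, {ae leb, forall t, (0 <= t <= 1)%R -> ~ N (ev t g)}}.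
Proof.
move=> [A [mA A0 NA]].
have mB : measurable ((fun z : CX * R => ev z.2 z.1 : borel X) @^-1` A).
  rewrite -[X in measurable X]setTI.
  exact: (ev_pair_measurable metX measurableT mA).
have nA : m.-negligible A by exists A; split.
apply: (ae_imp (ae_section mB (fun t t01 => ae_point t01 nA))) => g Hg.
by apply: (ae_imp Hg) => t H /H nAt /NA.
Qed.

End PlanTools.

Section CompressedPlan.
Context {R : realType} {X : ptopologicalType}.
Local Notation leb := (@lebesgue_measure R).
Local Notation CX := (borel (curve R X)).
Variables (d : X -> X -> \bar R) (m : {sigma_finite_measure set (borel X) -> \bar R}).
Variables (V : X -> R) (p q : R) (eta : probability CX R) (sg : R).
Hypotheses (metX : completely_metrizable R X)
  (mspeed : measurable_fun setT (speed d sg : CX * R -> \bar R))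
  (d0 : forall x y, (0 <= d x y)%E).
Hypotheses (p1 : 1 < p) (q1 : 1 < q) (pq : p^-1 + q^-1 = 1).
Hypotheses (mV : measurable_fun [set: borel X] V)
  (Vcompact : forall K : set X, compact K -> exists M : R, forall x, K x -> V x <= M).
Hypothesis compr : forall M : R, 0 <= M ->
  exists2 C : R, 0 <= C & forall B : set (borel X), measurable B ->
    (\int[leb]_(t in unit_itv R)
       pushforward eta (ev t : CX -> borel X) (B `&` [set x | (V x <= M)%R])
     <= C%:E * m B)%E.
Local Open Scope ereal_scope.

Let unitE (t : R) : (unit_itv R) t = (0 <= t <= 1)%R :> Prop.
Proof. by rewrite /unit_itv /= in_itv. Qed.

Let mU := @unit_itv_measurable R.
Let me := ev_pair_measurable metX.
Let speed0 z : 0 <= speed d sg z. Proof. exact: speed_ge0. Qed.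

Let high (M : R) : set (CX * R) := [set z | (M < V (ev z.2 z.1))%R].

Let mhigh M : measurable (high M).
Proof.
have : measurable ((fun z : CX * R => V (ev z.2 z.1)) @^-1` `]M, +oo[%classic).
  by rewrite -[X in measurable X]setTI; apply: (measurableT_comp mV me) => //.
by congr measurable; apply/seteqP; split => z /=; rewrite in_itv/= andbT.
Qed.

Definition energy (g : CX) : \bar R :=
  \int[leb]_(t in unit_itv R) (speed d sg (g, t) `^ p).

(** [V] is bounded by [K] at almost every time only: as an inequality between integrals, this
    condition is measurable in the curve. *)
Definition good_curves (K : nat) : set CX :=
  [set g | energy g <= K%:R%:E] `&`
  [set g | \int[leb]_(t in unit_itv R) (\1_(high K%:R) (g, t))%:E <= 0].

Let mspeedp : measurable_fun setT (fun z : CX * R => speed d sg z `^ p).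
Proof. exact: (measurableT_comp (measurable_poweR p) mspeed). Qed.

Let mindic M : measurable_fun setT (fun z : CX * R => (\1_(high M) z)%:E : \bar R).
Proof. by apply/measurable_EFinP; exact: measurable_indic. Qed.

Lemma good_curves_measurable K : measurable (good_curves K).
Proof.
have ml (f : CX -> \bar R) (c : \bar R) : measurable_fun setT f ->
    measurable [set g | f g <= c].
  move=> mf; rewrite -[X in measurable X]setTI.
  exact: emeasurable_fun_infty_c.
apply: measurableI; apply: ml.
  by apply: (measurable_inner mU mspeedp) => z; exact: poweR_ge0.
by apply: (measurable_inner mU (mindic _)) => z; rewrite lee_fin.
Qed.

(** The image of a curve is compact and [V] is bounded on compact sets. *)
Lemma good_curves_exists g : energy g < +oo -> exists K, good_curves K g.
Proof.
move=> Eg.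
have cK : compact (ev^~ g @` unit_itv R).
  apply: continuous_compact; last exact: segment_compact.
  by apply: continuous_subspaceT; exact: ev_continuous.
have [M HM] := Vcompact cK.
have E0 : 0 <= energy g by apply: integral_ge0 => t _; exact: poweR_ge0.
pose a := fine (energy g).
exists (maxn (Num.bound a) (Num.bound M)); split => /=.
  rewrite -(@fineK _ (energy g)) ?ge0_fin_numE// lee_fin -/a.
  apply: (le_trans (ler_norm _)); apply: (le_trans (ltW (archi_boundP (normr_ge0 a)))).
  rewrite /Num.bound normr_id ler_nat; exact: leq_maxl.
rewrite integral0_eq// => t tI; rewrite indicE memNset//= /high /=.
apply/negP; rewrite -leNgt.
apply: (le_trans (HM (ev t g) _)); first by exists t.
apply: (le_trans (ler_norm _)); apply: (le_trans (ltW (archi_boundP (normr_ge0 M)))).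
rewrite /Num.bound normr_id ler_nat; exact: leq_maxr.
Qed.

(** [occupation_density] on the product of the plan and time. The family [G] is arbitrary among good
    curves so that integrated inequalities can later be localized to almost every curve. *)
Lemma plan_density (K : nat) (G : set CX) (D : set R) :
  measurable G -> G `<=` good_curves K -> measurable D -> D `<=` unit_itv R ->
  exists h : borel X -> R,
  [/\ measurable_fun setT h, forall y, (0 <= h y)%R,
      \int[m]_y ((h y `^ p)%:E) < +oo &
      forall phi : borel X -> \bar R, measurable_fun setT phi -> (forall y, 0 <= phi y) ->
        \int[eta]_(g in G) \int[leb]_(t in D) (phi (ev t g) * speed d sg (g, t)) =
        \int[m]_y (phi y * (h y)%:E)].
Proof.
move=> mG GK mD DU.
(* Removing the times at which [V > K] changes no integral along good curves, and makes the
   compression bound applicable on all of [A]. *)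
pose A : set (CX * R) := (G `*` D) `\` high K%:R.
have mA : measurable A by apply: measurableD => //; exact: measurableX.
pose W z := (\1_A z)%:E * speed d sg z.
have mW : measurable_fun setT W.
  by apply: emeasurable_funM => //; apply/measurable_EFinP; exact: measurable_indic.
have W0 z : 0 <= W z by rewrite mule_ge0// lee_fin.
have [C C0 HC] := compr (ler0n R K).
have intA (F : CX * R -> \bar R) : measurable_fun setT F -> (forall z, 0 <= F z) ->
    \int[(eta \x leb)%E]_z ((\1_A z)%:E * F z) =
    \int[eta]_(g in G) \int[leb]_(t in D) F (g, t).
  move=> mF F0.
  transitivity (\int[eta]_g \int[leb]_t ((\1_A (g, t))%:E * F (g, t))).
    apply: (@fubini_tonelli1 _ _ _ _ _ eta leb (fun z => (\1_A z)%:E * F z)).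
      by apply: emeasurable_funM => //; apply/measurable_EFinP; exact: measurable_indic.
    by move=> z; rewrite mule_ge0// lee_fin.
  rewrite [RHS]integral_mkcond; apply: eq_integral => g _; rewrite patchE.
  case: ifPn => gG; last first.
    rewrite integral0_eq// => t _; rewrite indicE memNset ?mul0e//.
    by move=> -[[/= Gg _] _]; move: gG; rewrite mem_set.
  move: gG => /set_mem Gg; rewrite [RHS]integral_mkcond.
  have [_ /= Vg] := GK g Gg.
  have mFg : measurable_fun setT (fun t => F (g, t)).
    exact: (measurableT_comp mF (pair1_measurable g)).
  have mig : measurable_fun (unit_itv R) (fun t => (\1_(high K%:R) (g, t))%:E : \bar R).
    apply: measurable_funTS.
    exact: (measurableT_comp (mindic _) (pair1_measurable g)).
  have ae0 : {ae leb, forall t, unit_itv R t -> ~ high K%:R (g, t)}.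
    have : \int[leb]_(t in unit_itv R) `|(\1_(high K%:R) (g, t))%:E| = 0.
      apply/eqP; rewrite eq_le integral_ge0 ?andbT//.
      apply: le_trans Vg; rewrite le_eqVlt; apply/orP; left; apply/eqP.
      by apply: eq_integral => t _; rewrite gee0_abs// lee_fin.
    move=> /(ae_eq_integral_abs leb mU mig) aet.
    apply: (ae_imp aet) => t H /H /eqP; rewrite indicE eqe => /[swap] hz.
    by rewrite mem_set// oner_eq0.
  apply: ae_eq_integral_raw => //.
  - by move=> t _; rewrite mule_ge0// lee_fin.
  - by move=> t _; rewrite patchE; case: ifP.
  apply: (ae_imp ae0) => t Ht _; rewrite patchE; case: ifPn => [/set_mem Dt|nD].
    by rewrite indicE mem_set ?mul1e//; split => //; apply: Ht; exact: DU.
  rewrite indicE memNset ?mul0e// => -[[/= _ Dt] _].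
  by move: nD; rewrite mem_set.
have intAp (F : CX * R -> \bar R) c : 0 <= c -> measurable_fun setT F ->
    (forall z, 0 <= F z) ->
    (forall g, G g -> \int[leb]_(t in unit_itv R) F (g, t) <= c) ->
    \int[(eta \x leb)%E]_z ((\1_A z)%:E * F z) <= c.
  move=> c0 mF F0 Fc; rewrite intA//.
  apply: (@le_trans _ _ (\int[eta]_(g in G) cst c g)).
    apply: ae_le_integral_raw => //.
      by move=> g _; apply: integral_ge0.
    apply: aeW => g Gg; apply: le_trans (Fc g Gg).
    apply: ge0_subset_integral => //; apply: measurable_funTS.
    exact: (measurableT_comp mF (pair1_measurable g)).
  by rewrite integral_cst// -[leRHS]mule1; apply: lee_wpmul2l => //; exact: probability_le1.
have leb1 : \int[leb]_(t in unit_itv R) (cst 1) t = 1 :> \bar R.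
  rewrite integral_cst// mul1e.
  by rewrite [LHS](@lebesgue_measure_itv R `[0%R, 1%R])/= lte_fin ltr01 -EFinB subr0.
have energyK g : G g -> energy g <= K%:R%:E by move=> /GK[].
(* The speed is at most [1] plus its [p]-th power, and time has total measure one. *)
have Wfin : \int[(eta \x leb)%E]_z W z < +oo.
  apply: (@le_lt_trans _ _ (1 + K%:R)%:E); last exact: ltry.
  apply: intAp => //.
  move=> g Gg; apply: (@le_trans _ _
    (\int[leb]_(t in unit_itv R) (cst 1 t + speed d sg (g, t) `^ p))).
    apply: ae_le_integral_raw => //.
      by move=> t _; rewrite adde_ge0// poweR_ge0.
    apply: aeW => t _; case E : (speed d sg (g, t)) (speed0 (g, t)) => [s| |]//= s0.
      rewrite -EFinD lee_fin; have [s1|/ltW s1] := leP s 1%R.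
        by rewrite (le_trans s1)// lerDl powR_ge0.
      apply: (@le_trans _ _ (s `^ p)%R); last by rewrite lerDr.
      by apply: le1r_powR => //; exact: ltW.
    by rewrite gt_eqF ?(lt_trans ltr01)// addey.
  rewrite ge0_integralD//; first by rewrite leb1 EFinD leeD2l// energyK.
  - by move=> t _; exact: poweR_ge0.
  - by apply: measurable_funTS; exact: (measurableT_comp mspeedp (pair1_measurable g)).
have WpE z : W z `^ p = (\1_A z)%:E * speed d sg z `^ p.
  rewrite /W indicE; case: (_ \in _); first by rewrite !mul1e.
  by rewrite !mul0e poweR0r// gt_eqF// (lt_trans ltr01).
have Wp : \int[(eta \x leb)%E]_z (W z `^ p) < +oo.
  apply: (@le_lt_trans _ _ K%:R%:E); last exact: ltry.
  have -> : (fun z => W z `^ p) = (fun z => (\1_A z)%:E * speed d sg z `^ p).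
    by apply/funext.
  by apply: intAp => //; first by move=> z; exact: poweR_ge0.
(* The constant is [C + 1] because [occupation_density] asks for a positive one, while [C] may
   vanish. *)
have Wm (B : set (borel X)) : measurable B ->
    \int[(eta \x leb)%E]_z ((\1_B (ev z.2 z.1 : borel X))%:E *
    (\1_[set z | (0 < W z)%E] z)%:E) <= (C + 1)%:E * m B.
  move=> mB.
  have mVK : measurable [set x : borel X | (V x <= K%:R)%R].
    rewrite (_ : [set x | _] = V @^-1` `]-oo, K%:R]%classic).
      by rewrite -[X in measurable X]setTI; exact: mV.
    by apply/seteqP; split => x /=; rewrite in_itv.
  pose F (z : CX * R) : \bar R := (\1_(B `&` [set x | (V x <= K%:R)%R]) (ev z.2 z.1))%:E.
  have mF : measurable_fun setT F.
    apply/measurable_EFinP; apply: (measurableT_comp _ me).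
    by apply: measurable_indic; exact: measurableI.
  have F0 z : 0 <= F z by rewrite lee_fin.
  apply: (@le_trans _ _ (C%:E * m B)); last first.
    by rewrite lee_wpmul2r// lee_fin lerDl.
  apply: le_trans (HC B mB).
  apply: (@le_trans _ _ (\int[(eta \x leb)%E]_z (F z * (\1_(unit_itv R) z.2)%:E))).
    apply: ae_le_integral_raw => //.
      by move=> z _; rewrite mule_ge0// lee_fin.
    apply: aeW => z _; have [zA|nA] := pselect (A z); last first.
      have Wz0 : W z = 0 by rewrite /W indicE memNset// mul0e.
      rewrite [X in _ * X%:E <= _]indicE memNset/= ?Wz0 ?ltxx// mule0.
      by rewrite mule_ge0// lee_fin.
    have [[/= Gz Dz] nh] := zA.
    rewrite [X in _ * X%:E <= _]indicE [X in _ <= _ * X%:E]indicE (mem_set (DU _ Dz)) mule1.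
    apply: (@le_trans _ _ (\1_B (ev z.2 z.1))%:E).
      by rewrite -[leRHS]mule1 lee_wpmul2l// lee_fin// lern1; case: (_ \in _).
    rewrite lee_fin /= !indicE; case: (asboolP (B (ev z.2 z.1))) => [Bz|nB].
      rewrite !mem_set//; split => //=; rewrite leNgt; exact/negP.
    by rewrite (memNset nB).
  rewrite -tonelli_product// tonelli_swap//.
  rewrite le_eqVlt; apply/orP; left; apply/eqP; apply: eq_integral => t _.
  rewrite /pushforward -[RHS]mul1e -[X in X * _]/(1%:E) -integral_cst//.
    rewrite integral_mkcond; apply: eq_integral => g _.
    rewrite patchE /F /= indicE.
    have [h|h] := pselect ((B `&` [set x | (V x <= K%:R)%R]) (ev t g)).
      by rewrite !mem_set.
    by rewrite !memNset.
  rewrite -[X in measurable X]setTI; apply: (@ev_measurable R X) => //.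
  exact: measurableI.
have C10 : (0 < C + 1)%R by rewrite ltr_wpDl.
have [h [mh h0 hp hE]] := @occupation_density _ _ _ _ R (eta \x leb)%E m W
  (fun z => ev z.2 z.1) p q (C + 1) mW W0 me p1 q1 pq C10 Wfin Wp Wm.
exists h; split => // phi mphi phi0.
rewrite -hE//; transitivity (\int[(eta \x leb)%E]_z
    ((\1_A z)%:E * (phi (ev z.2 z.1) * speed d sg z))).
  apply: esym; apply: (intA (fun z => phi (ev z.2 z.1) * speed d sg z)).
    by apply: emeasurable_funM => //; exact: (measurableT_comp mphi me).
  by move=> z; rewrite mule_ge0.
by apply: eq_integral => z _; rewrite /W muleCA.
Qed.

End CompressedPlan.

Lemma limn_einf_le_cvg (R : realType) (u b : nat -> \bar R) l :
  (forall n, u n <= b n)%E -> b n @[n --> \oo] --> l -> (limn_einf u <= l)%E.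
Proof.
move=> ub bl; rewrite limn_einf_lim -(cvg_lim (@ereal_hausdorff R) bl).
apply: lee_lim; [exact: is_cvg_einfs|by apply/cvg_ex; exists l|].
apply: nearW => n; apply: le_trans (ub n).
by apply: ereal_inf_lbound; exists n => /=.
Qed.

Section LqFunctions.
Context d (T : measurableType d) (R : realType).
Variables (m : {measure set T -> \bar R}) (q : R).
Hypothesis q0 : 0 < q.
Local Open Scope ereal_scope.

Lemma Lq_integral (f : T -> R) :
  'N[m]_q%:E[EFin \o f] < +oo <-> \int[m]_x (`|f x| `^ q)%:E < +oo.
Proof.
have qn : q != 0%R by rewrite gt_eqF.
have E : 'N[m]_q%:E[EFin \o f] `^ q = \int[m]_x (`|f x| `^ q)%:E.
  by rewrite poweR_Lnorm.
split; first by move=> fq; rewrite -E; exact: poweR_lty.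
by rewrite -E; exact: lty_poweRy.
Qed.

Lemma Lnorm_cvg0_integral (f : nat -> T -> R) :
  'N[m]_q%:E[EFin \o f i] @[i --> \oo] --> 0 ->
  forall e : R, (0 < e)%R -> exists N, forall n, (N <= n)%N ->
    \int[m]_x (`|f n x| `^ q)%:E <= e%:E.
Proof.
move=> fcvg e e0; have e1 : (0 < e `^ q^-1)%R by rewrite powR_gt0.
have [N _ HN] : \forall n \near \oo, 'N[m]_q%:E[EFin \o f n] < (e `^ q^-1)%:E.
  apply: (fcvg [set x | x < (e `^ q^-1)%:E]).
  by apply: open_nbhs_nbhs; split; [exact: open_ereal_lt_ereal|rewrite /= lte_fin].
exists N => n /HN /= /ltW H.
have -> : \int[m]_x (`|f n x| `^ q)%:E = 'N[m]_q%:E[EFin \o f n] `^ q.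
  by rewrite poweR_Lnorm ?gt_eqF.
apply: (le_trans (le_poweR (ltW q0) (Lnorm_ge0 _ _ _) H)).
by rewrite poweR_EFin -powRrM mulVf ?gt_eqF// powRr1// ltW.
Qed.

Lemma young_lty (p : R) (a b : T -> R) : (0 < p)%R -> (p^-1 + q^-1 = 1)%R ->
  measurable_fun setT a -> measurable_fun setT b ->
  (forall x, 0 <= a x)%R -> (forall x, 0 <= b x)%R ->
  \int[m]_x (a x `^ q)%:E < +oo -> \int[m]_x (b x `^ p)%:E < +oo ->
  \int[m]_x ((a x)%:E * (b x)%:E) < +oo.
Proof.
move=> p0 pq ma mb a0 b0 aq bp.
have qp : (q^-1 + p^-1 = 1)%R by rewrite addrC.
have mp (r : R) (f : T -> R) : measurable_fun setT f ->
    measurable_fun setT (fun x => (f x `^ r)%:E).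
  by move=> mf; apply/measurable_EFinP; exact: (measurableT_comp (measurable_powR r)).
apply: (@le_lt_trans _ _ (\int[m]_x ((q^-1)%:E * (a x `^ q)%:E + (p^-1)%:E * (b x `^ p)%:E))).
  apply: ae_le_integral_raw => //.
  - by move=> x _; rewrite mule_ge0 ?lee_fin.
  - by move=> x _; rewrite adde_ge0// mule_ge0 ?lee_fin ?powR_ge0 ?invr_ge0 ?ltW.
  apply: aeW => x _; rewrite -!EFinM -EFinD lee_fin.
  by rewrite [X in (_ <= X + _)%R]mulrC [X in (_ <= _ + X)%R]mulrC; exact: conjugate_powR.
have iq0 : 0 <= (q^-1)%:E by rewrite lee_fin invr_ge0 ltW.
have ip0 : 0 <= (p^-1)%:E by rewrite lee_fin invr_ge0 ltW.
rewrite ge0_integralD//; [|by move=> x _; rewrite mule_ge0 ?lee_fin ?powR_ge0|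
  by apply: emeasurable_funM => //; exact: mp|
  by move=> x _; rewrite mule_ge0 ?lee_fin ?powR_ge0|
  by apply: emeasurable_funM => //; exact: mp].
rewrite !ge0_integralZl//; [|exact: mp|by move=> x _; rewrite lee_fin powR_ge0|
  exact: mp|by move=> x _; rewrite lee_fin powR_ge0].
by apply: lte_add_pinfty; [exact: (lte_mul_pinfty iq0 isT aq)|exact: (lte_mul_pinfty ip0 isT bp)].
Qed.

End LqFunctions.

(** * Relaxed gradients along curves *)

Section RelaxedGradientCurve.
Context {R : realType} {X : ptopologicalType}.
Local Notation leb := (@lebesgue_measure R).
Local Notation CX := (borel (curve R X)).
Variables (d : X -> X -> \bar R) (m : {sigma_finite_measure set (borel X) -> \bar R}).
Variables (V : X -> R) (p q : R) (eta : probability CX R) (sg : R).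
Hypotheses (metX : completely_metrizable R X)
  (mspeed : measurable_fun setT (speed d sg : CX * R -> \bar R))
  (dA : asymmetric_extended_metric d).
Hypotheses (p1 : 1 < p) (q1 : 1 < q) (pq : p^-1 + q^-1 = 1).
Hypotheses (mV : measurable_fun [set: borel X] V)
  (Vcompact : forall K : set X, compact K -> exists M : R, forall x, K x -> V x <= M).
Hypothesis compr : forall M : R, 0 <= M ->
  exists2 C : R, 0 <= C & forall B : set (borel X), measurable B ->
    (\int[leb]_(t in unit_itv R)
       pushforward eta (ev t : CX -> borel X) (B `&` [set x | (V x <= M)%R])
     <= C%:E * m B)%E.
Hypothesis etam : forall t : R, t \in `[0%R, 1%R] ->
  pushforward eta (ev t : CX -> borel X) `<< m.
Hypothesis energy_ae : {ae eta, forall g, energy d p sg g < +oo}%E.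
Variables (s t x y : R).
Hypotheses (s0 : 0 <= s) (t1 : t <= 1) (x01 : 0 <= x <= 1) (y01 : 0 <= y <= 1).
Local Open Scope ereal_scope.
Hypothesis slope_ae : {ae eta, forall g, forall v : X -> R, forward_Lipschitz d v ->
  (v (ev y g) - v (ev x g))%:E <= \int[leb]_(r in `[s, t])
     (ascending_slope d v (ev r g) * speed d sg (g, r))}.

Let d0 x1 x2 : 0 <= d x1 x2. Proof. by case: dA. Qed.
Let p0 : (0 < p)%R. Proof. exact: lt_trans ltr01 p1. Qed.
Let q0 : (0 < q)%R. Proof. exact: lt_trans ltr01 q1. Qed.
Let speed0 z : 0 <= speed d sg z. Proof. exact: speed_ge0. Qed.
Let mD : measurable (`[s, t]%classic : set R). Proof. exact: measurable_itv. Qed.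
Let DU r : (`[s, t]%classic : set R) r -> (0 <= r <= 1)%R.
Proof.
by rewrite /= in_itv/= => /andP[sr rt]; rewrite (le_trans s0 sr) (le_trans rt t1).
Qed.
Let mev r : measurable_fun setT (ev r : CX -> borel X).
Proof. exact: ev_measurable. Qed.
Let Lq_conj (h : X -> R) : measurable_fun [set: borel X] h -> (forall z, 0 <= h z)%R ->
  \int[m]_z ((h z `^ p)%:E) < +oo -> Lq m (q / (q - 1)) h.
Proof.
move=> mh h0 hp; have -> : (q / (q - 1) = p)%R.
  have : (p^-1 = 1 - q^-1)%R by rewrite -pq addrK.
  move=> /(congr1 GRing.inv); rewrite invrK => ->.
  have -> : (1 - q^-1 = (q - 1) / q)%R by rewrite mulrBl mulfV ?gt_eqF// mul1r.
  by rewrite invf_div.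
split; first by apply: (ae_completed_measurable_fun mh); exact: aeW.
apply/(Lq_integral m p0 h).
have -> // : (fun z => (`|h z| `^ p)%:E) = (fun z => (h z `^ p)%:E).
by apply/funext => z; rewrite ger0_norm.
Qed.

(** The end times [x], [y] of the increment are kept apart from the interval from [s] to [t]: motion
    to the right takes them as [s], [t], motion to the left as [t], [s]. In both cases the slopes of
    the approximations are paired with one fixed density in L^p, so that their weak convergence
    suffices. *)
Lemma relaxed_gradient_curve (u G : X -> R) (u0 G0 : borel X -> R) :
  relaxed_ascending_gradient d m q u G ->
  measurable_fun setT u0 -> {ae m, forall z, u z = u0 z} ->
  measurable_fun setT G0 -> {ae m, forall z, G z = G0 z} -> (forall z, 0 <= G0 z)%R ->
  {ae eta, forall g, (u0 (ev y g) - u0 (ev x g))%:E <=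
     \int[leb]_(r in `[s, t]) ((G0 (ev r g))%:E * speed d sg (g, r))}.
Proof.
move=> [uLq GLq G_ge0 [v [Gt [vP vcvg [slLq GtLq weak] GtG]]]] mu0 uu0 mG0 GG0 G00.
pose sl i z := fine (ascending_slope d (v i) z).
have sl0 i z : (0 <= sl i z)%R by apply: fine_ge0; exact: ascending_slope_ge0.
have /choice[L HL] : forall i, exists L : borel X -> R,
    [/\ measurable_fun setT L, {ae m, forall z, sl i z = L z} & forall z, (0 <= L z)%R].
  move=> i; have [cm _] := slLq i.
  have [L [mL aeL L0]] := completed_measurable_fun_ae_real cm.
  by exists L; split => //; exact: L0 (sl0 i).
have mv i : measurable_fun [set: borel X] (v i) by have [] := vP i.
(* At the fixed times [x] and [y] the law of the position is absolutely continuous, so convergence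
   [m]-almost everywhere passes to almost every curve; it is available along a subsequence. *)
have [k [kj aek]] : exists k : nat -> nat, (forall j, (j <= k j)%N) /\
    {ae m, forall z, (v (k j) z) @[j --> \oo] --> u0 z}.
  apply: (@Lnorm_cvg_ae_subseq _ _ _ m q) => // e e0.
  have [N HN] := Lnorm_cvg0_integral q0 vcvg e0.
  exists N => n /HN; apply: le_trans.
  apply: ae_le_integral_raw => //; [by move=> *; rewrite lee_fin powR_ge0..|].
  by apply: (ae_imp uu0) => z -> _.
have ptx := ae_point etam x01 aek; have pty := ae_point etam y01 aek.
have aeS : {ae eta, forall g, forall i, {ae leb, forall r, (0 <= r <= 1)%R ->
    sl i (ev r g) = L i (ev r g)}}.
  apply: ae_forall_countable => i; have [_ aeL _] := HL i.
  apply: (ae_imp (ae_time metX etam aeL)) => g Hg.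
  by apply: (ae_imp Hg) => r H /H /contrapT.
(* Positive parts, as Fatou's lemma needs nonnegative integrands. *)
pose dv j (g : CX) : R := Num.max 0%R (v (k j) (ev y g) - v (k j) (ev x g))%R.
pose a (g : CX) : \bar R := (Num.max 0 (u0 (ev y g) - u0 (ev x g))%R)%:E.
pose b (g : CX) := \int[leb]_(r in `[s, t]) ((G0 (ev r g))%:E * speed d sg (g, r)).
have mdiff (w : borel X -> R) : measurable_fun setT w ->
    measurable_fun setT (fun g : CX => (Num.max 0 (w (ev y g) - w (ev x g))%R)%:E : \bar R).
  move=> mw; apply/measurable_EFinP; apply: measurable_maxr; first exact: measurable_cst.
  by apply: measurable_funB; exact: (measurableT_comp mw (@mev _)).
have ma : measurable_fun setT a by exact: mdiff.
have mb : measurable_fun setT b.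
  apply: (measurable_inner mD (F := fun z => (G0 (ev z.2 z.1))%:E * speed d sg z)).
    apply: emeasurable_funM => //; apply/measurable_EFinP.
    exact: (measurableT_comp mG0 (ev_pair_measurable metX)).
  by move=> z; rewrite mule_ge0// lee_fin.
have b0 g : 0 <= b g by apply: integral_ge0 => r _; rewrite mule_ge0// lee_fin.
have a0 g : 0 <= a g by rewrite lee_fin le_max lexx.
have mEFin (w : borel X -> R) : measurable_fun setT w -> measurable_fun setT (EFin \o w).
  by move=> mw; exact/measurable_EFinP.
(* Weak convergence is tested against the density of the family [Gam]; letting [Gam] vary recovers
   the inequality along almost every good curve. *)
have density K (Gam : set CX) : measurable Gam -> Gam `<=` good_curves d V p sg K ->
  exists h : borel X -> R, [/\ \int[eta]_(g in Gam) b g =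
      \int[m]_z ((G0 z)%:E * (h z)%:E),
    \int[m]_z ((G0 z)%:E * (h z)%:E) < +oo &
    \int[eta]_(g in Gam) a g <= \int[m]_z ((G0 z)%:E * (h z)%:E)].
  move=> mGam GamK.
  have DU' : (`[s, t]%classic : set R) `<=` unit_itv R.
    by move=> r /DU; rewrite /unit_itv /= in_itv.
  have [h [mh h0 hp hE]] := plan_density metX mspeed d0 p1 q1 pq mV compr mGam GamK mD DU'.
  exists h.
  have E1 : \int[eta]_(g in Gam) b g = \int[m]_z ((G0 z)%:E * (h z)%:E).
    by apply: hE; [exact: mEFin|move=> z; rewrite lee_fin].
  split => //.
    apply: (young_lty q0 p0 pq mG0 mh G00 h0 _ hp).
    have /Lq_integral := GLq.2 => /(_ q0); apply: le_lt_trans.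
    apply: ae_le_integral_raw => //; [by move=> *; rewrite lee_fin powR_ge0..|].
    by apply: (ae_imp GG0) => z -> _; rewrite ger0_norm.
  have bnd j : \int[eta]_(g in Gam) (dv j g)%:E <= \int[m]_z (sl (k j) z * h z)%:E.
    have [mL aeL L0] := HL (k j).
    apply: (@le_trans _ _ (\int[eta]_(g in Gam) \int[leb]_(r in `[s, t])
        ((L (k j) (ev r g))%:E * speed d sg (g, r)))).
      apply: ae_le_integral_raw => //.
      - by move=> g _; rewrite lee_fin le_max lexx.
      - by move=> g _; apply: integral_ge0 => r _; rewrite mule_ge0// lee_fin.
      apply: (ae_imp2 slope_ae aeS) => g Hg /(_ (k j)) Sg _.
      have [_ vL _] := vP (k j).
      rewrite /dv EFin_max ge_max; apply/andP; split.
        by apply: integral_ge0 => r _; rewrite mule_ge0// lee_fin.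
      apply: (le_trans (Hg _ vL)); apply: ae_le_integral_raw => //.
      - by move=> r _; rewrite mule_ge0// ascending_slope_ge0.
      - by move=> r _; rewrite mule_ge0// lee_fin.
      apply: (ae_imp Sg) => r Hr /DU /Hr <-; rewrite fineK//.
      rewrite ge0_fin_numE ?ascending_slope_ge0//.
      exact: (forward_Lipschitz_slope dA _ vL).
    rewrite (hE (EFin \o L (k j)) (mEFin _ mL) (fun z => L0 z)).
    apply: ae_le_integral_raw => //.
    - by move=> z _; rewrite mule_ge0// lee_fin.
    - by move=> z _; rewrite lee_fin mulr_ge0.
    by apply: (ae_imp aeL) => z -> _; rewrite EFinM.
  have hLq := Lq_conj mh h0 hp.
  have klim : \int[m]_z (sl (k j) z * h z)%:E @[j --> \oo] --> \int[m]_z (Gt z * h z)%:E.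
    have kinf : k j @[j --> \oo] --> \oo.
      apply/cvgnyPge => A; exists A => // n /= An; exact: leq_trans An (kj n).
    exact: (@cvg_comp _ _ _ k (fun i => \int[m]_z (sl i z * h z)%:E) _ _ _ kinf (weak h hLq)).
  apply: (@le_trans _ _ (\int[m]_z (Gt z * h z)%:E)).
    apply: (@le_trans _ _ (\int[eta]_(g in Gam) limn_einf (fun j => (dv j g)%:E))).
      apply: ae_le_integral_raw => //.
        move=> g _; apply: (limn_einf_ge (N := 0%N)) => n _.
        by rewrite lee_fin le_max lexx.
      apply: (ae_imp2 ptx pty) => g /contrapT cx /contrapT cy _.
      have cv : (dv j g)%:E @[j --> \oo] --> a g.
        apply: cvg_EFin; first exact: nearW.
        apply: (@continuous_cvg _ _ _ _ _ _ (fun z : R => Num.max 0 z)%R).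
          by apply: (@continuous_max R R (cst 0%R) id) => ?; [exact: cvg_cst|exact: cvg_id].
        exact: (cvgB cy cx).
      by rewrite is_cvg_limn_einfE; [rewrite (cvg_lim _ cv)|apply/cvg_ex; exists (a g)].
    apply: (@le_trans _ _ (limn_einf (fun j => \int[eta]_(g in Gam) (dv j g)%:E))).
      apply: fatou => //.
        by move=> n; apply: measurable_funTS; exact: mdiff.
      by move=> n g _; rewrite lee_fin le_max lexx.
    exact: (limn_einf_le_cvg bnd klim).
  (* The weak limit [Gt] is only bounded above by [G], with no sign prescribed; the negative part is
     dropped. *)
  rewrite integralE.
  apply: (@le_trans _ _ (\int[m]_z ((fun z => (Gt z * h z)%:E) ^\+ z))).
    by rewrite -[leRHS]adde0 leeD2l// oppe_le0; apply: integral_ge0.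
  apply: ae_le_integral_raw => //.
    by move=> z _; rewrite mule_ge0// lee_fin.
  apply: (ae_imp2 GtG GG0) => z GtGz GG0z _.
  rewrite funeposE ge_max; apply/andP; split; last by rewrite mule_ge0// lee_fin.
  by rewrite -EFinM lee_fin -GG0z ler_wpM2r.
have main K : {ae eta, forall g, good_curves d V p sg K g -> a g <= b g}.
  have mK := good_curves_measurable p metX mspeed mV K.
  apply: ae_le_of_le_integral => //.
    by have [h [-> ]] := density K _ mK (@subset_refl _ _).
  by move=> Gam mGam GamK; have [h [-> _ ]] := density K Gam mGam GamK.
apply: (ae_imp2 energy_ae (ae_forall_countable main)) => g Eg H.
have [K gK] := good_curves_exists Vcompact Eg.
by apply: le_trans (H K gK); rewrite lee_fin le_max lexx orbT.
Qed.

End RelaxedGradientCurve.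

(** * From fixed times to almost all times *)

Section IntegrableRestriction.
Context {R : realType}.
Local Notation leb := (@lebesgue_measure R).
Local Open Scope ereal_scope.

(** [itv_int] and [travel] take real densities on the line. Where [A] is infinite, on a null set if
    its integral is finite, [fine] gives [0]. *)
Definition unit_restrict (A : R -> \bar R) : R -> R := (fine \o A) \_ (unit_itv R).

Lemma unit_restrict_ge0 A : (forall r, 0 <= A r) -> forall r, (0 <= unit_restrict A r)%R.
Proof. by move=> A0 r; rewrite /unit_restrict patchE; case: ifP => // _; exact: fine_ge0. Qed.

Variable A : R -> \bar R.
Hypotheses (mA : measurable_fun setT A) (A0 : forall r, 0 <= A r)
  (Afin : \int[leb]_(r in unit_itv R) A r < +oo).

Let mU := @unit_itv_measurable R.

Lemma unit_restrict_ae :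
  {ae leb, forall r, unit_itv R r -> (unit_restrict A r)%:E = A r}.
Proof.
have mAU : measurable_fun (unit_itv R) A by exact: measurable_funTS.
have aeA : {ae leb, forall r, unit_itv R r -> A r < +oo}.
  by apply: ae_lty_integral.
apply: (ae_imp aeA) => r Ar Ur.
by rewrite /unit_restrict patchE mem_set//= fineK// ge0_fin_numE// Ar.
Qed.

Lemma integrable_unit_restrict : integrable_fun (unit_restrict A).
Proof.
apply/integrableP; split.
  apply/measurable_EFinP; apply/(measurable_restrictT _ mU).
  by apply: measurable_funTS; exact: measurableT_comp.
apply: le_lt_trans Afin.
rewrite [leRHS]integral_mkcond; apply: ae_le_integral_raw => //.
- by move=> r _; rewrite patchE; case: ifP.
apply: (ae_imp unit_restrict_ae) => r Hr _; rewrite /= patchE; case: ifPn => rU.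
  rewrite -(Hr (set_mem rU)) ger0_norm//; exact: unit_restrict_ge0.
by rewrite /unit_restrict patchE (negbTE rU) normr0.
Qed.

Lemma integral_unit_restrict (s t : R) : (0 <= s)%R -> (s <= t)%R -> (t <= 1)%R ->
  \int[leb]_(r in `[s, t]) A r = (itv_int (unit_restrict A) s t)%:E.
Proof.
move=> s0 st t1; rewrite itv_intE; last exact: integrable_unit_restrict.
have mD : measurable (`[s, t]%classic : set R) by exact: measurable_itv.
rewrite [RHS](_ : _ = \int[leb]_(r in `[s, t]) (unit_restrict A r)%:E).
  apply: ae_eq_integral_raw => //.
    by move=> r _; rewrite lee_fin unit_restrict_ge0.
  apply: (ae_imp unit_restrict_ae) => r Hr; rewrite /= in_itv/= => /andP[sr rt].
  by rewrite Hr// /unit_itv /= in_itv/= (le_trans s0 sr) (le_trans rt t1).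
apply: integral_itv_obnd_cbnd.
by apply: measurable_funTS; have /integrableP[] := integrable_unit_restrict.
Qed.

End IntegrableRestriction.

Section RationalTimes.
Context {R : realType} {X : ptopologicalType}.
Local Notation leb := (@lebesgue_measure R).
Local Notation CX := (borel (curve R X)).
Variables (eta : probability CX R).
Hypotheses (metX : completely_metrizable R X).
Variables (A : CX * R -> \bar R) (w : borel X -> R).
Hypotheses (mA : measurable_fun setT A) (mw : measurable_fun setT w)
  (A0 : forall z, (0 <= A z)%E).
Local Open Scope ereal_scope.

Local Notation ratR := (@ratr R).

(** One end of the interval is kept rational: this leaves countably many conditions on [r], and two
    admissible times are compared through a rational between them. *)
Definition rational_bound (g : curve R X) (r : R) := forall c : rat,
  (0 <= ratR c <= (1 : R))%R ->
  ((ratR c <= r)%R -> (w (ev r g) - w (ev (ratR c) g))%:E <=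
     \int[leb]_(x in `[ratR c, r]) A (g, x)) /\
  ((r <= ratR c)%R -> (w (ev (ratR c) g) - w (ev r g))%:E <=
     \int[leb]_(x in `[r, ratR c]) A (g, x)).

Lemma measurable_itv_integral (h1 h2 : R -> R) : measurable_fun setT h1 ->
  measurable_fun setT h2 -> measurable_fun setT
    (fun z : CX * R => \int[leb]_(x in `[h1 z.2, h2 z.2]) A (z.1, x)).
Proof.
move=> mh1 mh2.
pose S : set ((CX * R) * R) := [set y | (h1 y.1.2 <= y.2 <= h2 y.1.2)%R].
have mS : measurable S.
  have m12 : measurable_fun setT (fun y : (CX * R) * R => y.1.2).
    exact: (measurableT_comp measurable_snd measurable_fst).
  have m2 : measurable_fun setT (fun y : (CX * R) * R => y.2) by exact: measurable_snd.
  rewrite (_ : S = [set y | (h1 y.1.2 <= y.2)%R] `&` [set y | (y.2 <= h2 y.1.2)%R]).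
    apply: measurableI; rewrite -[X in measurable X]setTI.
      by apply: measurable_fun_ler => //; exact: (measurableT_comp mh1 m12).
    by apply: measurable_fun_ler => //; exact: (measurableT_comp mh2 m12).
  by apply/seteqP; split => y /= => [/andP[]|[h1y h2y]] //; apply/andP.
pose F (y : (CX * R) * R) := A (y.1.1, y.2) * (\1_S y)%:E.
have mF : measurable_fun setT F.
  apply: emeasurable_funM; last by apply/measurable_EFinP; exact: measurable_indic.
  apply: (measurableT_comp mA); apply/measurable_fun_pairP; split => /=.
    exact: (measurableT_comp measurable_fst measurable_fst).
  exact: measurable_snd.
rewrite (_ : (fun z => _) = fubini_F leb F).
  by apply: measurable_fun_fubini_tonelli_F => // y; rewrite mule_ge0// lee_fin.
apply/funext => z; transitivity (\int[leb]_x F (z, x)); last by [].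
rewrite integral_mkcond; apply: eq_integral => x _; rewrite patchE /F /= indicE; case: ifPn => [|] xI.
  by rewrite mem_set ?mule1//; move: xI; rewrite inE /= in_itv.
by rewrite memNset ?mule0//; move: xI; rewrite notin_setE /= in_itv/=.
Qed.

Hypothesis wA : forall s t : R, (0 <= s)%R -> (s <= t)%R -> (t <= 1)%R ->
  {ae eta, forall g, (w (ev t g) - w (ev s g))%:E <= \int[leb]_(x in `[s, t]) A (g, x)}.

Lemma rational_bound_rat : {ae eta, forall g, forall c : rat,
  (0 <= ratR c <= (1 : R))%R -> rational_bound g (ratR c)}.
Proof.
have H : {ae eta, forall g, forall c : rat * rat,
    (0 <= ratR c.1 <= (1 : R))%R -> (0 <= ratR c.2 <= (1 : R))%R ->
    (ratR c.1 <= ratR c.2 :> R)%R ->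
    (w (ev (ratR c.2) g) - w (ev (ratR c.1) g))%:E <=
     \int[leb]_(x in `[ratR c.1, ratR c.2]) A (g, x)}.
  apply: ae_forall_countable => -[c c'] /=.
  have [|] := boolP [&& (0 <= ratR c <= (1 : R))%R, (0 <= ratR c' <= (1 : R))%R &
    (ratR c <= ratR c' :> R)%R]; last first.
    by move=> nH; apply: aeW => g h1 h2 h3; move: nH; rewrite h1 h2 h3.
  move=> /and3P[/andP[c0 _] /andP[_ c1] cc].
  by apply: (ae_imp (wA c0 cc c1)) => g Hg.
apply: (ae_imp H) => g Hg c c01 c' c'01; split => cc.
  exact: (Hg (c', c)).
exact: (Hg (c, c')).
Qed.

Lemma rational_bound_ae : {ae eta, forall g, {ae leb, forall r,
  (0 <= r <= 1)%R -> rational_bound g r}}.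
Proof.
have mwev (h : R -> R) : measurable_fun setT h ->
    measurable_fun setT (fun z : CX * R => w (ev (h z.2) z.1)).
  move=> mh; apply: (measurableT_comp mw).
  apply: (@measurableT_comp _ _ _ _ _ _ (fun z : CX * R => ev z.2 z.1 : borel X) _
    (fun z => (z.1, h z.2))); first exact: ev_pair_measurable.
  apply/measurable_fun_pairP; split => /=; first exact: measurable_fst.
  exact: (measurableT_comp mh measurable_snd).
(* Used with one end constant and the other the identity, in either order. *)
have bad (h1 h2 : R -> R) : measurable_fun setT h1 -> measurable_fun setT h2 ->
    (forall r, (0 <= r <= 1)%R -> (h1 r <= h2 r)%R -> (0 <= h1 r)%R /\ (h2 r <= 1)%R) ->
    {ae eta, forall g, {ae leb, forall r, (0 <= r <= 1)%R -> (h1 r <= h2 r)%R ->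
      (w (ev (h2 r) g) - w (ev (h1 r) g))%:E <=
      \int[leb]_(x in `[h1 r, h2 r]) A (g, x)}}.
  move=> mh1 mh2 h01.
  pose B : set (CX * R) := [set z | (h1 z.2 <= h2 z.2)%R] `&`
    [set z | \int[leb]_(x in `[h1 z.2, h2 z.2]) A (z.1, x) <
             (w (ev (h2 z.2) z.1) - w (ev (h1 z.2) z.1))%:E].
  have mB : measurable B.
    apply: measurableI; rewrite -[X in measurable X]setTI.
      apply: measurable_fun_ler => //; exact: (measurableT_comp _ measurable_snd).
    apply: measurable_lte => //; first exact: measurable_itv_integral.
    by apply/measurable_EFinP; apply: measurable_funB; exact: mwev.
  have B0 t : (0 <= t <= 1)%R -> {ae eta, forall g, ~ B (g, t)}.
    move=> t01; have [h12|h21] := leP (h1 t) (h2 t); last first.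
      by apply: aeW => g -[/=]; rewrite leNgt h21.
    have [h10 h21] := h01 t t01 h12.
    by apply: (ae_imp (wA h10 h12 h21)) => g Hg -[_ /=]; rewrite ltNge Hg.
  apply: (ae_imp (ae_section mB B0)) => g Hg.
  apply: (ae_imp Hg) => r Hr r01 h12; rewrite leNgt; apply/negP => bd.
  by apply: (Hr r01).
have H c : {ae eta, forall g, {ae leb, forall r, (0 <= r <= 1)%R ->
    (0 <= ratR c <= (1 : R))%R ->
    ((ratR c <= r)%R -> (w (ev r g) - w (ev (ratR c) g))%:E <=
       \int[leb]_(x in `[ratR c, r]) A (g, x)) /\
    ((r <= ratR c)%R -> (w (ev (ratR c) g) - w (ev r g))%:E <=
       \int[leb]_(x in `[r, ratR c]) A (g, x))}}.
  have [c01|nc] := boolP (0 <= ratR c <= (1 : R))%R; last first.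
    by apply: aeW => g; apply: aeW.
  have /andP[c0 c1] := c01.
  have H1 := bad (cst (ratR c)) id (@measurable_cst _ _ _ _ _ _) (@measurable_id _ _ _).
  have H2 := bad id (cst (ratR c)) (@measurable_id _ _ _) (@measurable_cst _ _ _ _ _ _).
  have {}H1 := H1 (fun r r01 _ => conj c0 (andP r01).2).
  have {}H2 := H2 (fun r r01 _ => conj (andP r01).1 c1).
  apply: (ae_imp2 H1 H2) => g H1g H2g.
  by apply: (ae_imp2 H1g H2g) => r H1r H2r r01 _; split; [exact: H1r|exact: H2r].
apply: (ae_imp (ae_forall_countable H)) => g Hg.
by apply: (ae_imp (ae_forall_countable Hg)) => r Hr r01 c; exact: Hr.
Qed.

Lemma rational_bound_chain g s t : (0 <= s)%R -> (s <= t)%R -> (t <= 1)%R ->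
  \int[leb]_(x in unit_itv R) A (g, x) < +oo ->
  rational_bound g s -> rational_bound g t ->
  (w (ev t g) - w (ev s g) <=
   itv_int (unit_restrict (fun x => A (g, x))) s t)%R.
Proof.
move=> s0 st t1 Afin Hs Ht.
have mAg : measurable_fun setT (fun x => A (g, x)).
  exact: (measurableT_comp mA (pair1_measurable g)).
have Ag0 x : 0 <= A (g, x) by [].
have iA := integrable_unit_restrict mAg Ag0 Afin.
have IE := integral_unit_restrict mAg Ag0 Afin.
have [->|sNt] := eqVneq s t; first by rewrite subrr itv_intxx.
have st' : (s < t)%R by rewrite lt_neqAle sNt.
have [c] := rat_in_itvoo st'; rewrite in_itv/= => /andP[/ltW sc /ltW ct].
have c01 : (0 <= ratR c <= (1 : R))%R by rewrite (le_trans s0 sc) (le_trans ct t1).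
have /andP[c0 c1] := c01.
have [_ /(_ sc)] := Hs c c01; rewrite IE// lee_fin => H1.
have [/(_ ct) + _] := Ht c c01; rewrite IE// lee_fin => H2.
by rewrite (itv_intD iA sc ct); move: H1 H2; lra.
Qed.

End RationalTimes.

Section CurveRepresentative.
Context {R : realType} {X : ptopologicalType}.
Local Notation leb := (@lebesgue_measure R).
Local Notation CX := (borel (curve R X)).
Local Notation ratR := (@ratr R).
Variables (d : X -> X -> \bar R) (m : {sigma_finite_measure set (borel X) -> \bar R}).
Variables (V : X -> R) (p q : R) (eta : probability CX R).
Hypotheses (sepX : separable X) (metX : completely_metrizable R X)
  (lscd : lower_semicontinuous (fun z : X * X => d z.1 z.2))
  (dA : asymmetric_extended_metric d).
Hypotheses (p1 : 1 < p) (q1 : 1 < q) (pq : p^-1 + q^-1 = 1).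
Hypotheses (mV : measurable_fun [set: borel X] V)
  (Vcompact : forall K : set X, compact K -> exists M : R, forall x, K x -> V x <= M).
Hypothesis compr : forall M : R, 0 <= M ->
  exists2 C : R, 0 <= C & forall B : set (borel X), measurable B ->
    (\int[leb]_(t in unit_itv R)
       pushforward eta (ev t : CX -> borel X) (B `&` [set x | (V x <= M)%R])
     <= C%:E * m B)%E.
Hypothesis plan : test_plan d m p eta.
Local Open Scope ereal_scope.

Let etam := plan.2.
Let p0 : (0 < p)%R. Proof. exact: lt_trans ltr01 p1. Qed.
Let q0 : (0 < q)%R. Proof. exact: lt_trans ltr01 q1. Qed.
Let mspeed sg : measurable_fun setT (speed d sg : CX * R -> \bar R).
Proof. exact: speed_measurable. Qed.
Let d0 x y : 0 <= d x y. Proof. by case: dA. Qed.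
Let speed0 sg z : 0 <= speed d sg z. Proof. exact: speed_ge0. Qed.

Let energy_ae sg : sg = 1%R \/ sg = (-1)%R -> {ae eta, forall g, energy d p sg g < +oo}.
Proof.
have ACg := plan.1.
case=> ->; apply: (ae_imp ACg) => g /(AC_speed_Lp (ltW p1) dA)[E1 E2 _].
  exact: E1.
exact: E2.
Qed.

Definition along (G : borel X -> \bar R) sg (g : curve R X) (r : R) : \bar R :=
  G (ev r g) * speed d sg (g, r).

Let malong G sg : measurable_fun setT G ->
  measurable_fun setT (fun z : CX * R => along G sg z.1 z.2).
Proof.
move=> mG; apply: emeasurable_funM.
  exact: (measurableT_comp mG (ev_pair_measurable metX)).
rewrite (_ : (fun z => _) = speed d sg); first exact: mspeed.
by apply/funext => -[].
Qed.

Let along_ge0 G sg g r : (forall z, 0 <= G z) -> 0 <= along G sg g r.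
Proof. by move=> G0; rewrite mule_ge0. Qed.

(** Over the good curves of level [K], the integral is a pairing of [G] in L^q with a density in
    L^p, hence finite; the good curves of all levels exhaust almost every curve. *)
Lemma integrable_along (G : borel X -> R) sg : sg = 1%R \/ sg = (-1)%R ->
  measurable_fun setT G -> (forall z, 0 <= G z)%R ->
  \int[m]_z (G z `^ q)%:E < +oo ->
  {ae eta, forall g, \int[leb]_(r in unit_itv R) along (EFin \o G) sg g r < +oo}.
Proof.
move=> sg1 mG G0 Gq; have mGE : measurable_fun setT (EFin \o G) by exact/measurable_EFinP.
have mI : measurable_fun setT
    (fun g : CX => \int[leb]_(r in unit_itv R) along (EFin \o G) sg g r).
  apply: (measurable_inner unit_itv_measurable (malong sg mGE)) => z.
  by apply: along_ge0 => y; rewrite lee_fin.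
have main K : {ae eta, forall g, good_curves d V p sg K g ->
    \int[leb]_(r in unit_itv R) along (EFin \o G) sg g r < +oo}.
  have mK := good_curves_measurable p metX (mspeed sg) mV K.
  have [h [mh h0 hp hE]] := plan_density metX (mspeed sg) d0 p1 q1 pq mV compr
    mK (@subset_refl _ _) unit_itv_measurable (@subset_refl _ _).
  apply: ae_lty_integral => //.
  - exact: measurable_funTS.
  - by move=> g _; apply: integral_ge0 => r _; apply: along_ge0 => y; rewrite lee_fin.
  rewrite [ltLHS](hE (EFin \o G) mGE (fun z => G0 z)).
  exact: (young_lty q0 p0 pq mG mh G0 h0 Gq hp).
apply: (ae_imp2 (energy_ae sg1) (ae_forall_countable main)) => g Eg H.
by have [K gK] := good_curves_exists Vcompact Eg; exact: H K gK.
Qed.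

(** Multiplying [w] by [sg] turns the bound for motion to the left into one for an increase from
    left to right, so that both directions share the passage to almost all times. *)
Lemma curve_rational_bound (w : borel X -> R) (G : borel X -> R) (u U : X -> R) sg :
  sg = 1%R \/ sg = (-1)%R ->
  relaxed_ascending_gradient d m q u U ->
  measurable_fun setT w -> {ae m, forall z, u z = w z} ->
  measurable_fun setT G -> {ae m, forall z, U z = G z} -> (forall z, 0 <= G z)%R ->
  let A := fun z : CX * R => along (EFin \o G) sg z.1 z.2 in
  let sw : borel X -> R := (fun x => sg * w x)%R in
  {ae eta, forall g, (forall c : rat, (0 <= ratR c <= 1)%R -> rational_bound A sw g (ratR c)) /\
    {ae leb, forall r, (0 <= r <= 1)%R -> rational_bound A sw g r}}.
Proof.
move=> sg1 uU mw uw mG UG G0 A sw; have ACae := plan.1.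
have mA : measurable_fun setT A by apply: malong; exact/measurable_EFinP.
have A0 z : 0 <= A z by apply: along_ge0 => y; rewrite lee_fin.
have msw : measurable_fun setT sw by exact: measurable_funM.
have swA s t : (0 <= s)%R -> (s <= t)%R -> (t <= 1)%R ->
    {ae eta, forall g, (sw (ev t g) - sw (ev s g))%:E <=
      \int[leb]_(x in `[s, t]) A (g, x)}.
  move=> s0 st t1.
  have s01 : (0 <= s <= 1)%R by rewrite s0 (le_trans st t1).
  have t01 : (0 <= t <= 1)%R by rewrite t1 (le_trans s0 st).
  have H x y : (0 <= x <= 1)%R -> (0 <= y <= 1)%R ->
      {ae eta, forall g, forall v : X -> R, forward_Lipschitz d v ->
        (v (ev y g) - v (ev x g))%:E <= \int[leb]_(r in `[s, t])
          (ascending_slope d v (ev r g) * speed d sg (g, r))} ->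
      {ae eta, forall g, (w (ev y g) - w (ev x g))%:E <=
        \int[leb]_(r in `[s, t]) A (g, r)}.
    move=> x01 y01 Hs.
    exact: (relaxed_gradient_curve metX (mspeed sg) dA p1 q1 pq mV Vcompact compr
      etam (energy_ae sg1) s0 t1 x01 y01 Hs uU mw uw mG UG G0).
  case: sg1 => sgE.
    have Hs := H s t s01 t01; rewrite sgE in Hs.
    have /Hs aeH : {ae eta, forall g, forall v : X -> R, forward_Lipschitz d v ->
        (v (ev t g) - v (ev s g))%:E <= \int[leb]_(r in `[s, t])
          (ascending_slope d v (ev r g) * speed d 1 (g, r))}.
      apply: (ae_imp ACae) => g ACg v vL.
      have [E1 _] := AC_slope_speed (ltW p1) dA ACg vL st; exact: E1.
    by apply: (ae_imp aeH) => g; rewrite /sw sgE !mul1r.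
  have Hs := H t s t01 s01; rewrite sgE in Hs.
  have /Hs aeH : {ae eta, forall g, forall v : X -> R, forward_Lipschitz d v ->
      (v (ev s g) - v (ev t g))%:E <= \int[leb]_(r in `[s, t])
        (ascending_slope d v (ev r g) * speed d (-1) (g, r))}.
    apply: (ae_imp ACae) => g ACg v vL.
    have [_ E2] := AC_slope_speed (ltW p1) dA ACg vL st; exact: E2.
  by apply: (ae_imp aeH) => g; rewrite /sw sgE !mulN1r opprK addrC.
have H1 := rational_bound_rat swA.
have H2 := rational_bound_ae metX mA msw A0 swA.
exact: (ae_imp2 H1 H2).
Qed.

Lemma relaxed_gradient_integrable (u U : X -> R) (G : borel X -> R) :
  relaxed_ascending_gradient d m q u U -> {ae m, forall z, U z = G z} ->
  \int[m]_z (`|G z| `^ q)%:E < +oo.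
Proof.
move=> [_ [_ /(Lq_integral m q0 U) Uq] _ _] UG; apply: le_lt_trans Uq.
apply: ae_le_integral_raw => //; [by move=> *; rewrite lee_fin powR_ge0..|].
by apply: (ae_imp UG) => z -> _.
Qed.

(** The truncations are glued along the set [E] of admissible times, and a McShane extension of the
    result from [E] is the representative. It agrees with [f0] at rational times exactly, hence at
    both ends of the curve. *)
Lemma curve_representative (f : X -> R) (f0 : borel X -> R) (U : nat -> X -> R)
    (G : nat -> borel X -> R) :
  measurable_fun setT f0 -> {ae m, forall z, f z = f0 z} ->
  (forall N, relaxed_ascending_gradient d m q (truncation N f) (U N)) ->
  (forall N, measurable_fun setT (G N)) -> (forall N z, 0 <= G N z)%R ->
  (forall N, {ae m, forall z, U N z = G N z}) ->
  let H := fun z => G (Num.bound (f0 z)) z in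
  measurable_fun setT H -> \int[m]_z (H z `^ q)%:E < +oo ->
  {ae eta, forall g,
    \int[leb]_(r in unit_itv R) along (EFin \o H) 1 g r < +oo /\
    exists u b : R -> R, [/\ integrable_fun b, forall r, (0 <= b r)%R,
      forall s t, (u t - u s <= travel (unit_restrict (along (EFin \o H) 1 g)) b s t)%R,
      forall c : rat, (0 <= ratR c <= 1)%R -> u (ratR c) = f0 (ev (ratR c) g) &
      {ae leb, forall r, (0 <= r <= 1)%R -> u r = f0 (ev r g)}]}.
Proof.
move=> mf0 ff0 UP mG G0 UG H mH Hq.
pose w N (z : borel X) : R := trunc N (f0 z).
have mw N : measurable_fun setT (w N).
  by apply: measurable_minr => //; exact: measurable_maxr.
have uw N : {ae m, forall z, truncation N f z = w N z}.
  by apply: (ae_imp ff0) => z; rewrite /truncation /w /trunc => ->.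
have Gq N : \int[m]_z (G N z `^ q)%:E < +oo.
  apply: le_lt_trans (relaxed_gradient_integrable (UP N) (UG N)).
  by apply: ae_le_integral_raw => //; [by move=> *; rewrite lee_fin powR_ge0..|
    apply: aeW => z _; rewrite ger0_norm].
have H0 z : (0 <= H z)%R by exact: G0.
pose good sg N (g : CX) := [/\
  \int[leb]_(r in unit_itv R) along (EFin \o G N) sg g r < +oo,
  forall c : rat, (0 <= ratR c <= 1)%R -> rational_bound
    (fun z : CX * R => along (EFin \o G N) sg z.1 z.2) (fun x => sg * w N x)%R g (ratR c) &
  {ae leb, forall r, (0 <= r <= 1)%R -> rational_bound
    (fun z : CX * R => along (EFin \o G N) sg z.1 z.2) (fun x => sg * w N x)%R g r}].
have goodP sg : sg = 1%R \/ sg = (-1)%R -> {ae eta, forall g, forall N, good sg N g}.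
  move=> sg1; apply: ae_forall_countable => N.
  have I1 := integrable_along sg1 (mG N) (G0 N) (Gq N).
  have I2 := curve_rational_bound sg1 (UP N) (mw N) (uw N) (mG N) (UG N) (G0 N).
  by apply: (ae_imp2 I1 I2) => g g1 [g2 g3]; split.
have sg1 : 1%R = 1%R :> R \/ 1%R = (-1)%R :> R by left.
have sgN1 : (-1)%R = 1%R :> R \/ (-1)%R = (-1)%R :> R by right.
have Hp := integrable_along sg1 mH H0 Hq; have Hn := integrable_along sgN1 mH H0 Hq.
have HH := ae_imp2 Hp Hn (fun g h1 h2 => conj h1 h2).
have GG := ae_imp2 (goodP _ sg1) (goodP _ sgN1) (fun g h1 h2 => conj h1 h2).
apply: (ae_imp2 HH GG) => g [Hpg Hng] [gp gn]; split; first exact: Hpg.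
pose rb sg N := rational_bound (fun z : CX * R => along (EFin \o G N) sg z.1 z.2)
  (fun x => sg * w N x)%R g.
(* Times admissible for all truncations and both directions. Null sets being countably many, almost
   every time qualifies, and every rational one does. *)
pose E : set R := [set r | (0 <= r <= 1)%R /\ forall N, rb 1%R N r /\ rb (-1)%R N r].
pose phi r := f0 (ev r g).
have mphi : measurable_fun setT phi.
  exact: (measurableT_comp mf0 (measurableT_comp (ev_pair_measurable metX)
    (pair1_measurable (g : CX)))).
have Erat c : (0 <= ratR c <= 1)%R -> E (ratR c).
  move=> c01; split => // N; have [_ h1 _] := gp N; have [_ h2 _] := gn N.
  by split; [exact: h1|exact: h2].
have Eae : {ae leb, forall r, (0 <= r <= 1)%R -> E r}.
  have K N : {ae leb, forall r, (0 <= r <= 1)%R -> rb 1%R N r /\ rb (-1)%R N r}.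
    have [_ _ h1] := gp N; have [_ _ h2] := gn N.
    by apply: (ae_imp2 h1 h2) => r h1r h2r r01; split; [exact: h1r|exact: h2r].
  by apply: (ae_imp (ae_forall_countable K)) => r Kr r01; split => // N; exact: Kr.
have mal (F : borel X -> R) sg : measurable_fun setT F ->
    measurable_fun setT (along (EFin \o F) sg g).
  move=> mF; have mFE : measurable_fun setT (EFin \o F) by exact/measurable_EFinP.
  exact: (measurableT_comp (malong sg mFE) (pair1_measurable (g : CX))).
have al0 (F : borel X -> R) sg r : (forall z, 0 <= F z)%R -> 0 <= along (EFin \o F) sg g r.
  by move=> F0; apply: along_ge0 => z; rewrite lee_fin.
pose a sg N := unit_restrict (along (EFin \o G N) sg g).
have ia sg N : \int[leb]_(r in unit_itv R) along (EFin \o G N) sg g r < +oo ->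
    integrable_fun (a sg N).
  by move=> fin; apply: integrable_unit_restrict => //; [exact: mal|move=> r; exact: al0].
have a0 sg N r : (0 <= a sg N r)%R.
  by apply: unit_restrict_ge0 => x; exact: al0.
have iaH sg : \int[leb]_(r in unit_itv R) along (EFin \o H) sg g r < +oo ->
    integrable_fun (unit_restrict (along (EFin \o H) sg g)).
  by move=> fin; apply: integrable_unit_restrict => //; [exact: mal|move=> r; exact: al0].
(* Choosing the truncation by the value of [f0] at the current point is the same in the space, as in
   [H], and along the curve, as in [glue_truncations]. *)
have aHE sg : (fun r => a sg (Num.bound (phi r)) r) =
    unit_restrict (along (EFin \o H) sg g).
  by apply/funext => r; rewrite /a /unit_restrict !patchE.
have chain s t : E s -> E t -> (phi t - phi s <= travel
    (unit_restrict (along (EFin \o H) 1 g)) (unit_restrict (along (EFin \o H) (-1) g)) s t)%R.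
  have E01 r : E r -> (0 <= r <= 1)%R by case.
  have step sg N s1 t1 : sg = 1%R \/ sg = (-1)%R -> (s1 <= t1)%R -> E s1 -> E t1 ->
      \int[leb]_(r in unit_itv R) along (EFin \o G N) sg g r < +oo ->
      (sg * w N (ev t1 g) - sg * w N (ev s1 g) <= itv_int (a sg N) s1 t1)%R.
    move=> sgE st [/andP[s0 _] Es] [/andP[_ t1'] Et] fin.
    have mA : measurable_fun setT (fun z : CX * R => along (EFin \o G N) sg z.1 z.2).
      by apply: malong; exact/measurable_EFinP.
    have A0 (z : CX * R) : 0 <= along (EFin \o G N) sg z.1 z.2.
      by apply: along_ge0 => y; rewrite lee_fin.
    have rs : rb sg N s1 by case: sgE => ->; [exact: (Es N).1|exact: (Es N).2].
    have rt : rb sg N t1 by case: sgE => ->; [exact: (Et N).1|exact: (Et N).2].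
    exact: (rational_bound_chain mA A0 s0 st t1' fin rs rt).
  rewrite -!aHE; apply: glue_truncations => //.
  - by move=> N; apply: ia; case: (gp N).
  - by move=> N; apply: ia; case: (gn N).
  - move=> N s1 t1 Es Et; rewrite /travel; case: ifPn => st.
      have [fin _ _] := gp N.
      by have := step 1%R N s1 t1 sg1 st Es Et fin; rewrite !mul1r.
    have [fin _ _] := gn N.
    have ts : (t1 <= s1)%R by rewrite ltW// ltNge.
    by have := step (-1)%R N t1 s1 sgN1 ts Et Es fin; rewrite !mulN1r opprK addrC.
  - by rewrite aHE; exact: iaH.
  - by rewrite aHE; exact: iaH.
have E0 : E !=set0.
  by exists (ratR 0); apply: Erat; rewrite rmorph0 lexx ler01.
have [u uE ub] := McShane_extension (iaH _ Hpg) (iaH _ Hng)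
  (unit_restrict_ge0 (fun r => al0 H 1%R r H0))
  (unit_restrict_ge0 (fun r => al0 H (-1)%R r H0)) E0 chain.
exists u, (unit_restrict (along (EFin \o H) (-1) g)); split.
- exact: iaH.
- by apply: unit_restrict_ge0 => r; exact: al0.
- exact: ub.
- by move=> c /Erat /uE.
- by apply: (ae_imp Eae) => r Er /Er /uE.
Qed.

End CurveRepresentative.

(** * Weak upper gradients *)

Section AffineChange.
Context {R : realType}.
Local Notation leb := (@lebesgue_measure R).
Variables (a c : R).
Hypothesis c0 : 0 < c.
Local Open Scope ereal_scope.

Let phi (x : R) : R := (a + c * x)%R.
Let mphi : measurable_fun setT phi.
Proof. by apply: measurable_funD => //; exact: measurable_funM. Qed.

Let W : R -> \bar R := cst c%:E.
Let mW : measurable_fun setT W. Proof. exact: measurable_cst. Qed.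
Let W0 x : 0 <= W x. Proof. by rewrite lee_fin ltW. Qed.

Let mphi' : measurable_fun setT (phi : R -> measurableTypeR R). Proof. exact: mphi. Qed.

(** Both measures agree on half-open intervals, which determine Lebesgue measure. *)
Lemma lebesgue_measure_affine (B : set R) : measurable B ->
  leb B = image_density leb mW W0 mphi B.
Proof.
move=> mB.
pose nu : {measure set (measurableTypeR R) -> \bar R} := image_density leb mW W0 mphi'.
suff H X : ocitv X -> leb X = nu X by exact: (lebesgue_measure_unique H mB).
move=> [[x y]] _ <-; rewrite /=.
rewrite [RHS](_ : _ = \int[leb]_(z in phi @^-1` `]x, y]) W z)//.
have -> : phi @^-1` `]x, y] = `]((x - a) / c)%R, ((y - a) / c)%R]%classic.
  apply/seteqP; split => z /=; rewrite !in_itv/= /phi => /andP[h1 h2]; apply/andP; split.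
  - by rewrite ltr_pdivrMr// ltrBlDl mulrC.
  - by rewrite ler_pdivlMr// lerBrDl mulrC.
  - by move: h1; rewrite ltr_pdivrMr// ltrBlDl mulrC.
  - by move: h2; rewrite ler_pdivlMr// lerBrDl mulrC.
rewrite integral_cst//= !lebesgue_measure_itv/= !lte_fin ltr_pM2r ?invr_gt0// ltrD2r.
case: ifPn => _; last by rewrite mule0.
rewrite -!EFinB -EFinM; congr EFin.
by rewrite -mulrBl mulrC mulfVK ?gt_eqF// opprB addrA subrK.
Qed.

Let indicE_affine (B : set R) : measurable B ->
  \int[leb]_x ((\1_B (phi x))%:E * W x) = \int[leb]_x ((\1_B x)%:E * cst 1 x).
Proof.
move=> mB; transitivity (leb B).
  rewrite lebesgue_measure_affine// /image_density/= [RHS]integral_mkcond.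
  apply: eq_integral => x _; rewrite patchE indicE.
  have [h|h] := pselect (B (phi x)); first by rewrite !mem_set// mul1e.
  by rewrite !memNset// mul0e.
transitivity (\int[leb]_x (\1_B x)%:E); first by rewrite integral_indic// setIT.
by apply: eq_integral => x _; rewrite mule1.
Qed.

Lemma integral_affine (k : R -> \bar R) : measurable_fun setT k ->
  (forall x, 0 <= k x) -> \int[leb]_x (k (a + c * x)%R * c%:E) = \int[leb]_x k x.
Proof.
move=> mk k0; transitivity (\int[leb]_x (k x * cst 1 x)); last first.
  by apply: eq_integral => x _; rewrite mule1.
apply/eqP; rewrite eq_le; apply/andP; split.
  apply: (@le_integral_comp _ _ _ _ _ _ _ leb leb setT setT W (cst 1) phi id) => //.
  by move=> B mB; rewrite indicE_affine.
apply: (@le_integral_comp _ _ _ _ _ _ _ leb leb setT setT (cst 1) W id phi) => //.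
by move=> B mB; rewrite -indicE_affine.
Qed.

Lemma negligible_affine (P : R -> Prop) : {ae leb, forall x, P x} ->
  {ae leb, forall x, P (a + c * x)%R}.
Proof.
move=> [N [mN N0 PN]]; exists (phi @^-1` N); split.
- by rewrite -[X in measurable X]setTI; exact: mphi.
- have := lebesgue_measure_affine mN; rewrite N0 /image_density/= integral_cst//=.
    by move=> /esym/eqP; rewrite mule_eq0 eqe gt_eqF//= => /eqP.
  by rewrite -[X in measurable X]setTI; exact: mphi.
- by move=> x /= /PN.
Qed.

Lemma integral_unit_affine (k : R -> \bar R) : measurable_fun setT k ->
  (forall x, 0 <= k x) -> \int[leb]_(x in unit_itv R) (k (a + c * x)%R * c%:E) =
  \int[leb]_(x in `[a, (a + c)%R]) k x.
Proof.
move=> mk k0.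
have mD : measurable (`[a, (a + c)%R]%classic : set R) by exact: measurable_itv.
rewrite [RHS]integral_mkcond -(integral_affine (k := k \_ `[a, (a + c)%R])).
- rewrite [LHS]integral_mkcond; apply: eq_integral => x _; rewrite !patchE.
  have -> : (a + c * x \in `[a, (a + c)%R]%classic)%R = (x \in unit_itv R).
    rewrite /unit_itv !mem_setE !in_itv/= lerDl lerD2l.
    by rewrite pmulr_rge0// -{2}[c]mulr1 ler_pM2l.
  by case: ifP => // _; rewrite mul0e.
- exact/(measurable_restrictT _ mD)/measurable_funTS.
- by move=> x; rewrite patchE; case: ifP.
Qed.

End AffineChange.

(** Continuity of [u] extends the bound to real times: rational times slightly inside the interval
    cost little on the left, and nothing on the right as [k >= 0]. Differentiation then compares the
    densities. *)
Lemma le_density_of_rational_bound (R : realType) (u w k : R -> R) :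
  continuous u -> {ae (@lebesgue_measure R), forall x, has_deriv u x (w x)} ->
  integrable_fun k -> (forall x, 0 <= k x) ->
  (forall c c' : rat, 0 <= @ratr R c -> @ratr R c < ratr c' -> @ratr R c' <= 1 ->
    u (ratr c') - u (ratr c) <= itv_int k (ratr c) (ratr c')) ->
  {ae (@lebesgue_measure R), forall x, 0 < x < 1 -> w x <= k x}.
Proof.
move=> cu du ik k0 H.
have Hreal s t : 0 < s -> s < t -> t < 1 -> u t - u s <= itv_int k s t.
  move=> s0 st t1; apply/ler_addgt0Pr => e e0.
  have e2 : 0 < e / 2 by rewrite divr_gt0.
  have /cvgrPdist_lt/(_ _ e2)[ds /= ds0 Hs] := cu s.
  have /cvgrPdist_lt/(_ _ e2)[dt /= dt0 Ht] := cu t.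
  (* Taking the two rationals on either side of the midpoint keeps them in order. *)
  pose mid := (s + t) / 2.
  have [smid midt] : s < mid /\ mid < t by rewrite midf_lt// midf_lt.
  have [c] : exists c : rat, ratr c \in `]s, Num.min mid (s + ds)[.
    by apply: rat_in_itvoo; rewrite lt_min smid ltrDl.
  rewrite in_itv/= lt_min => /and3P[sc cm cds].
  have [c'] : exists c : rat, ratr c \in `]Num.max mid (t - dt), t[.
    by apply: rat_in_itvoo; rewrite gt_max midt gtrBl.
  rewrite in_itv/= gt_max => /andP[/andP[mc' dtc'] c't].
  have Hc : `|u s - u (ratr c)| < e / 2.
    by apply: Hs; rewrite /= distrC gtr0_norm ?subr_gt0// ltrBlDl.
  have Hc' : `|u t - u (ratr c')| < e / 2.
    by apply: Ht; rewrite /= gtr0_norm ?subr_gt0// ltrBlDr -ltrBlDl.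
  have cc' : @ratr R c < ratr c' by exact: lt_trans mc'.
  have := H c c' (ltW (lt_trans s0 sc)) cc' (ltW (lt_trans c't t1)).
  have := itv_int_sub ik k0 (ltW sc) (ltW cc') (ltW c't).
  have aux (a b x y z I J : R) : `|x - y| < e / 2 -> `|a - b| < e / 2 ->
      I <= J -> b - y <= I -> a - x <= J + e.
    by rewrite !ltr_norml => /andP[? ?] /andP[? ?] ? ?; lra.
  exact: (aux _ _ _ _ 0 _ _ Hc Hc').
have dk := itv_int_deriv ik (fun s t => @primitiveB _ k s t ik).
apply: (ae_imp2 du dk) => x dux dkx /andP[x0 x1].
have x10 : 0 < 1 - x by rewrite subr_gt0.
apply: (le_has_deriv dux dkx x10) => h /andP[h0 h1].
have xh : x < x + h by rewrite ltrDl.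
by rewrite (primitiveB ik (ltW xh)) Hreal// -ltrBrDl.
Qed.

(** Over any [G] the integral of [b] is at most that of [a], because over the complement it is at
    least that of [a] and the totals are finite. *)
Lemma ae_le_of_integral_ge d (T : measurableType d) (R : realType)
    (mu : {measure set T -> \bar R}) (a b : T -> \bar R) :
  measurable_fun setT a -> measurable_fun setT b ->
  (forall x, 0 <= a x)%E -> (forall x, a x <= b x)%E ->
  (\int[mu]_x b x <= \int[mu]_x a x)%E -> (\int[mu]_x a x < +oo)%E ->
  {ae mu, forall x, setT x -> (b x <= a x)%E}.
Proof.
move=> ma mb a0 ab ba afin.
have b0 x : (0 <= b x)%E by exact: le_trans (ab x).
apply: ae_le_of_le_integral => // G mG _.
have split_int (h : T -> \bar R) : measurable_fun setT h -> (forall x, 0 <= h x)%E ->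
    (\int[mu]_x h x = \int[mu]_(x in G) h x + \int[mu]_(x in ~` G) h x)%E.
  move=> mh h0; rewrite -(setUv G) ge0_integral_setU//.
  - exact: measurableC.
  - by rewrite setUv.
  - by rewrite disj_set2E setICr.
have fin : (\int[mu]_(x in ~` G) a x \is a fin_num)%E.
  rewrite ge0_fin_numE; last exact: integral_ge0.
  apply: le_lt_trans afin; rewrite (split_int a)// leeDr//; exact: integral_ge0.
rewrite -(leeD2rE _ _ fin) -split_int//; apply: le_trans ba.
rewrite (split_int b)//; apply: leeD2l; apply: ae_le_integral_raw => //.
- exact: measurableC.
- exact: aeW.
Qed.

Section StretchedCurves.
Context {R : realType} {X : ptopologicalType}.
Local Notation leb := (@lebesgue_measure R).
Local Notation CX := (borel (curve R X)).
Variables (d : X -> X -> \bar R).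
Local Open Scope ereal_scope.

Lemma forward_speed_ge0 (g : curve R X) s : (forall x y, 0 <= d x y) ->
  0 <= forward_speed d g s.
Proof.
move=> d0; rewrite /forward_speed.
(* Where the limit does not exist, [lim] is a nonnegative default value. *)
set F := (X in lim X); have [cF|/dvgP ->//] := pselect (cvg F).
apply: lime_ge => //; near=> h; rewrite mule_ge0// lee_fin invr_ge0.
by apply: ltW; near: h; exact: nbhs_right_gt.
Unshelve. all: by end_near. Qed.

(** At [s = 1] the stretched curve rests at its end point while [g] may go on, so [s < 1] leaves
    room for a motion to the right. *)
Lemma forward_speed_stretch (g : curve R X) (t1 t2 s : R) : (t1 < t2)%R ->
  (0 <= s < 1)%R ->
  let r := (t1 + (t2 - t1) * s)%R in
  d (ev r g) (ev (r + h) g) * (h^-1)%:E @[h --> 0%R^'+] --> speed d 1 (g, r) ->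
  forward_speed d (stretch t1 t2 g) s = speed d 1 (g, r) * (t2 - t1)%:E.
Proof.
move=> t12 /andP[s0 s1] r cvr; have c0 : (0 < t2 - t1)%R by rewrite subr_gt0.
rewrite /forward_speed; apply/cvg_lim => //.
have cmul : ((t2 - t1) * h)%R @[h --> 0%R^'+] --> 0%R^'+.
  move=> A [e /= e0 HA]; exists (e / (t2 - t1))%R; first by rewrite /= divr_gt0.
  move=> h /= he h0; apply: HA; last by rewrite mulr_gt0.
  move: he; rewrite /= !sub0r !normrN !gtr0_norm ?mulr_gt0//.
  by rewrite ltr_pdivlMr// mulrC.
have fc : (t2 - t1)%:E \is a fin_num by [].
have := cvgeZr fc (cvg_comp _ _ cmul cvr).
apply: cvg_trans; apply: near_eq_cvg; near=> h.
have h0 : (0 < h)%R by near: h; exact: nbhs_right_gt.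
have h1 : (h < 1 - s)%R by near: h; apply: nbhs_right_lt; rewrite subr_gt0.
have evE (y : R) : (0 <= y <= 1)%R ->
    ev y (stretch t1 t2 g) = ev (t1 + (t2 - t1) * y)%R g.
  by move=> y01; rewrite ev_stretch//; congr ev; ring.
rewrite !evE ?s0 ?(ltW s1)//; last first.
  by rewrite addr_ge0 ?(ltW h0)//= -lerBrDl ltW.
rewrite /= mulrDr addrA -/r -muleA -EFinM; congr (_ * _%:E).
by rewrite invfM mulrAC mulVf ?gt_eqF// mul1r.
Unshelve. all: by end_near. Qed.

End StretchedCurves.

Section WeakUpperGradients.
Context {R : realType} {X : ptopologicalType}.
Local Notation leb := (@lebesgue_measure R).
Local Notation CX := (borel (curve R X)).
Local Notation ratR := (@ratr R).
Variables (d : X -> X -> \bar R) (m : {measure set (borel X) -> \bar R}) (p : R)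
  (T : set (probability (borel (curve R X)) R)) (f : X -> R).
Hypotheses (sepX : separable X) (metX : completely_metrizable R X)
  (lscd : lower_semicontinuous (fun z : X * X => d z.1 z.2))
  (dA : asymmetric_extended_metric d) (p1 : 1 <= p).
Hypothesis plan : forall eta, T eta -> test_plan d m p eta.
Local Open Scope ereal_scope.
Implicit Types (G : borel X -> \bar R) (g : curve R X).

Let d0 x y : 0 <= d x y. Proof. by case: dA. Qed.
Let along_ge0 G g r : (forall z, 0 <= G z) -> 0 <= along d G 1 g r.
Proof. by move=> G0; rewrite mule_ge0// speed_ge0. Qed.
Let mspeed : measurable_fun setT (speed d 1 : CX * R -> \bar R).
Proof. exact: speed_measurable. Qed.

Lemma measurable_along G g : measurable_fun setT G -> measurable_fun setT (along d G 1 g).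
Proof.
move=> mG; apply: emeasurable_funM.
  apply: (measurableT_comp mG).
  exact: (measurableT_comp (ev_pair_measurable metX) (pair1_measurable (g : CX))).
exact: (measurableT_comp mspeed (pair1_measurable (g : CX))).
Qed.

Lemma weak_forward_upper_gradient_ae G G' :
  weak_forward_upper_gradient d m T f G ->
  completed_measurable_fun m G' -> (forall z, 0 <= G' z) ->
  {ae m, forall z, G z = G' z} -> weak_forward_upper_gradient d m T f G'.
Proof.
move=> [_ G0 wG] mG' G'0 GG'; split => // eta Teta.
have [ACg etam] := plan Teta.
apply: (ae_imp2 (wG eta Teta) (ae_imp2 (ae_time metX etam GG') ACg (fun g h1 h2 => conj h1 h2))).
move=> g /= Hg [aeg _].
have -> // : \int[leb]_(s in unit_itv R) (G' (ev s g) * forward_speed d g s) =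
  \int[leb]_(s in unit_itv R) (G (ev s g) * forward_speed d g s).
apply: ae_eq_integral_raw => //.
- exact: unit_itv_measurable.
- by move=> s _; rewrite mule_ge0// forward_speed_ge0.
- by move=> s _; rewrite mule_ge0// forward_speed_ge0.
by apply: (ae_imp aeg) => s; rewrite /unit_itv /= in_itv/= => /[apply] /contrapT ->.
Qed.

Let forward_speedE eta : T eta -> {ae eta, forall g, {ae leb, forall s,
  forward_speed d g s = speed d 1 (g, s)}}.
Proof.
move=> Teta; have [ACg _] := plan Teta.
apply: (ae_imp ACg) => g /(AC_speed_Lp p1 dA)[_ _ cvs].
by apply: (ae_imp cvs) => s /cvg_lim; apply.
Qed.

(** It replaces [forward_speed], a limit taken curve by curve, by the jointly measurable [speed];
    the two agree at almost every time of an absolutely continuous curve. *)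
Lemma weak_forward_upper_gradient_along G : measurable_fun setT G -> (forall z, 0 <= G z) ->
  (weak_forward_upper_gradient d m T f G <-> forall eta, T eta -> {ae eta, forall g,
    (f (ev 1 g) - f (ev 0 g))%:E <= \int[leb]_(r in unit_itv R) along d G 1 g r /\
    \int[leb]_(r in unit_itv R) along d G 1 g r < +oo}).
Proof.
move=> mG G0.
have E eta : T eta -> {ae eta, forall g,
    \int[leb]_(s in unit_itv R) (G (ev s g) * forward_speed d g s) =
    \int[leb]_(r in unit_itv R) along d G 1 g r}.
  move=> Teta; apply: (ae_imp (forward_speedE Teta)) => g fs.
  apply: ae_eq_integral_raw.
  - exact: unit_itv_measurable.
  - by move=> s _; rewrite mule_ge0// forward_speed_ge0.
  - by move=> s _; exact: along_ge0.
  - by apply: (ae_imp fs) => s -> _.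
split=> [[_ _ H] eta Teta|H].
  by apply: (ae_imp2 (H eta Teta) (E eta Teta)) => g /= + Eg; rewrite Eg.
split => //; first by apply: (ae_completed_measurable_fun mG); exact: aeW.
move=> eta Teta.
by apply: (ae_imp2 (H eta Teta) (E eta Teta)) => g /= + Eg; rewrite Eg.
Qed.

Hypothesis stretchT : stretchable T.

(** The defining inequality is applied to the plan of stretched curves: its exceptional set pulls
    back to a null set of [eta], and the factor [t2 - t1] in the speed is the Jacobian of the change
    of time. *)
Lemma weak_forward_upper_gradient_itv G eta (t1 t2 : R) : measurable_fun setT G ->
  weak_forward_upper_gradient d m T f G -> T eta ->
  (0 <= t1)%R -> (t1 < t2)%R -> (t2 <= 1)%R ->
  {ae eta, forall g,
    (f (ev t2 g) - f (ev t1 g))%:E <= \int[leb]_(r in `[t1, t2]) along d G 1 g r /\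
    \int[leb]_(r in `[t1, t2]) along d G 1 g r < +oo}.
Proof.
move=> mG [_ G0 wG] Teta t10 t12 t21.
have c0 : (0 < t2 - t1)%R by rewrite subr_gt0.
have [eta' Teta' eta'E] := stretchT Teta t10 (ltW t12) t21.
have [ACg _] := plan Teta.
have strE : {ae eta, forall g, let g' := stretch t1 t2 g in
    let I := \int[leb]_(s in unit_itv R) (G (ev s g') * forward_speed d g' s) in
    (f (ev 1 g') - f (ev 0 g'))%:E <= I /\ I < +oo}.
  have [N [mN N0 HN]] := wG eta' Teta'.
  exists ((stretch t1 t2 : CX -> CX) @^-1` N); split.
  - by rewrite -[X in measurable X]setTI; exact: (@stretch_measurable R X t1 t2 measurableT N mN).
  - by have := eta'E N mN; rewrite N0 => /esym.
  - by move=> g /= nH; apply: HN.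
apply: (ae_imp2 strE ACg) => g + /(AC_speed_Lp p1 dA)[_ _ cvs].
have evE (y : R) : (0 <= y <= 1)%R ->
    ev y (stretch t1 t2 g) = ev (t1 + (t2 - t1) * y)%R g.
  by move=> y01; rewrite ev_stretch//; congr ev; ring.
cbv zeta; rewrite !evE ?lexx ?ler01// mulr1 mulr0 addr0 [(t1 + (t2 - t1))%R]addrC subrK.
have -> // : \int[leb]_(s in unit_itv R)
    (G (ev s (stretch t1 t2 g)) * forward_speed d (stretch t1 t2 g) s) =
  \int[leb]_(r in `[t1, t2]) along d G 1 g r.
transitivity (\int[leb]_(s in unit_itv R)
    (along d G 1 g (t1 + (t2 - t1) * s)%R * (t2 - t1)%:E)); last first.
  rewrite (integral_unit_affine t1 c0 (measurable_along g mG)).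
    by rewrite addrC subrK.
  by move=> r; exact: along_ge0.
have ae1 : {ae leb, forall s : R, s <> 1%R}.
  exists [set 1%R]; split; [exact: measurable_set1|exact: lebesgue_measure_set1|].
  by move=> s /= /contrapT.
apply: ae_eq_integral_raw.
- exact: unit_itv_measurable.
- by move=> s _; rewrite mule_ge0// forward_speed_ge0.
- by move=> s _; rewrite mule_ge0 ?lee_fin ?(ltW c0)//; exact: along_ge0.
apply: (ae_imp2 ae1 (negligible_affine t1 c0 cvs)) => s s1 cs sU.
have /andP[s0 s1'] : (0 <= s <= 1)%R by move: sU; rewrite /unit_itv /= in_itv.
have s01 : (0 <= s < 1)%R by rewrite s0 lt_neqAle s1' andbT; apply/eqP.
by rewrite (forward_speed_stretch t12 s01 cs) evE ?s0// /along muleA.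
Qed.

(** Agreement at rational times is all that is asked: [u] is continuous, so increments between
    rational times control its derivative. *)
Definition rational_representative (phi : R -> R) := exists u a b : R -> R,
  [/\ integrable_fun a /\ integrable_fun b,
      (forall r, 0 <= a r)%R /\ (forall r, 0 <= b r)%R,
      forall s t, (u t - u s <= travel a b s t)%R &
      forall c : rat, (0 <= ratR c <= 1)%R -> u (ratR c) = phi (ratR c)].

Hypothesis representative : forall eta, T eta ->
  {ae eta, forall g, rational_representative (fun r => f (ev r g))}.

Let mspeedg g : measurable_fun setT (fun r => speed d 1 (g, r)).
Proof. exact: (measurableT_comp mspeed (pair1_measurable (g : CX))). Qed.

Let speed_lty eta : T eta -> {ae eta, forall g, {ae leb, forall r,
  (0 <= r <= 1)%R -> speed d 1 (g, r) < +oo}}.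
Proof.
move=> Teta; have [ACg _] := plan Teta.
apply: (ae_imp ACg) => g /(AC_speed_Lp p1 dA)[spp _ _].
have mpw : measurable_fun setT (fun r => speed d 1 (g, r) `^ p).
  exact: (measurableT_comp (measurable_poweR p) (mspeedg g)).
have H : {ae leb, forall r, unit_itv R r -> speed d 1 (g, r) `^ p < +oo}.
  apply: ae_lty_integral => //; first exact: unit_itv_measurable.
    exact: measurable_funTS.
  by move=> r _; exact: poweR_ge0.
apply: (ae_imp H) => r; rewrite /unit_itv /= in_itv/= => /[apply].
by apply: lty_poweRy; rewrite gt_eqF// (lt_le_trans ltr01).
Qed.

(* The density of the representative of [f] is bounded by each [Gs n] times the
   speed, hence by the infimum. *)
Lemma weak_forward_upper_gradient_inf (Gs : nat -> borel X -> \bar R) :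
  (forall n, measurable_fun setT (Gs n)) ->
  (forall n, weak_forward_upper_gradient d m T f (Gs n)) ->
  weak_forward_upper_gradient d m T f (fun z => einfs (Gs ^~ z) 0%N).
Proof.
move=> mG wG; pose G z := einfs (Gs ^~ z) 0%N.
have mGi : measurable_fun setT G by exact: measurable_fun_einfs.
have Gs0 n z : 0 <= Gs n z by have [_ ->] := wG n.
have G0 z : 0 <= G z by apply: le_ereal_inf_tmp => _ [n _ <-].
have G_le n z : G z <= Gs n z by apply: ereal_inf_lbound; exists n.
apply/weak_forward_upper_gradient_along => // eta Teta.
have itvG : {ae eta, forall g, forall x : nat * (rat * rat), let: (n, (c, c')) := x in
    (0 <= ratR c)%R -> (ratR c < ratR c')%R -> (ratR c' <= 1)%R ->
    (f (ev (ratR c') g) - f (ev (ratR c) g))%:E <=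
      \int[leb]_(r in `[ratR c, ratR c']) along d (Gs n) 1 g r /\
    \int[leb]_(r in `[ratR c, ratR c']) along d (Gs n) 1 g r < +oo}.
  apply: ae_forall_countable => -[n [c c']].
  have [/and3P[h1 h2 h3]|nh] :=
      boolP [&& (0 <= ratR c)%R, (ratR c < ratR c')%R & (ratR c' <= 1)%R].
    by apply: (ae_imp (weak_forward_upper_gradient_itv (mG n) (wG n) Teta h1 h2 h3)).
  by apply: aeW => g h1 h2 h3; move: nh; rewrite h1 h2 h3.
apply: (ae_imp3 itvG (representative Teta) (speed_lty Teta)) => g Hg rep sp.
have [u [a [b [[ia ib] [a0 b0] ub uE]]]] := rep.
have uabs := travel_norm ia ib a0 b0 ub.
have iab := integrable_funD ia ib.
have cu := continuous_of_itv_int iab uabs.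
have ab0 x : (0 <= a x + b x)%R by rewrite addr_ge0.
have [||w [iw wE dw]] := @has_deriv_of_itv_int _ _ _ u iab iab ab0 ab0.
- by move=> s t st; apply: le_trans (uabs _ _ st); exact: ler_norm.
- by move=> s t st; apply: le_trans (uabs _ _ st); rewrite distrC; exact: ler_norm.
have rat01 : [/\ (0 <= ratR 0)%R, (ratR 0 < ratR 1)%R, (ratR 1 <= 1)%R,
    ratR 0 = 0%R & ratR 1 = 1%R] by rewrite rmorph0 rmorph1 lexx ltr01 lexx.
have [r0 r1 r2 R0 R1] := rat01.
pose A n := along d (Gs n) 1 g.
have A0 n r : 0 <= A n r by exact: along_ge0.
have mA n : measurable_fun setT (A n) by exact: measurable_along.
have Afin n : \int[leb]_(r in unit_itv R) A n r < +oo.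
  by have [_] := Hg (n, (0%R, 1%R)) r0 r1 r2; rewrite R0 R1.
have ik n := integrable_unit_restrict (mA n) (A0 n) (Afin n).
have wk n : {ae leb, forall r, (0 < r < 1)%R -> (w r <= unit_restrict (A n) r)%R}.
  apply: (le_density_of_rational_bound cu dw (ik n)).
    exact: unit_restrict_ge0.
  move=> c c' c0 cc' c1; have [Hle _] := Hg (n, (c, c')) c0 cc' c1.
  rewrite uE ?(le_trans c0 (ltW cc'))// uE ?c0 ?(le_trans (ltW cc'))//.
  by rewrite -lee_fin -integral_unit_restrict// ltW.
have mAi : measurable_fun setT (along d G 1 g) by exact: measurable_along.
have Ai0 r : 0 <= along d G 1 g r by exact: along_ge0.
have Aifin : \int[leb]_(r in unit_itv R) along d G 1 g r < +oo.
  apply: le_lt_trans (Afin 0%N); apply: ae_le_integral_raw => //.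
    exact: unit_itv_measurable.
  by apply: aeW => r _; apply: lee_wpmul2r => //; exact: speed_ge0.
have iki := integrable_unit_restrict mAi Ai0 Aifin.
split; last exact: Aifin.
have unitE (r : R) : unit_itv R r = (0 <= r <= 1)%R :> Prop by rewrite /unit_itv /= in_itv.
(* The time [1], which belongs to the half-open interval of [itv_int], is discarded as a null
   set. *)
have wki : {ae leb, forall r, (0 < r <= 1)%R -> (w r <= unit_restrict (along d G 1 g) r)%R}.
  have ae1 : {ae leb, forall s : R, s <> 1%R}.
    exists [set 1%R]; split; [exact: measurable_set1|exact: lebesgue_measure_set1|].
    by move=> s /= /contrapT.
  have aeA := ae_forall_countable (fun n => unit_restrict_ae (mA n) (A0 n) (Afin n)).
  have aeAi := unit_restrict_ae mAi Ai0 Aifin.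
  have h1 := ae_imp3 ae1 aeA aeAi (fun r x1 x2 x3 => And3 x1 x2 x3).
  apply: (ae_imp3 h1 (ae_forall_countable wk) sp) => r [rN1 rA rAi] wr spr /andP[r_0 r_1].
  have r01 : (0 <= r <= 1)%R by rewrite ltW.
  have r01' : (0 < r < 1)%R by rewrite r_0 lt_neqAle r_1 andbT; apply/eqP.
  have rU : unit_itv R r by rewrite unitE.
  rewrite -lee_fin rAi//.
  have wn n : (w r)%:E <= Gs n (ev r g) * speed d 1 (g, r).
    by rewrite -[leRHS]/(A n r) -rA// lee_fin wr.
  have := spr r01; have := @speed_ge0 R X d 1 (g, r) d0; rewrite /along.
  (* Where the speed vanishes all products are [0]; where it is a positive real [v], dividing by [v]
     lets the infimum be taken. *)
  case: (speed d 1 (g, r)) wn => [v| |]// wn; rewrite lee_fin le_eqVlt => /predU1P[v0|v0] _.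
    by have := wn 0%N; rewrite -v0 !mule0.
  rewrite -lee_pdivrMr//; apply: le_ereal_inf_tmp => _ [n _ <-].
  by rewrite lee_pdivrMr.
rewrite -[f (ev 1 g)]/((fun r => f (ev r g)) 1%R) -[f (ev 0 g)]/((fun r => f (ev r g)) 0%R).
rewrite -{1}R1 -{1}R0 -!uE ?R1 ?R0 ?ler01 ?lexx//.
rewrite wE// [leRHS](integral_unit_restrict mAi Ai0 Aifin)// lee_fin.
exact: le_itv_int.
Qed.

Lemma weak_forward_upper_gradient_min G G' :
  measurable_fun setT G -> measurable_fun setT G' ->
  weak_forward_upper_gradient d m T f G -> weak_forward_upper_gradient d m T f G' ->
  exists M : borel X -> \bar R, [/\ measurable_fun setT M, weak_forward_upper_gradient d m T f M,
    forall z, M z <= G z & forall z, M z <= G' z].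
Proof.
move=> mG mG' wG wG'; pose Gs n := if n is 0%N then G else G'.
exists (fun z => einfs (Gs ^~ z) 0%N); split.
- by apply: measurable_fun_einfs => -[].
- by apply: weak_forward_upper_gradient_inf => -[].
- by move=> z; apply: ereal_inf_lbound; exists 0%N.
- by move=> z; apply: ereal_inf_lbound; exists 1%N.
Qed.

(** The pointwise infimum of a minimizing sequence is again a weak upper gradient, so the least
    energy is attained. [H] makes this energy finite, which is what turns least energy into
    minimality almost everywhere. *)
Lemma minimal_weak_forward_upper_gradient_exists (q : R) (H : borel X -> \bar R) :
  (0 < q)%R -> measurable_fun setT H -> weak_forward_upper_gradient d m T f H ->
  \int[m]_z (H z `^ q) < +oo ->
  exists G, minimal_weak_forward_upper_gradient d m T f G.
Proof.
move=> q0 mH wH Hq.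
pose W : set (borel X -> \bar R) :=
  [set G : borel X -> \bar R | measurable_fun setT G /\ weak_forward_upper_gradient d m T f G].
pose E (G : borel X -> \bar R) := \int[m]_z (G z `^ q).
have E0 G : 0 <= E G by apply: integral_ge0 => z _; exact: poweR_ge0.
have leE (G G' : borel X -> \bar R) : (forall z, 0 <= G z) ->
    (forall z, G z <= G' z) -> E G <= E G'.
  move=> G0 GG'; apply: ae_le_integral_raw => //.
  - by move=> z _; exact: poweR_ge0.
  - by move=> z _; exact: poweR_ge0.
  - by apply: aeW => z _; apply: le_poweR => //; exact: ltW.
pose I := ereal_inf (E @` W).
have IH : I <= E H by apply: ereal_inf_lbound; exists H.
have I0 : 0 <= I by apply: le_ereal_inf_tmp => _ [G _ <-].
have Ifin : I \is a fin_num by rewrite ge0_fin_numE// (le_lt_trans IH).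
have /choice[Gs Gs_prop] : forall n : nat, exists G, W G /\ E G < I + (n.+1%:R^-1)%:E.
  move=> n; have n0 : (0 < n.+1%:R^-1 :> R)%R by rewrite invr_gt0.
  have [_ [G WG <-] EG] := lb_ereal_inf_adherent n0 Ifin.
  by exists G.
have mGs n : measurable_fun setT (Gs n) by have [[]] := Gs_prop n.
have wGs n : weak_forward_upper_gradient d m T f (Gs n) by have [[]] := Gs_prop n.
pose G z := einfs (Gs ^~ z) 0%N.
have mG : measurable_fun setT G by exact: measurable_fun_einfs.
have wG : weak_forward_upper_gradient d m T f G by exact: weak_forward_upper_gradient_inf.
have [_ G0 _] := wG.
have EG : E G <= I.
  apply/lee_addgt0Pr => e e0.
  have [N _ HN] := near_infty_natSinv_lt (PosNum e0).
  have [_ /ltW EN] := Gs_prop N.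
  apply: (@le_trans _ _ (E (Gs N))).
    by apply: leE => // z; apply: ereal_inf_lbound; exists N.
  by apply: (le_trans EN); rewrite leeD2l// lee_fin ltW//; exact: (HN N (leqnn N)).
exists G; split => // G' wG'.
have [mG' G'0 _] := wG'.
have [G1 [mG1 GG1 G10 _]] := completed_measurable_fun_ae mG'.
have wG1 : weak_forward_upper_gradient d m T f G1.
  apply: (weak_forward_upper_gradient_ae wG' _ (G10 G'0) GG1).
  by apply: (ae_completed_measurable_fun mG1); exact: aeW.
(* [M] is a weak upper gradient below [G], so it has the same, finite energy; hence [G] and [M]
   agree almost everywhere, and [M] lies below the competitor. *)
have [M [mM wM MG MG1]] := weak_forward_upper_gradient_min mG mG1 wG wG1.
have [_ M0 _] := wM.
have mpow (F : borel X -> \bar R) : measurable_fun setT F ->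
    measurable_fun setT (fun z => F z `^ q).
  by move=> mF; exact: (measurableT_comp (measurable_poweR q) mF).
have IM : I <= E M by apply: ereal_inf_lbound; exists M.
have EMfin : E M < +oo by apply: (le_lt_trans (leE _ _ M0 MG)); exact: (le_lt_trans EG (le_lt_trans IH Hq)).
have aeGM : {ae m, forall z, setT z -> G z `^ q <= M z `^ q}.
  apply: ae_le_of_integral_ge => //; [exact: mpow|exact: mpow|..].
  - by move=> z; exact: poweR_ge0.
  - by move=> z; apply: le_poweR => //; exact: ltW.
  - exact: (le_trans EG IM).
apply: (ae_imp2 aeGM GG1) => z /(_ Logic.I) GM ->.
apply: le_trans (MG1 z).
have qK (x : \bar R) : 0 <= x -> (x `^ q) `^ q^-1 = x.
  by move=> x0; rewrite -poweRrM mulfV ?gt_eqF// poweRe1.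
rewrite -[leLHS]qK// -[leRHS]qK//; apply: le_poweR => //; last exact: poweR_ge0.
by rewrite invr_ge0 ltW.
Qed.

End WeakUpperGradients.

(** * Borel representatives and conclusion *)

Section SigmaFiniteMeasure.
Context d (T : measurableType d) (R : realType) (m : {measure set T -> \bar R}).
Hypothesis sfm : sigma_finite setT m.

Definition sigma_finite_copy of sigma_finite setT m : set T -> \bar R := m.

HB.instance Definition _ := Measure.copy (sigma_finite_copy sfm) m.
HB.instance Definition _ := Measure_isSigmaFinite.Build _ _ _ (sigma_finite_copy sfm) sfm.

End SigmaFiniteMeasure.

Lemma sigma_finite_measure_of d (T : measurableType d) (R : realType)
    (m : {measure set T -> \bar R}) : sigma_finite setT m ->
  exists ms : {sigma_finite_measure set T -> \bar R}, (ms : {measure set T -> \bar R}) = m.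
Proof. by move=> sfm; exists (sigma_finite_copy sfm); case: m sfm => ? [? ?]. Qed.

Lemma measurable_fun_select d (T : measurableType d) (R : realType)
    (k : T -> nat) (F : nat -> T -> R) :
  (forall n, measurable [set x | k x = n]) -> (forall n, measurable_fun setT (F n)) ->
  measurable_fun setT (fun x => F (k x) x).
Proof.
move=> mk mF _ B mB; rewrite setTI.
rewrite (_ : _ @^-1` B = \bigcup_n ([set x | k x = n] `&` F n @^-1` B)).
  apply: bigcupT_measurable => n; apply: measurableI => //.
  by rewrite -[X in measurable X]setTI; exact: mF.
apply/seteqP; split => [x /= Bx|x [n _ [/= <-]]//].
by exists (k x).
Qed.

(** All that is used of the Cheeger energy: it is finite, and below [relaxed_gradient] lie genuine
    relaxed ascending gradients of the truncations, selected by the value of [f]. *)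
Lemma Cheeger_gradients (R : realType) (X : ptopologicalType) (d : X -> X -> \bar R)
    (m : {measure set (borel X) -> \bar R}) (q : R) (f : X -> R) : 0 < q ->
  (Cheeger d m q f < +oo)%E ->
  (\int[m]_x (relaxed_gradient d m q f x `^ q) < +oo)%E /\
  exists U : nat -> X -> R,
    (forall N, relaxed_ascending_gradient d m q (truncation N f) (U N)) /\
    forall x, ((U (Num.bound (f x)) x)%:E <= relaxed_gradient d m q f x)%E.
Proof.
move=> q0; rewrite /Cheeger; case: asboolP => // HU Chfin; split.
  have I0 : (0 <= \int[m]_x (relaxed_gradient d m q f x `^ q))%E.
    by apply: integral_ge0 => x _; exact: poweR_ge0.
  move: Chfin; case: (\int[m]_x _)%E I0 => [r| |]// _.
    by move=> _; exact: ltry.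
  by rewrite mulry gtr0_sg ?invr_gt0// mul1e.
have /choice[U HU'] : forall N, exists U : X -> R,
    relaxed_ascending_gradient d m q (truncation N f) U /\
    forall x, ((U x)%:E <= Lq_relaxed_gradient d m q (truncation N f) x)%E.
  move=> N; have [_ [U0 HU0]] := HU N; rewrite /Lq_relaxed_gradient.
  (* Where there is no least gradient the value is [+oo], and any gradient will do. *)
  case: xgetP => [g _ [U [HU1 _] <-]|_]; first by exists U.
  by exists U0; split => // x; rewrite leey.
exists U; split => [N|x]; first by have [] := HU' N.
by have [_] := HU' (Num.bound (f x)); exact.
Qed.

Theorem proposition4p24 (R : realType) (X : ptopologicalType)
  (d : X -> X -> \bar R) (m : {measure set (borel X) -> \bar R})
  (V : X -> R) (p q : R)
  (T : set (probability (borel (curve R X)) R)) (f : X -> R)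
  (HX : forward_extended_Polish d)
  (Hm : sigma_finite [set: borel X] m)
  (HA1 : A1 d m V) (HA3 : A3 d)
  (Hp : 1 < p) (Hq : 1 < q) (Hpq : p^-1 + q^-1 = 1)
  (HT : forall eta, T eta -> test_plan d m p eta)
  (Hstretch : stretchable T)
  (Hcompr : forall eta, T eta -> forall M : R, 0 <= M ->
    exists2 C : R, 0 <= C & forall B : set (borel X), measurable B ->
      (\int[lebesgue_measure]_(t in unit_itv R)
         pushforward eta (ev t : borel (curve R X) -> borel X)
           (B `&` [set x | (V x <= M)%R])
       <= C%:E * m B)%E)
  (Hf : completed_measurable_fun m f)
  (HCh : (Cheeger d m q f < +oo)%E) :
  Sobolev_along T f /\
  (exists G, minimal_weak_forward_upper_gradient d m T f G) /\
  (forall G, minimal_weak_forward_upper_gradient d m T f G ->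
    {ae m, forall x, (G x <= relaxed_gradient d m q f x)%E}).
Proof.
have [ms msE] := sigma_finite_measure_of Hm; subst m.
have [[dF _] [sepX metX] _ lscd] := HX; have dA := dF.1.
have [mV _ _ Vcompact _] := HA1.
have q0 : 0 < q by exact: lt_trans Hq.
have [f0 [mf0 ff0 _]] := completed_measurable_fun_ae_real Hf.
have [rg_fin [U [HU Ule]]] := Cheeger_gradients q0 HCh.
have /choice[G HG] : forall N, exists G : borel X -> R,
    [/\ measurable_fun setT G, {ae ms, forall x, U N x = G x} & forall x, 0 <= G x].
  move=> N; have [_ [mU _] U0 _] := HU N.
  have [G [mG UG G0]] := completed_measurable_fun_ae_real mU.
  by exists G; split => //; exact: G0.
have mG N : measurable_fun setT (G N) by case: (HG N).
have UG N : {ae ms, forall x, U N x = G N x} by case: (HG N).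
have G0 N x : 0 <= G N x by case: (HG N).
(* A Borel function which is almost everywhere at most the relaxed gradient: it serves both as a
   weak upper gradient and as the competitor that bounds the minimal one. *)
pose H (z : borel X) := G (Num.bound (f0 z)) z.
have H0 z : 0 <= H z by exact: G0.
have mH : measurable_fun setT H.
  apply: (@measurable_fun_select _ (borel X) R (fun z => Num.bound (f0 z))) => // n.
  have mn : measurable_fun setT (fun z => `|f0 z|) by exact: measurableT_comp.
  (* [Num.bound] is the integer part of the absolute value plus one, so it never takes the value
     [0]. *)
  rewrite (_ : [set z | _] = (fun z => `|f0 z|) @^-1` [set t | (Num.truncn t).+1 = n])//.
  rewrite -[X in measurable X]setTI; apply: mn => //; case: n => [|n].
    by rewrite (_ : [set t | _] = set0)//; apply/seteqP; split.
  rewrite (_ : [set t | _] = [set t | Num.truncn t = n]); first exact: truncn_measurable.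
  by apply/seteqP; split => t /= => [[]|->].
have Hle : {ae ms, forall x, ((H x)%:E <= relaxed_gradient d ms q f x)%E}.
  apply: (ae_imp2 ff0 (ae_forall_countable UG)) => x fx UGx.
  by apply: le_trans (Ule x); rewrite /H -fx -UGx.
have Hq_fin : (\int[ms]_z (H z `^ q)%:E < +oo)%E.
  apply: le_lt_trans rg_fin; apply: ae_le_integral_raw => //.
  - by move=> z _; rewrite lee_fin powR_ge0.
  - by move=> z _; exact: poweR_ge0.
  - apply: (ae_imp Hle) => z Hz _; rewrite -poweR_EFin.
    have Hz0 : (0 <= (H z)%:E)%E by rewrite lee_fin.
    exact: (le_poweR (ltW q0) Hz0 Hz).
have mHE : measurable_fun setT (EFin \o H) by exact/measurable_EFinP.
have H0E z : (0 <= (EFin \o H) z)%E by rewrite lee_fin.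
have curves eta : T eta -> {ae eta, forall g,
    (\int[lebesgue_measure]_(r in unit_itv R) along d (EFin \o H) 1 g r < +oo)%E /\
    exists u b : R -> R, [/\ integrable_fun b, forall r, 0 <= b r,
      forall s t, u t - u s <= travel (unit_restrict (along d (EFin \o H) 1 g)) b s t,
      forall c : rat, 0 <= @ratr R c <= 1 -> u (ratr c) = f (ev (ratr c) g) &
      {ae (@lebesgue_measure R), forall r, 0 <= r <= 1 -> u r = f (ev r g)}]}.
  move=> Teta; have plan := HT eta Teta; have [_ etam] := plan.
  have rep := curve_representative sepX metX lscd dA Hp Hq Hpq mV Vcompact
    (Hcompr eta Teta) plan mf0 ff0 HU mG G0 UG mH Hq_fin.
  (* The null set where [f] and [f0] differ is avoided by almost every curve at all rational times
     and at almost every time, so the representative of [f0] along the curve is one of [f], end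
     points included. *)
  have pts : {ae eta, forall g, forall c : rat, 0 <= @ratr R c <= 1 ->
      f (ev (ratr c) g) = f0 (ev (ratr c) g)}.
    apply: ae_forall_countable => c.
    have [c01|nc] := boolP (0 <= @ratr R c <= 1); last exact: aeW.
    by apply: (ae_imp (ae_point etam c01 ff0)) => g /contrapT.
  apply: (ae_imp3 rep pts (ae_time metX etam ff0)) => g [fin [u [b [ib b0 ub uE uae]]]] fE fae.
  split => //; exists u, b; split => //.
  - by move=> c c01; rewrite uE// fE.
  - by apply: (ae_imp2 uae fae) => r ur fr r01; rewrite ur// (contrapT (fr r01)).
have al0 g r : (0 <= along d (EFin \o H) 1 g r)%E.
  by rewrite mule_ge0//; apply: speed_ge0; case: dA.
have mal g : measurable_fun setT (along d (EFin \o H) 1 g).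
  exact: (measurable_along sepX metX lscd g mHE).
have rat01 : [/\ @ratr R 0 = 0, @ratr R 1 = 1, 0 <= @ratr R 0 <= 1 & 0 <= @ratr R 1 <= 1].
  by rewrite rmorph0 rmorph1 !lexx ler01.
have [R0 R1 R001 R101] := rat01.
have wH : weak_forward_upper_gradient d ms T f (EFin \o H).
  apply/(@weak_forward_upper_gradient_along _ _ _ _ p) => //; first exact: ltW.
  move=> eta Teta; apply: (ae_imp (curves eta Teta)) => g [fin [u [b [_ _ ub uE _]]]].
  split => //; have := ub 0 1; rewrite /travel ler01.
  have := uE 0 R001; have := uE 1 R101; rewrite R0 R1 => -> ->.
  by rewrite -lee_fin -(integral_unit_restrict (mal g) (al0 g) fin).
split; [|split].
- move=> eta Teta; apply: (ae_imp (curves eta Teta)) => g [fin [u [b [ib b0 ub uE uae]]]].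
  have ia := integrable_unit_restrict (mal g) (al0 g) fin.
  have a0 := unit_restrict_ge0 (al0 g).
  exists u; split.
  + apply: (absolutely_continuous01_itv_int (integrable_funD ia ib)).
    exact: travel_norm.
  + by have := uE 0 R001; rewrite R0.
  + by have := uE 1 R101; rewrite R1.
  + by apply: (ae_imp uae) => r ur; rewrite in_itv/= => /andP[r0 r1]; rewrite ur// !ltW.
- apply: (minimal_weak_forward_upper_gradient_exists sepX metX lscd dA (ltW Hp) HT Hstretch
    _ q0 mHE wH Hq_fin).
  move=> eta Teta; apply: (ae_imp (curves eta Teta)) => g [fin [u [b [ib b0 ub uE _]]]].
  exists u, (unit_restrict (along d (EFin \o H) 1 g)), b; split => //.
    by split => //; exact: integrable_unit_restrict.
  by split => //; exact: unit_restrict_ge0.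
- move=> G1 [_ /(_ _ wH) G1H].
  by apply: (ae_imp2 G1H Hle) => x; exact: le_trans.
Qed.
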